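(* Let $M$ be a connected compact manifold of finite dimension $m\ge 3$, let $X$ be a $C^1$ vector field on $M$ (inwardly transverse to $\partial M$ if $\partial M\neq\emptyset$) with flow $X_t$. Let $\Gamma\subset M$ be a partially hyperbolic set for $X$ whose splitting $T_\Gamma M=E^s\oplus E^c\oplus E^u$ is dominated with subbundles of constant dimension and such that: $E^s$ is uniformly contracted; $E^c$ is $2$-dimensional and area expanding; $E^u$ is uniformly expanded; and $E^c\oplus E^u$ is strongly partially hyperbolic. Put $E=E^s$ and $F=E^c\oplus E^u$. Then $\Gamma$ admits a sectional-adapted metric, i.e. there exist a Riemannian metric on $T_\Gamma M$ with induced norm $|\cdot|$ and a constant $\lambda>0$ such that for all $x\in\Gamma$, all $t>0$ and all $2$-dimensional linear subspaces $L_x\subset F_x$ $$|DX_t|_{E_x}|\cdot|(DX_t|_{F_x})^{-1}|\le e^{-\lambda t},\qquad |DX_t|_{E_x}|\le e^{-\lambda t},\qquad |\det(DX_t|_{L_x})|\ge e^{\lambda t}.$$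
   Context: $\Gamma$ is a compact $X_t$-invariant set; fix a Riemannian metric on $M$ with norm $\|\cdot\|$. The splitting $T_\Gamma M=E^s\oplus E^c\oplus E^u$ is continuous and $DX_t$-invariant. Dominated: there are $K,\lambda>0$ such that $\|DX_t|_{E^s_x}\|\cdot\|DX_{-t}|_{E^c_{X_t(x)}}\|<Ke^{-\lambda t}$ and $\|DX_t|_{E^c_x}\|\cdot\|DX_{-t}|_{E^u_{X_t(x)}}\|<Ke^{-\lambda t}$ for all $x\in\Gamma$, $t>0$. $E^s$ uniformly contracted: $\|DX_t|_{E^s_x}\|\le Ce^{-\lambda t}$ for all $x\in\Gamma$, $t\ge0$ and some $C,\lambda>0$. $E^u$ uniformly expanded: $\|(DX_t|_{E^u_x})^{-1}\|\le Ce^{-\lambda t}$ for all $x\in\Gamma$, $t>0$ and some $C,\lambda>0$. $E^c$ area expanding: $|\det(DX_t|_{E^c_x})|>Ce^{\lambda t}$ for all $x\in\Gamma$, $t>0$ and some $C,\lambda>0$. $E^c\oplus E^u$ strongly partially hyperbolic: there are $K>0$ and $\mu>\lambda>0$ such that for each $t>0$ and $x\in\Gamma$, $\|DX_t|_{E^c_x}\|\le Ke^{\lambda t}$ and $\|DX_{-t}|_{E^u_{X_t(x)}}\|<Ke^{-\mu t}$. A Riemannian metric on $T_\Gamma M$ means a continuously varying family of inner products on the spaces $T_xM$, $x\in\Gamma$. Determinants and operator norms in the conclusion are computed with respect to the metric asserted to exist; $\det(DX_t|_{L_x})$ is the determinant of $DX_t:L_x\to DX_t(L_x)$. *)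

(* Defs.v *)
(* MathComp-Analysis, over an arbitrary [R : realType]. *)
From HB Require Import structures.
From mathcomp Require Import all_boot all_order all_algebra.
From mathcomp Require Import all_classical all_reals all_analysis.

Set Implicit Arguments.
Unset Strict Implicit.
Unset Printing Implicit Defensive.

Import Order.TTheory GRing.Theory Num.Theory.
Import numFieldNormedType.Exports.

Local Open Scope classical_set_scope.
Local Open Scope ring_scope.

Section Calculus.
Context {R : realType} {V W : normedModType R}.

(* Fréchet derivative relative to [D], so that it makes sense at boundary
   points of a half-space (where it is still unique). *)
Definition is_deriv_within (D : set V) (f : V -> W) (x : V) (L : V -> W) :=
  linear L /\
  forall e : R, 0 < e ->
    \forall y \near within D (nbhs x), `|f y - f x - L (y - x)| <= e * `|y - x|.

(* Class C^k relative to [D]; only used when [V] is finite-dimensional, so that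
   continuity of all the [df ^~ h] is continuity of [df] in operator norm. *)
Fixpoint Ck (k : nat) (D : set V) (f : V -> W) : Prop :=
  if k is k'.+1 then
    exists df : V -> V -> W,
      (forall x, D x -> is_deriv_within D f x (df x)) /\
      (forall h, Ck k' D (df ^~ h))
  else {within D, continuous f}.

End Calculus.

(* [cinv] is only meaningful on [cmap @` cdom]. *)
Record chart (R : realType) (m : nat) (M : Type) := Chart {
  cdom : set M;
  cmap : M -> 'rV[R]_m;
  cinv : 'rV[R]_m -> M }.

Section Charts.
Context {R : realType} {m : nat} {M : topologicalType}.
Implicit Types c d : chart R m M.

Definition halfspace : set 'rV[R]_m :=
  [set v | forall i : 'I_m, i = 0%N :> nat -> 0 <= v 0 i].

Definition is_chart c :=
  [/\ open (cdom c),
      exists2 O : set 'rV[R]_m, open O & cmap c @` cdom c = O `&` halfspace,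
      forall x, cdom c x -> cinv c (cmap c x) = x,
      {within cdom c, continuous (cmap c)} &
      {within cmap c @` cdom c, continuous (cinv c)}].

(* The map [f], defined on [S], read in the charts [c] and [d]. *)
Definition loc_map c d (f : M -> M) : 'rV[R]_m -> 'rV[R]_m :=
  fun v => cmap d (f (cinv c v)).

Definition loc_dom c d (S : set M) (f : M -> M) : set 'rV[R]_m :=
  cmap c @` [set y | [/\ cdom c y, S y & cdom d (f y)]].

(* Matrices act on row vectors from the right throughout. *)
Definition loc_diff c d (S : set M) (f : M -> M) (x : M) : 'M[R]_m :=
  get [set A : 'M[R]_m |
    is_deriv_within (loc_dom c d S f) (loc_map c d f) (cmap c x) (mulmxr A)].

End Charts.

(* Smooth m-manifold with (possibly empty) boundary on the space [M].
   The tangent space at [x] is modelled on R^m through the distinguished chart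
   [chart_at x]: an element of ['rV[R]_m] regarded as a tangent vector at [x]
   is its coordinate vector in that chart.  Regularity of sections is always
   tested in the charts of the atlas, after the change of coordinates
   [tcoord], so the choice of distinguished charts is immaterial. *)
Record smooth_manifold (R : realType) (m : nat) (M : topologicalType) := {
  mfd_hausdorff : hausdorff_space M;
  mfd_second_countable : @second_countable M;
  atlas : set (chart R m M);
  atlas_chart : forall c, atlas c -> is_chart c;
  atlas_smooth : forall c d, atlas c -> atlas d ->
    forall k, Ck k (loc_dom c d setT id) (loc_map c d id);
  chart_at : M -> chart R m M;
  chart_at_atlas : forall x, atlas (chart_at x);
  chart_at_dom : forall x, cdom (chart_at x) x }.

Section Manifold.
Context {R : realType} {m : nat} {M : topologicalType}.
Variable S : smooth_manifold R m M.

(* From coordinates in [chart_at S x] to coordinates in [c], on T_xM. *)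
Definition tcoord (c : chart R m M) (x : M) : 'M[R]_m :=
  loc_diff (chart_at S x) c setT id x.

Definition Ck_vector_field (k : nat) (X : M -> 'rV[R]_m) :=
  forall c, atlas S c ->
    Ck k (cmap c @` cdom c) (fun v => X (cinv c v) *m tcoord c (cinv c v)).

(* The boundary consists of the points whose 0-th coordinate vanishes in some
   (equivalently, any) chart of the atlas; X points strictly inward there. *)
Definition inward_transverse (X : M -> 'rV[R]_m) :=
  forall x c (i : 'I_m), atlas S c -> cdom c x -> i = 0%N :> nat ->
    cmap c x 0 i = 0 -> 0 < (X x *m tcoord c x) 0 i.

Definition integral_curve (X : M -> 'rV[R]_m) (J : set R) (gamma : R -> M) :=
  {within J, continuous gamma} /\
  forall t, J t ->
    is_deriv_within J (fun s => cmap (chart_at S (gamma t)) (gamma s)) t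
      (fun h : R => h *: X (gamma t)).

(* The closed interval with endpoints 0 and t, whatever the sign of t. *)
Definition seg (t : R) : set R :=
  [set s | Num.min 0 t <= s <= Num.max 0 t].

(* Points whose X-trajectory exists up to the (possibly negative) time t. *)
Definition flow_dom (X : M -> 'rV[R]_m) (t : R) : set M :=
  [set x | exists2 gamma : R -> M, gamma 0 = x & integral_curve X (seg t) gamma].

(* [phi t x] is X_t(x); its values off [flow_dom X t] are irrelevant.  On a
   compact manifold with boundary, trajectories of an inward field exist for all
   t >= 0, but may leave M in negative time.  The last clause is the joint C^1
   regularity of the flow of a C^1 field. *)
Record is_flow (X : M -> 'rV[R]_m) (phi : R -> M -> M) : Prop := {
  flow_forward : forall t x, 0 <= t -> flow_dom X t x;
  flow0 : forall x, phi 0 x = x;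
  flow_add : forall s t x, flow_dom X s x -> flow_dom X t (phi s x) ->
    flow_dom X (s + t) x /\ phi (s + t) x = phi t (phi s x);
  flow_integral : forall t x, flow_dom X t x ->
    integral_curve X (seg t) (phi ^~ x);
  flow_C1 : forall c d, atlas S c -> atlas S d ->
    Ck 1 [set p : R * 'rV[R]_m |
           [/\ (cmap c @` cdom c) p.2, flow_dom X p.1 (cinv c p.2) &
               cdom d (phi p.1 (cinv c p.2))]]
         (fun p => cmap d (phi p.1 (cinv c p.2))) }.

(* DX_t(x) : T_xM -> T_{X_t(x)}M. *)
Definition flow_diff (X : M -> 'rV[R]_m) (phi : R -> M -> M) (t : R) (x : M) :
    'M[R]_m :=
  loc_diff (chart_at S x) (chart_at S (phi t x)) (flow_dom X t) (phi t) x.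

Definition invariant_set (X : M -> 'rV[R]_m) (phi : R -> M -> M)
    (Gamma : set M) :=
  forall t, Gamma `<=` flow_dom X t /\ phi t @` Gamma = Gamma.

End Manifold.

Section LinearMetric.
Context {R : realType} {m : nat}.
Implicit Types (G H A : 'M[R]_m) (U : {vspace 'rV[R]_m}).

(* [G] is a Gram matrix. *)
Definition dotg G (v w : 'rV[R]_m) : R := (v *m G *m w^T) 0 0.

Definition inner_product G :=
  G^T = G /\ forall v : 'rV[R]_m, v != 0 -> 0 < dotg G v v.

Definition normg G (v : 'rV[R]_m) : R := Num.sqrt (dotg G v v).

Definition push A U : {vspace 'rV[R]_m} := (linfun (mulmxr A) @: U)%VS.

(* Operator norm of A|_U, with G on the source and H on the target. *)
Definition opnorm G H A U : R :=
  sup [set normg H (v *m A) | v in [set v | v \in U /\ normg G v <= 1]].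

Definition orthonormal_basis G U k (b : k.-tuple 'rV[R]_m) :=
  basis_of U b /\ forall i j, dotg G (tnth b i) (tnth b j) = (i == j)%:R.

(* |det (A : U -> A U)|, computed in orthonormal bases of U (for G) and of its
   image (for H); the value does not depend on the bases. *)
Definition absdet G H A U : R :=
  get [set d : R | exists b b' : (\dim U).-tuple 'rV[R]_m,
    [/\ orthonormal_basis G U b, orthonormal_basis H (push A U) b' &
        d = `|\det (\matrix_(i, j) dotg H (tnth b i *m A) (tnth b' j))|]].

End LinearMetric.

Section Bundles.
Context {R : realType} {m : nat} {M : topologicalType}.
Variable S : smooth_manifold R m M.
Implicit Types (g : M -> 'M[R]_m) (Gamma : set M).
Implicit Types E Es Ec Eu : M -> {vspace 'rV[R]_m}.

(* The Gram matrix at [x] in the coordinates of the chart [c]. *)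
Definition metric_in g (c : chart R m M) (x : M) : 'M[R]_m :=
  invmx (tcoord S c x) *m g x *m (invmx (tcoord S c x))^T.

Definition riemannian_metric g :=
  (forall x, inner_product (g x)) /\
  forall c, atlas S c -> forall k,
    Ck k (cmap c @` cdom c) (fun v => metric_in g c (cinv c v)).

Definition riemannian_metric_on Gamma g :=
  (forall x, Gamma x -> inner_product (g x)) /\
  forall c, atlas S c -> {within Gamma `&` cdom c, continuous (metric_in g c)}.

(* Continuous subbundle of T_Gamma M of rank k, via local frames. *)
Definition subbundle Gamma (k : nat) E :=
  forall x c, Gamma x -> atlas S c -> cdom c x ->
  exists (U : set M) (e : 'I_k -> M -> 'rV[R]_m),
    [/\ open U, U x, U `<=` cdom c,
        forall i, {within Gamma `&` U, continuous
                    (fun y => e i y *m tcoord S c y)} &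
        forall y, Gamma y -> U y ->
          basis_of (E y) [seq e i y | i <- enum 'I_k]].

Variables (X : M -> 'rV[R]_m) (phi : R -> M -> M).

Local Notation DX := (flow_diff S X phi).

(* ||DX_t|_{E_x}||, for E_x a subspace of T_xM *)
Definition normDX g (t : R) (x : M) E : R :=
  opnorm (g x) (g (phi t x)) (DX t x) (E x).

(* ||(DX_t|_{E_x})^{-1}||, the inverse being defined on DX_t(E_x). *)
Definition normDXV g (t : R) (x : M) E : R :=
  opnorm (g (phi t x)) (g x) (invmx (DX t x)) (push (DX t x) (E x)).

(* |det (DX_t|_L)|, for L a subspace of T_xM. *)
Definition detDX g (t : R) (x : M) (L : {vspace 'rV[R]_m}) : R :=
  absdet (g x) (g (phi t x)) (DX t x) L.

Definition invariant_bundle Gamma E :=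
  forall t x, Gamma x -> push (DX t x) (E x) = E (phi t x).

Definition splitting Gamma Es Ec Eu :=
  forall x, Gamma x ->
    (Es x + Ec x + Eu x)%VS = fullv /\ directv (Es x + Ec x + Eu x).

Definition dominated_splitting g Gamma Es Ec Eu :=
  exists K lambda : R, [/\ 0 < K, 0 < lambda &
    forall x t, Gamma x -> 0 < t ->
      normDX g t x Es * normDX g (- t) (phi t x) Ec < K * expR (- lambda * t) /\
      normDX g t x Ec * normDX g (- t) (phi t x) Eu < K * expR (- lambda * t)].

Definition uniformly_contracted g Gamma E :=
  exists C lambda : R, [/\ 0 < C, 0 < lambda &
    forall x t, Gamma x -> 0 <= t ->
      normDX g t x E <= C * expR (- lambda * t)].

Definition uniformly_expanded g Gamma E :=
  exists C lambda : R, [/\ 0 < C, 0 < lambda &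
    forall x t, Gamma x -> 0 < t ->
      normDXV g t x E <= C * expR (- lambda * t)].

Definition area_expanding g Gamma E :=
  exists C lambda : R, [/\ 0 < C, 0 < lambda &
    forall x t, Gamma x -> 0 < t ->
      C * expR (lambda * t) < detDX g t x (E x)].

Definition strongly_partially_hyperbolic g Gamma Ec Eu :=
  exists K lambda mu : R, [/\ 0 < K, 0 < lambda, lambda < mu &
    forall x t, Gamma x -> 0 < t ->
      normDX g t x Ec <= K * expR (lambda * t) /\
      normDX g (- t) (phi t x) Eu < K * expR (- mu * t)].

End Bundles.

(* Main.v *)
Require Import Defs.
From HB Require Import structures.
From mathcomp Require Import all_boot all_order all_algebra.
From mathcomp Require Import all_classical all_reals all_analysis.
From mathcomp Require Import perm ring lra.

Set Implicit Arguments.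
Unset Strict Implicit.
Unset Printing Implicit Defensive.

Import Order.TTheory GRing.Theory Num.Theory.
Import numFieldNormedType.Exports.

Local Open Scope classical_set_scope.
Local Open Scope ring_scope.

(** The metric is assembled from three orthogonal blocks, one for each
    summand of the splitting, so the work lies in choosing the blocks.

    Averaging with variable rates.  Let the squared length of every vector of
    an invariant bundle change over a time [T] by a factor that lies between
    [exp(2 T q(x))] and [exp(2 T p(x))], where [q <= p] are continuous on
    [Gamma].  The squared length is averaged over a window of length [2 tau]
    of future times, with weights that undo the growth at a rate slightly
    below [q] in the first half and slightly above [p] in the second half.
    The form so obtained grows along the orbit at a rate between [q] and [p], up to a
    small error and with no multiplicative constant ([avg_growth] on the line,
    [adapted_growth] on the bundle): when the average is differentiated, the
    two contributions of the middle of the window cancel and those of its two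
    ends are small for large [tau].  The rates have to be functions of the
    point, because domination compares the bundles at the same point only.
    All averages below use the same [tau], so that the integrals of different
    rates extend over the same piece of orbit.

    Rates on the plane bundle.  For a large [T], the change of area
    [area_growth] and the squared Hilbert-Schmidt norm [hs_growth] of
    [DX_T] on [Ec] give two continuous rates, [area_rate] and [hs_rate]; every
    vector of [Ec] is stretched at a rate between [area_rate - hs_rate] and
    [hs_rate].  The Hilbert-Schmidt norm is used in place of the operator
    norm because it is a rational expression in a local frame; the factor
    between the two is absorbed by [T].  Domination, contraction, expansion
    and area expansion at time [T] then say, for some [eps > 0], that [Es] has
    upper rate [min (- eps) (area_rate - hs_rate - eps)], that [Eu] has lower
    rate [max eps (hs_rate + eps)] and that [area_rate >= eps] ([rates]).

    The block of [Ec].  The averaged form of [Ec] is multiplied by the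
    positive function that makes its area element the geometric mean, over
    the times from [tau] to [tau + T], of the pulled back area elements.  Area
    then grows exactly by the integral of [area_rate], and the lower stretching
    rate [area_rate - hs_rate] survives the rescaling ([plane_adapted],
    [plane_rescale]).

    Sectional expansion.  For the sum of the forms of [Ec] and [Eu], the
    squared area of a pair of vectors of [Ec + Eu] is the sum of the two
    squared areas and of a mixed term that is bilinear and monotone in the two
    forms ([gram2D], [mix2_le]).  Its three terms grow at the respective rates
    [area_rate], twice the rate of [Eu], and
    [(area_rate - hs_rate) + (hs_rate + eps)], all of which are at least [eps]
    ([assembly_area]).

    The flow.  Continuity of the blocks rests on the joint continuity of
    [(t, x) |-> X_t(x)] for [t >= 0], which the regularity of the flow gives
    near time 0 and which compactness of [M] propagates to all times
    ([flow_continuous]), and on the continuity of [DX_t] read in charts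
    ([pulled_cvg]).  At a boundary point derivatives are taken within a
    half-space, where they are still unique ([deriv_within_unique]); hence
    the chain rule makes [DX_t] a cocycle, with [DX_{-t}] at [X_t(x)] the
    inverse of [DX_t] at [x] ([flow_diff_back]). *)

(** * Primitives and weighted averages on the line *)

Section RealDerivatives.
Context {R : realType}.
Implicit Types (f g : R -> R) (a b c t : R).

(** Derivative rules are stated for literal abstractions over [R] because the
    functions below occur in this form. *)
Lemma is_derive_constR c t : is_derive t 1 (fun=> c) (0 : R).
Proof. exact: (@is_derive_cst R R^o R^o). Qed.

Lemma is_derive_addR f g t a b : is_derive t 1 f a -> is_derive t 1 g b ->
  is_derive t 1 (fun s => f s + g s) (a + b).
Proof. by move=> fa gb; exact: (@is_deriveD R R^o R^o). Qed.

Lemma is_derive_subR f g t a b : is_derive t 1 f a -> is_derive t 1 g b ->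
  is_derive t 1 (fun s => f s - g s) (a - b).
Proof. by move=> fa gb; exact: (@is_deriveB R R^o R^o). Qed.

Lemma is_derive_mulR f g t a b : is_derive t 1 f a -> is_derive t 1 g b ->
  is_derive t 1 (fun s => f s * g s) (a * g t + f t * b).
Proof.
move=> fa gb; have h := @is_deriveM R R^o f g t 1 a b fa gb.
by apply: is_derive_eq h _; rewrite /GRing.scale/= addrC (mulrC a).
Qed.

Lemma is_derive_scaleR c f t a : is_derive t 1 f a -> is_derive t 1 (fun s => c * f s) (c * a).
Proof. by move=> fa; exact: (@is_deriveZ R R^o R^o). Qed.

Lemma is_derive_compR f g t a b : is_derive (g t) 1 f a -> is_derive t 1 g b ->
  is_derive t 1 (fun s => f (g s)) (a * b).
Proof.
by move=> fa gb; exact: is_derive1_comp.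
Qed.

Lemma is_derive_shiftR f c t a : is_derive (c + t) 1 f a ->
  is_derive t 1 (fun s => f (c + s)) a.
Proof.
move=> fa; rewrite -[a]mulr1; apply: (@is_derive_compR f (fun s => c + s)) => //.
by rewrite -[X in is_derive _ _ _ X]add0r; apply: is_derive_addR.
Qed.

Lemma is_derive_expR_comp f t a : is_derive t 1 f a ->
  is_derive t 1 (fun s => expR (f s)) (a * expR (f t)).
Proof. by move=> fa; rewrite mulrC; apply: (@is_derive_compR expR f) => //; exact: is_derive_expR. Qed.

End RealDerivatives.

Section Primitives.
Context {R : realType}.
Notation mu := (@lebesgue_measure R).
Implicit Types (f g F G : R -> R) (a b c t : R).

Lemma derive_nondecreasing F f a b : a <= b ->
  (forall t, a <= t <= b -> is_derive t 1 F (f t)) ->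
  (forall t, a <= t <= b -> 0 <= f t) -> F a <= F b.
Proof.
move=> ab dF f0.
have dF' x : x \in `]a, b[ -> is_derive x 1 F (f x).
  by rewrite in_itv/= => /andP[ax xb]; apply: dF; rewrite !ltW.
have cF : {within `[a, b], continuous F}.
  apply: derivable_within_continuous => x; rewrite in_itv/= => xab.
  by have [] := dF x xab.
have [c cab E] := MVT_segment ab dF' cF.
rewrite -subr_ge0 E mulr_ge0 ?subr_ge0 ?f0 //.
Qed.

(** Integration supplies primitives to the right of a base point only. The base
    point is moved to the left with [t]; the primitives for two base points
    differ by a constant, which is removed by normalizing at 0. *)
Lemma exists_primitive f : continuous f ->
  exists F, F 0 = 0 /\ forall t, is_derive t 1 F (f t).
Proof.
move=> cf.
pose J (a t : R) := (\int[mu]_(s in [set` `[a, t]]) f s)%R.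
have fi (a b : R) : mu.-integrable [set` `[a, b]] (EFin \o f).
  apply: continuous_compact_integrable; first exact: segment_compact.
  exact: continuous_subspaceT.
have dJ (a t : R) : a < t -> is_derive t 1 (J a) (f t).
  move=> lt_at; have tt1 : t < t + 1 by rewrite ltrDl.
  have [d e] := @continuous_FTC1_closed R f a t (t+1) tt1 (fi _ _) lt_at (cf t).
  exact: (DeriveDef d (etrans (esym (derive1E _ _)) e)).
have chasles (a b t u : R) : a <= b -> b <= t -> b <= u -> J a t - J a u = J b t - J b u.
  move=> ab bt bu.
  have E v : b <= v -> J a v = J a b + J b v.
    move=> bv; apply/eqP; rewrite addrC -subr_eq; apply/eqP.
    rewrite /J Rintegral_itvB ?bnd_simp// Rintegral_itv_obnd_cbnd//.
    by apply: integrableS (fi b v) => //; apply: subset_itvr; rewrite bnd_simp.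
  by rewrite (E t)// (E u)//; ring.
(* Near [t], this is the primitive based at [- (`|t| + 2)] up to a constant. *)
pose F t := J (- (`|t| + 1)) t - J (- (`|t| + 1)) 0.
exists F; split; first by rewrite /F subrr.
move=> t; pose a := - (`|t| + 2).
have [b1 b2] : (- `|t| <= t) /\ (t <= `|t|) by have := lexx `|t|; rewrite ler_norml => /andP.
have da : is_derive t 1 (fun s => J a s - J a 0) (f t - 0).
  by apply: is_derive_subR; apply: dJ; rewrite /a; lra.
rewrite subr0 in da.
apply: near_eq_is_derive da.
near=> s.
have [c1 c2] : (- `|s| <= s) /\ (s <= `|s|) by have := lexx `|s|; rewrite ler_norml => /andP.
have : `|s| < `|t| + 1.
  have : `|t - s| < 1 by near: s; apply: (@cvgr_dist_lt _ R^o) => //.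
  by have := ler_distD t s 0; rewrite !subr0 (distrC s t) => h1 h2; lra.
move=> st; rewrite /F.
have s0 := normr_ge0 s.
by apply: chasles; rewrite /a; lra.
Unshelve. all: by end_near. Qed.

(** A primitive on the whole line makes [Int] additive in its bounds by
    definition and differentiable in both of them, at every real number. *)
Definition prim f : R -> R :=
  get [set F | F 0 = 0 /\ forall t, is_derive t 1 F (f t)].

Lemma prim_spec f : continuous f ->
  prim f 0 = 0 /\ forall t, is_derive t 1 (prim f) (f t).
Proof.
move=> cf; have [F FP] := exists_primitive cf.
exact: (@getPex _ [set F | F 0 = 0 /\ forall t, is_derive t 1 F (f t)] (ex_intro _ F FP)).
Qed.

Lemma prim_derive f t : continuous f -> is_derive t 1 (prim f) (f t).
Proof. by move=> /prim_spec[]. Qed.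

Definition Int f a b := prim f b - prim f a.

Lemma Int_eq f F a b : continuous f -> a <= b ->
  (forall t, a <= t <= b -> is_derive t 1 F (f t)) -> Int f a b = F b - F a.
Proof.
move=> cf ab dF.
have E t : a <= t <= b -> is_derive t 1 (fun s => prim f s - F s) ((f t) - (f t)).
  move=> tab; have := prim_derive t cf; have := dF t tab => ? ?.
  exact: is_derive_subR.
have H1 := @derive_nondecreasing _ (fun t => f t - f t) _ _ ab E.
have E' t : a <= t <= b -> is_derive t 1 (fun s => F s - prim f s) ((f t) - (f t)).
  move=> tab; have := prim_derive t cf; have := dF t tab => ? ?.
  exact: is_derive_subR.
have H2 := @derive_nondecreasing _ (fun t => f t - f t) _ _ ab E'.
have z t : a <= t <= b -> 0 <= f t - f t by rewrite subrr.
have := H1 z; have := H2 z; rewrite /Int; lra.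
Qed.

Lemma Int_split f b a c : Int f a c = Int f a b + Int f b c.
Proof. rewrite /Int; ring. Qed.

Lemma Int_le f g a b : continuous f -> continuous g -> a <= b ->
  (forall t, a <= t <= b -> f t <= g t) -> Int f a b <= Int g a b.
Proof.
move=> cf cg ab fg.
have : prim g a - prim f a <= prim g b - prim f b; last by rewrite /Int; lra.
apply: (@derive_nondecreasing (fun s => prim g s - prim f s) (fun t => g t - f t)) => // t tab.
  by have := prim_derive t cf; have := prim_derive t cg => ? ?; exact: is_derive_subR.
by rewrite subr_ge0 fg.
Qed.

Lemma Int_congr f g a b : continuous f -> continuous g -> a <= b ->
  (forall t, a <= t <= b -> f t = g t) -> Int f a b = Int g a b.
Proof.
move=> cf cg ab fg; apply/eqP; rewrite eq_le !Int_le // => t /fg -> //.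
Qed.

Lemma Int_cst (c a b : R) : a <= b -> Int (fun=> c) a b = c * (b - a).
Proof.
move=> ab; have dF t : a <= t <= b -> is_derive t 1 (fun s => c * s) c.
  by move=> _; rewrite -[X in is_derive _ _ _ X]mulr1; apply: is_derive_scaleR.
rewrite (Int_eq _ ab dF); first by ring.
by move=> t; exact: cvg_cst.
Qed.

Lemma IntD f g a b : continuous f -> continuous g -> a <= b ->
  Int (fun t => f t + g t) a b = Int f a b + Int g a b.
Proof.
move=> cf cg ab.
have dF t : a <= t <= b -> is_derive t 1 (fun s => prim f s + prim g s) (f t + g t).
  by move=> _; have := prim_derive t cf; have := prim_derive t cg => ? ?; exact: is_derive_addR.
rewrite (Int_eq _ ab dF); first by rewrite /Int; ring.
by move=> t; apply: continuousD; [exact: cf|exact: cg].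
Qed.

Lemma IntZ c f a b : continuous f -> a <= b ->
  Int (fun t => c * f t) a b = c * Int f a b.
Proof.
move=> cf ab.
have dF t : a <= t <= b -> is_derive t 1 (fun s => c * prim f s) (c * f t).
  by move=> _; have := prim_derive t cf => ?; exact: is_derive_scaleR.
rewrite (Int_eq _ ab dF); first by rewrite /Int; ring.
by move=> t; apply: continuousM; [exact: cvg_cst|exact: cf].
Qed.

Lemma Int_shift f c a b : continuous f -> a <= b ->
  Int (fun t => f (c + t)) a b = Int f (c + a) (c + b).
Proof.
move=> cf ab.
have dF t : a <= t <= b -> is_derive t 1 (fun s => prim f (c + s)) (f (c + t)).
  by move=> _; apply: is_derive_shiftR; exact: prim_derive.
rewrite (Int_eq _ ab dF) // => t; apply: continuous_comp; last exact: cf.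
by apply: continuousD; [exact: cvg_cst|exact: cvg_id].
Qed.

End Primitives.

Section AdaptedGrowth.
Context {R : realType}.
Implicit Types (s t r : R).
Variables (f p q : R -> R) (T C B d tau : R).
Hypothesis (cf : continuous f) (cp : continuous p) (cq : continuous q).
Hypothesis f0 : forall r, 0 < f r.
Hypothesis T1 : 1 <= T.
Hypothesis C1 : 1 <= C.
Hypothesis fC : forall r s, 0 <= r -> 0 <= s <= T ->
  f r <= C * f (r + s) /\ f (r + s) <= C * f r.
Hypothesis fT : forall r, 0 <= r ->
  expR (2 * T * q r) * f r <= f (r + T) <= expR (2 * T * p r) * f r.
Hypothesis pB : forall r, p r <= B.
Hypothesis qp : forall r, q r <= p r.
Hypothesis B0 : 0 <= B.
Hypothesis d0 : 0 < d.
Hypothesis tau1 : 1 <= tau.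
Hypothesis tauP : C ^+ 3 * expR (2 * (B + d)) * expR (- (2 * d * tau)) <= 2 * d.

Let P := prim p.
Let Q := prim q.
Let a t := expR (2 * P t + 2 * d * t).
Let b t := expR (2 * Q t - 2 * d * t).

Let da t : is_derive t 1 a ((2 * p t + 2 * d) * a t).
Proof.
apply: is_derive_expR_comp; apply: is_derive_addR; first by apply: is_derive_scaleR; exact: prim_derive.
by rewrite -[X in is_derive _ _ _ X]mulr1; apply: is_derive_scaleR.
Qed.

Let db t : is_derive t 1 b ((2 * q t - 2 * d) * b t).
Proof.
apply: is_derive_expR_comp; apply: is_derive_subR; first by apply: is_derive_scaleR; exact: prim_derive.
by rewrite -[X in is_derive _ _ _ X]mulr1; apply: is_derive_scaleR.
Qed.

(** The logarithm of [f] changes by a controlled amount only over times [T];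
    its mean over a window of length [T] is differentiable, and the bounds on
    [f (t + T) / f t] become bounds on its derivative. *)
Let L t := T^-1 * Int (fun r => ln (f r)) t (t + T).

Let clnf : continuous (fun r => ln (f r)).
Proof. by move=> r; apply: continuous_comp; [exact: cf|exact: continuous_ln]. Qed.

Let T0 : 0 < T. Proof. exact: lt_le_trans T1. Qed.

Let dL t : is_derive t 1 L (T^-1 * (ln (f (t + T)) - ln (f t))).
Proof.
apply: is_derive_scaleR; apply: is_derive_subR; last exact: prim_derive.
have h := prim_derive (T + t) clnf.
rewrite addrC; have -> : (fun s => prim (fun r => ln (f r)) (s + T)) =
  (fun s => prim (fun r => ln (f r)) (T + s)) by apply/funext => s; rewrite addrC.
exact: is_derive_shiftR.
Qed.

Let L_f t : 0 <= t -> `|L t - ln (f t)| <= ln C.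
Proof.
move=> t0; have C0 : 0 < C by exact: lt_le_trans C1.
have tT : t <= t + T by rewrite lerDl ltW.
have E (c : R) : T^-1 * Int (fun=> c) t (t + T) = c.
  by rewrite Int_cst// addrAC subrr add0r mulrC mulfK// gt_eqF.
have H r : t <= r <= t + T -> ln (f t) - ln C <= ln (f r) <= ln (f t) + ln C.
  move=> /andP[tr rt]; have /= := @fC t (r - t) t0 _.
  rewrite (addrC t (r - t)) subrK subr_ge0 tr/= lerBlDl => /(_ rt)[h1 h2].
  have a1 : ln (f t) <= ln C + ln (f r).
    by rewrite -lnM ?posrE// ler_ln ?posrE ?mulr_gt0.
  have a2 : ln (f r) <= ln C + ln (f t).
    by rewrite -lnM ?posrE// ler_ln ?posrE ?mulr_gt0.
  lra.
have cc (c : R) : continuous (fun _ : R => c) by move=> ?; exact: cvg_cst.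
have T0' : 0 <= T^-1 by rewrite invr_ge0 ltW.
rewrite ler_distl /L; apply/andP; split.
  by rewrite -[X in X <= _]E; apply: ler_wpM2l => //; apply: (Int_le (cc _) clnf tT) => r /H /andP[].
by rewrite -[X in _ <= X]E; apply: ler_wpM2l => //; apply: (Int_le clnf (cc _) tT) => r /H /andP[].
Qed.

Let L_mono s t : 0 <= s -> s <= t ->
  2 * (Q t - Q s) <= L t - L s <= 2 * (P t - P s).
Proof.
move=> s0 st.
have H r : s <= r <= t -> 2 * q r <= T^-1 * (ln (f (r + T)) - ln (f r)) <= 2 * p r.
  move=> /andP[sr _]; have /andP[h1 h2] := fT (le_trans s0 sr).
  have a1 : 2 * T * q r + ln (f r) <= ln (f (r + T)).
    by rewrite -[X in X + _]expRK -lnM ?posrE ?expR_gt0// ler_ln ?posrE ?mulr_gt0 ?expR_gt0.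
  have a2 : ln (f (r + T)) <= 2 * T * p r + ln (f r).
    by rewrite -[2 * T * p r]expRK -lnM ?posrE ?expR_gt0// ler_ln ?posrE ?mulr_gt0 ?expR_gt0.
  by rewrite [T^-1 * _]mulrC ler_pdivlMr// ler_pdivrMr//; apply/andP; split; lra.
apply/andP; split.
  have : L s - 2 * Q s <= L t - 2 * Q t; last by lra.
  apply: (@derive_nondecreasing _ (fun r => L r - 2 * Q r)
    (fun r => T^-1 * (ln (f (r + T)) - ln (f r)) - 2 * q r)) => // r rst.
    by have h1 := @is_derive_scaleR _ 2 _ _ _ (prim_derive r cq); have h2 := dL r; exact: is_derive_subR.
  by rewrite subr_ge0; have /andP[] := H r rst.
have : 2 * P s - L s <= 2 * P t - L t; last by lra.
apply: (@derive_nondecreasing _ (fun r => 2 * P r - L r)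
  (fun r => 2 * p r - T^-1 * (ln (f (r + T)) - ln (f r)))) => // r rst.
  by have h1 := @is_derive_scaleR _ 2 _ _ _ (prim_derive r cp); have h2 := dL r; exact: is_derive_subR.
by rewrite subr_ge0; have /andP[] := H r rst.
Qed.

Let growth s t : 0 <= s -> s <= t ->
  f t <= C ^+ 2 * f s * expR (2 * (P t - P s)) /\
  f s * expR (2 * (Q t - Q s)) <= C ^+ 2 * f t.
Proof.
move=> s0 st; have t0 := le_trans s0 st.
have C0 : 0 < C by exact: lt_le_trans C1.
have /andP[m1 m2] := L_mono s0 st.
have := L_f s0; have := L_f t0; rewrite !ler_distl => /andP[h1 h2] /andP[h3 h4].
have lnE (x y : R) : 0 < x -> 0 < y -> (x <= y) = (ln x <= ln y).
  by move=> x0 y0; rewrite ler_ln ?posrE.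
have C2 : 0 < C ^+ 2 by rewrite exprn_gt0.
have lC2 : ln (C ^+ 2) = ln C + ln C by rewrite expr2 lnM.
have lM (x y : R) : 0 < x -> 0 < y -> ln (x * y) = ln x + ln y by move=> ? ?; rewrite lnM.
have fs := f0 s; have ft := f0 t.
have ep := expR_gt0 (2 * (P t - P s)); have eq := expR_gt0 (2 * (Q t - Q s)).
split.
  rewrite lnE//; last by rewrite !mulr_gt0.
  by rewrite !lM ?mulr_gt0// expRK ?lC2; lra.
rewrite lnE ?mulr_gt0//.
by rewrite !lM// expRK ?lC2; lra.
Qed.

(** The first half of the window is discounted at the rate [q - d] and the
    second one at the rate [p + d]; both weights are equal to 1 at its middle
    [t + tau], so that the values of [f] there cancel in the derivative. *)
Definition avg t :=
  b (t + tau) * Int (fun r => f r / b r) t (t + tau) +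
  a (t + tau) * Int (fun r => f r / a r) (t + tau) (t + tau + tau).

Let a0 t : 0 < a t. Proof. exact: expR_gt0. Qed.
Let b0 t : 0 < b t. Proof. exact: expR_gt0. Qed.

Let cdiv (h k : R -> R) : (forall t, 0 < k t) ->
  (forall t, derivable k t 1) -> continuous h -> continuous (fun t => h t / k t).
Proof.
move=> k0 dk ch t; apply: (@continuousM R R h (fun t => (k t)^-1)); first exact: ch.
apply: (@continuousV R R k); first by rewrite gt_eqF.
exact/differentiable_continuous/derivable1_diffP.
Qed.

Let cfa : continuous (fun r => f r / a r).
Proof. by apply: cdiv => // t; have [] := da t. Qed.

Let cfb : continuous (fun r => f r / b r).
Proof. by apply: cdiv => // t; have [] := db t. Qed.

Let I1 t := b (t + tau) * Int (fun r => f r / b r) t (t + tau).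
Let I2 t := a (t + tau) * Int (fun r => f r / a r) (t + tau) (t + tau + tau).

Let dshiftr (h : R -> R) (c t x : R) : is_derive (t + c) 1 h x ->
  is_derive t 1 (fun s => h (s + c)) x.
Proof.
move=> hx; have -> : (fun s => h (s + c)) = (fun s => h (c + s)).
  by apply/funext => s; rewrite addrC.
by apply: is_derive_shiftR; rewrite addrC.
Qed.

Let davg t : is_derive t 1 avg
  ((2 * q (t + tau) - 2 * d) * I1 t + (2 * p (t + tau) + 2 * d) * I2 t +
   (a (t + tau) * (f (t + tau + tau) / a (t + tau + tau)) -
    b (t + tau) * (f t / b t))).
Proof.
have d1 := dshiftr (da (t + tau)); have d2 := dshiftr (db (t + tau)).
have i1 : is_derive t 1 (fun s => Int (fun r => f r / b r) s (s + tau))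
   (f (t + tau) / b (t + tau) - f t / b t).
  have h1 := prim_derive t cfb; have h2 := dshiftr (prim_derive (t + tau) cfb).
  exact: is_derive_subR.
have i2 : is_derive t 1 (fun s => Int (fun r => f r / a r) (s + tau) (s + tau + tau))
   (f (t + tau + tau) / a (t + tau + tau) - f (t + tau) / a (t + tau)).
  have h1 := dshiftr (prim_derive (t + tau) cfa).
  have h2 := prim_derive (t + tau + tau) cfa.
  have h3 := dshiftr (dshiftr h2).
  exact: is_derive_subR.
have k1 := is_derive_mulR d2 i1; have k2 := is_derive_mulR d1 i2.
apply: is_derive_eq (is_derive_addR k1 k2) _.
rewrite /I1 /I2.
have na := gt_eqF (a0 (t + tau)); have nb := gt_eqF (b0 (t + tau)).
have e1 : b (t + tau) * (f (t + tau) / b (t + tau)) = f (t + tau) by rewrite mulrC divfK// nb.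
have e2 : a (t + tau) * (f (t + tau) / a (t + tau)) = f (t + tau) by rewrite mulrC divfK// na.
rewrite !mulrBr e1 e2; ring.
Qed.

Let I1_ge0 t : 0 <= I1 t.
Proof.
apply: mulr_ge0; first exact: ltW.
have tt : t <= t + tau by rewrite lerDl; apply: le_trans tau1.
rewrite -[X in X <= _](mul0r (t + tau - t)) -(Int_cst _ tt).
apply: Int_le => //; first by move=> ?; exact: cvg_cst.
by move=> r _; rewrite divr_ge0// ltW.
Qed.

Let I2_ge t : 0 <= t -> C^-1 * expR (- (2 * (B + d))) * f (t + tau) <= I2 t.
Proof.
move=> t0; set u := t + tau.
have tau1' := tau1; have d0' := d0; have B0' := B0; have T1' := T1.
have u0 : 0 <= u by rewrite /u; lra.
have C0 : 0 < C by exact: lt_le_trans C1.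
have cc (c : R) : continuous (fun _ : R => c) by move=> ?; exact: cvg_cst.
rewrite /I2 -/u (Int_split _ (u + 1)) [a u * _]mulrDr -[X in X <= _]addr0; apply: lerD; last first.
  apply: mulr_ge0; first exact: ltW.
  rewrite -[X in X <= _](mul0r (u + tau - (u + 1))) -Int_cst; last by lra.
  apply: Int_le => //; first by lra.
  by move=> r _; rewrite divr_ge0// ltW.
rewrite [a u * _]mulrC -(ler_pdivrMr _ _ (a0 u)).
set c := (X in X <= _).
have -> : c = c * (u + 1 - u) by rewrite addrAC subrr add0r mulr1.
rewrite -Int_cst ?lerDl//. apply: Int_le => //; first by rewrite lerDl.
move=> r /andP[ur ru].
have rT : 0 <= r - u <= T by apply/andP; split; lra.
have [h1 _] := fC u0 rT; rewrite addrC subrK in h1.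
have Pr : P r - P u <= B * (r - u).
  rewrite -(Int_cst B ur); exact: Int_le.
have Pr1 : B * (r - u) <= B by rewrite ler_piMr//; lra.
have E : a r <= expR (2 * (B + d)) * a u.
  rewrite -expRD ler_expR.
  have : d * (r - u) <= d by rewrite ler_piMr//; [exact: ltW|lra].
  lra.
rewrite ler_pdivlMr// /c expRN; set X := expR _ in E *.
have X0 : 0 < X by exact: expR_gt0.
have e1 : C^-1 * f u <= f r by rewrite mulrC ler_pdivrMr// mulrC.
have e2 : X^-1 * a r / a u <= 1 by rewrite ler_pdivrMr// mul1r mulrC ler_pdivrMr// mulrC.
have -> : C^-1 * X^-1 * f u / a u * a r = (C^-1 * f u) * (X^-1 * a r / a u) by ring.
apply: le_trans e1; rewrite ler_piMr// mulr_ge0 ?invr_ge0// ltW//.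
Qed.

(** The ends of the window lie at distance [tau] from its middle, and the
    margin [d] in the weights makes them exponentially small in [tau]. *)
Let edge t : 0 <= t ->
  a (t + tau) * (f (t + tau + tau) / a (t + tau + tau)) <= 2 * d * I2 t /\
  b (t + tau) * (f t / b t) <= 2 * d * I2 t.
Proof.
move=> t0; set u := t + tau.
have tau1' := tau1; have d0' := d0; have B0' := B0.
have u0 : 0 <= u by rewrite /u; lra.
have C0 : 0 < C by exact: lt_le_trans C1.
have tu : t <= u by rewrite /u; lra.
have uu : u <= u + tau by lra.
have X0 := expR_gt0 (2 * (B + d)); have Y0 := expR_gt0 (- (2 * d * tau)).
have fu := f0 u.
have key : C ^+ 2 * expR (- (2 * d * tau)) * f u <= 2 * d * I2 t.
  apply: le_trans (_ : 2 * d * (C^-1 * expR (- (2 * (B + d))) * f u) <= _); last first.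
    by rewrite ler_pM2l ?mulr_gt0//; exact: I2_ge.
  rewrite [expR (- (2 * (B + d)))]expRN !mulrA ler_pM2r// ler_pdivlMr// ler_pdivlMr//.
  by apply: le_trans tauP; rewrite le_eqVlt; apply/orP; left; apply/eqP; ring.
have [_ g2] := growth t0 tu; have [g1 _] := growth u0 uu.
split; apply: le_trans key.
  have -> : expR (- (2 * d * tau)) = a u * expR (2 * (P (u + tau) - P u)) / a (u + tau).
    rewrite /a -expRN -!expRD; congr expR; ring.
  rewrite mulrA ler_pdivrMr// mulrC.
  have -> : C ^+ 2 * (a u * expR (2 * (P (u + tau) - P u)) / a (u + tau)) * f u * a (u + tau)
     = (C ^+ 2 * f u * expR (2 * (P (u + tau) - P u))) * a u * ((a (u + tau))^-1 * a (u + tau)) by ring.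
  by rewrite mulVf ?gt_eqF// mulr1 ler_pM2r.
have -> : b u * (f t / b t) = f t * expR (2 * (Q u - Q t)) * expR (- (2 * d * tau)).
  have -> : b u * (f t / b t) = f t * (b u / b t) by ring.
  rewrite -mulrA; congr (_ * _); rewrite /b -expRN -!expRD; congr expR; rewrite /u; ring.
by rewrite [X in _ <= X]mulrAC ler_pM2r.
Qed.

(** The logarithmic derivative of the average is [2 q - 2 d] on the first half
    and [2 p + 2 d] on the second one, up to the terms of the two ends, which
    [edge] bounds by [2 d] times the average; both values lie between [2 q - 4
    d] and [2 p + 4 d]. *)
Lemma avg_growth t : 0 <= t ->
  expR (2 * (Q (t + tau) - Q tau) - 4 * d * t) * avg 0 <= avg t /\
  avg t <= expR (2 * (P (t + tau) - P tau) + 4 * d * t) * avg 0.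
Proof.
move=> t0.
have d0' := d0.
have avgE s : avg s = I1 s + I2 s by [].
pose avg' s := (2 * q (s + tau) - 2 * d) * I1 s + (2 * p (s + tau) + 2 * d) * I2 s +
  (a (s + tau) * (f (s + tau + tau) / a (s + tau + tau)) - b (s + tau) * (f s / b s)).
have davg' s : is_derive s 1 avg (avg' s) by exact: davg.
have dQ s : is_derive s 1 (fun r => Q (r + tau)) (q (s + tau)).
  by apply: dshiftr; exact: prim_derive.
have dP s : is_derive s 1 (fun r => P (r + tau)) (p (s + tau)).
  by apply: dshiftr; exact: prim_derive.
have lin (c : R) s : is_derive s 1 (fun r => c * r) c.
  by rewrite -[X in is_derive _ _ _ X]mulr1; apply: is_derive_scaleR.
split.
  pose E s := expR (- (2 * Q (s + tau) - 4 * d * s)).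
  have dE s : is_derive s 1 E ((0 - (2 * q (s + tau) - 4 * d)) * E s).
    apply: is_derive_expR_comp.
    have h1 := @is_derive_scaleR _ 2 _ _ _ (dQ s); have h2 := lin (4 * d) s.
    have h3 := is_derive_subR h1 h2; have := is_derive_subR (is_derive_constR 0 s) h3.
    by apply: near_eq_is_derive; near=> r; rewrite sub0r.
  pose k s := avg s * E s.
  have dk s : is_derive s 1 k (avg' s * E s + avg s * ((0 - (2 * q (s + tau) - 4 * d)) * E s)).
    exact: (is_derive_mulR (davg' s) (dE s)).
  have : k 0 <= k t.
    apply: (derive_nondecreasing t0 (fun s _ => dk s)) => s /andP[s0 _].
    have [e1 e2] := edge s0; rewrite /avg' avgE.
    have := I1_ge0 s; have E0 : 0 < E s by exact: expR_gt0.
    have e3 : 0 <= a (s + tau) * (f (s + tau + tau) / a (s + tau + tau)).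
      by rewrite mulr_ge0 ?divr_ge0// ltW.
    set x1 := a _ * _ in e1 e3 *; set x2 := b _ * _ in e2 *.
    have qp' := qp (s + tau); move=> i1.
    have i2 : 0 <= (p (s + tau) - q (s + tau)) * I2 s.
      rewrite mulr_ge0 ?subr_ge0//; apply: le_trans (I2_ge s0).
      by rewrite !mulr_ge0 ?invr_ge0 ?expR_ge0// ?(ltW (f0 _))// (le_trans _ C1).
    have i3 : 0 <= d * I1 s by rewrite mulr_ge0// ltW.
    have i4 : 0 <= d * I2 s.
      rewrite mulr_ge0//; first exact: ltW.
      apply: le_trans (I2_ge s0).
      by rewrite !mulr_ge0 ?invr_ge0 ?expR_ge0// ?(ltW (f0 _))// (le_trans _ C1).
    rewrite [(_ + _) * (_ * E s)]mulrA -mulrDl pmulr_lge0//.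
    lra.
  rewrite /k => h; rewrite -(ler_pM2r (expR_gt0 (- (2 * Q (t + tau) - 4 * d * t)))).
  apply: le_trans h; rewrite le_eqVlt; apply/orP; left; apply/eqP.
  rewrite mulrAC -expRD mulrC /E; congr (_ * expR _); rewrite add0r; ring.
pose E s := expR (- (2 * P (s + tau) + 4 * d * s)).
have dE s : is_derive s 1 E ((0 - (2 * p (s + tau) + 4 * d)) * E s).
  apply: is_derive_expR_comp.
  have h1 := @is_derive_scaleR _ 2 _ _ _ (dP s); have h2 := lin (4 * d) s.
  have h3 := is_derive_addR h1 h2; have := is_derive_subR (is_derive_constR 0 s) h3.
  by apply: near_eq_is_derive; near=> r; rewrite sub0r.
pose k s := 0 - avg s * E s.
have dk s : is_derive s 1 k (0 - (avg' s * E s + avg s * ((0 - (2 * p (s + tau) + 4 * d)) * E s))).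
  exact: (is_derive_subR (is_derive_constR 0 s) (is_derive_mulR (davg' s) (dE s))).
have : k 0 <= k t.
  apply: (derive_nondecreasing t0 (fun s _ => dk s)) => s /andP[s0 _].
  have [e1 e2] := edge s0; rewrite /avg' avgE.
  have := I1_ge0 s; have E0 : 0 < E s by exact: expR_gt0.
  have e3 : 0 <= b (s + tau) * (f s / b s).
    by rewrite mulr_ge0 ?divr_ge0// ltW.
  set x1 := a _ * _ in e1 *; set x2 := b _ * _ in e2 e3 *.
  have qp' := qp (s + tau); move=> i1.
  have i2 : 0 <= (p (s + tau) - q (s + tau)) * I1 s by rewrite mulr_ge0 ?subr_ge0.
  have i3 : 0 <= d * I1 s by rewrite mulr_ge0// ltW.
  rewrite [(_ + _) * (_ * E s)]mulrA -mulrDl sub0r -mulNr pmulr_lge0//.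
  lra.
rewrite /k !sub0r lerN2.
move=> h; rewrite -(ler_pM2r (expR_gt0 (- (2 * P (t + tau) + 4 * d * t)))).
apply: le_trans h _; rewrite le_eqVlt; apply/orP; left; apply/eqP.
rewrite mulrAC -expRD mulrC /E; congr (expR _ * _); rewrite add0r; ring.
Unshelve. all: by end_near. Qed.

End AdaptedGrowth.

Section AvgAlgebra.
Context {R : realType}.
Implicit Types (f p q : R -> R) (t r d tau : R).

Lemma continuous_prim f : continuous f -> continuous (prim f).
Proof.
move=> cf t; have [df _] := prim_derive t cf.
exact/differentiable_continuous/derivable1_diffP.
Qed.

Lemma prim_Int f t : continuous f -> prim f t = Int f 0 t.
Proof. by move=> cf; rewrite /Int (prim_spec cf).1 subr0. Qed.

Lemma continuous_scal (c : R) f : continuous f -> continuous (fun r => c * f r).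
Proof. by move=> cf r; apply: (@continuousM R R (fun=> c) f); [exact: cvg_cst|exact: cf]. Qed.

Definition weight_up p d t := expR (2 * prim p t + 2 * d * t).
Definition weight_down q d t := expR (2 * prim q t - 2 * d * t).

Lemma avgE f p q d tau t : avg f p q d tau t =
  weight_down q d (t + tau) * Int (fun r => f r / weight_down q d r) t (t + tau) +
  weight_up p d (t + tau) * Int (fun r => f r / weight_up p d r) (t + tau) (t + tau + tau).
Proof. by []. Qed.

Lemma continuous_weight_up p d : continuous p -> continuous (weight_up p d).
Proof.
move=> cp t; apply: continuous_comp; last exact: continuous_expR.
apply: continuousD; apply: continuousM; try exact: cvg_cst; last exact: cvg_id.
exact: continuous_prim.
Qed.

Lemma continuous_weight_down p d : continuous p -> continuous (weight_down p d).
Proof.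
move=> cp t; apply: continuous_comp; last exact: continuous_expR.
apply: continuousB; apply: continuousM; try exact: cvg_cst; last exact: cvg_id.
exact: continuous_prim.
Qed.

Lemma weight_up_gt0 p d t : 0 < weight_up p d t. Proof. exact: expR_gt0. Qed.
Lemma weight_down_gt0 p d t : 0 < weight_down p d t. Proof. exact: expR_gt0. Qed.

Lemma continuous_div (h k : R -> R) : (forall t, 0 < k t) ->
  continuous h -> continuous k -> continuous (fun t => h t / k t).
Proof.
move=> k0 ch ck t; apply: (@continuousM R R h (fun t => (k t)^-1)); first exact: ch.
by apply: (@continuousV R R k); [rewrite gt_eqF|exact: ck].
Qed.

Lemma avgD f1 f2 p q d tau t : 0 <= tau -> continuous p -> continuous q ->
  continuous f1 -> continuous f2 ->
  avg (fun r => f1 r + f2 r) p q d tau t = avg f1 p q d tau t + avg f2 p q d tau t.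
Proof.
move=> tau0 cp cq c1 c2.
have cwa := @continuous_weight_up p d cp; have cwb := @continuous_weight_down q d cq.
have ga := @weight_up_gt0 p d; have gb := @weight_down_gt0 q d.
have e1 : (fun r => (f1 r + f2 r) / weight_up p d r) = (fun r => f1 r / weight_up p d r + f2 r / weight_up p d r).
  by apply/funext => r; rewrite mulrDl.
have e2 : (fun r => (f1 r + f2 r) / weight_down q d r) = (fun r => f1 r / weight_down q d r + f2 r / weight_down q d r).
  by apply/funext => r; rewrite mulrDl.
by rewrite !avgE e1 e2 !IntD ?lerDl//; [ring|..]; exact: continuous_div.
Qed.

Lemma avgZ c f p q d tau t : 0 <= tau -> continuous p -> continuous q ->
  continuous f ->
  avg (fun r => c * f r) p q d tau t = c * avg f p q d tau t.
Proof.
move=> tau0 cp cq c1.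
have cwa := @continuous_weight_up p d cp; have cwb := @continuous_weight_down q d cq.
have ga := @weight_up_gt0 p d; have gb := @weight_down_gt0 q d.
have e1 : (fun r => c * f r / weight_up p d r) = (fun r => c * (f r / weight_up p d r)).
  by apply/funext => r; rewrite mulrA.
have e2 : (fun r => c * f r / weight_down q d r) = (fun r => c * (f r / weight_down q d r)).
  by apply/funext => r; rewrite mulrA.
by rewrite !avgE e1 e2 !IntZ ?lerDl//; [ring|..]; exact: continuous_div.
Qed.

Lemma continuous_sum (I : Type) (s : seq I) (F : I -> R -> R) :
  (forall i, continuous (F i)) -> continuous (fun r => \sum_(i <- s) F i r).
Proof.
move=> cF; elim: s => [|j s IH].
  have -> : (fun r => \sum_(i <- [::]) F i r) = (fun=> 0) by apply/funext => r; rewrite big_nil.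
  by move=> ?; exact: cvg_cst.
have -> : (fun r => \sum_(i <- j :: s) F i r) = (fun r => F j r + \sum_(i <- s) F i r).
  by apply/funext => r; rewrite big_cons.
by move=> r; apply: continuousD; [exact: cF|exact: IH].
Qed.

Lemma avg_sum (I : Type) (s : seq I) (F : I -> R -> R) p q d tau t :
  0 <= tau -> continuous p -> continuous q -> (forall i, continuous (F i)) ->
  avg (fun r => \sum_(i <- s) F i r) p q d tau t = \sum_(i <- s) avg (F i) p q d tau t.
Proof.
move=> tau0 cp cq cF; elim: s => [|i s IH].
  rewrite big_nil.
  have -> : (fun r => \sum_(i <- [::]) F i r) = (fun r => 0 * (fun=> 0 : R) r).
    by apply/funext => r; rewrite big_nil mul0r.
  by rewrite avgZ// ?mul0r// => ?; exact: cvg_cst.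
rewrite big_cons -IH -avgD//; first by congr avg; apply/funext => r; rewrite big_cons.
exact: continuous_sum.
Qed.

Lemma Int_gt0 f (a b : R) : continuous f -> a < b -> (forall r, 0 < f r) -> 0 < Int f a b.
Proof.
move=> cf ab f0; rewrite /Int subr_gt0.
have cF : {within `[a, b], continuous prim f} by apply: continuous_subspaceT; exact: continuous_prim.
have [c _ E] := MVT ab (fun x _ => prim_derive x cf) cF.
by rewrite -subr_gt0 E mulr_gt0 ?subr_gt0.
Qed.

Lemma avg_gt0 f p q d tau t : 0 < tau -> continuous p -> continuous q ->
  continuous f -> (forall r, 0 < f r) -> 0 < avg f p q d tau t.
Proof.
move=> tau0 cp cq cf f0; rewrite avgE.
apply: addr_gt0; apply: mulr_gt0; [exact: weight_down_gt0| |exact: weight_up_gt0|].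
  apply: Int_gt0; [|by rewrite ltrDl|by move=> r; rewrite divr_gt0 ?weight_down_gt0].
  by apply: continuous_div => //; [exact: weight_down_gt0|exact: continuous_weight_down].
apply: Int_gt0; [|by rewrite ltrDl|by move=> r; rewrite divr_gt0 ?weight_up_gt0].
by apply: continuous_div => //; [exact: weight_up_gt0|exact: continuous_weight_up].
Qed.

Lemma prim_shift f f' t r : continuous f -> continuous f' -> 0 <= r ->
  (forall s, 0 <= s -> f' s = f (t + s)) ->
  prim f' r = prim f (t + r) - prim f t.
Proof.
move=> cf cf' r0 E; rewrite prim_Int//.
rewrite (@Int_congr _ f' (fun s => f (t + s)))//.
- by rewrite Int_shift// addr0.
- move=> s; apply: continuous_comp; last exact: cf.
  by apply: continuousD; [exact: cvg_cst|exact: cvg_id].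
- by move=> s /andP[s0 _]; exact: E.
Qed.

(** Only the values at nonnegative times enter, since orbits are followed
    forward only. *)
Lemma avg_shift f p q f' p' q' d tau t : 0 <= tau ->
  continuous f -> continuous p -> continuous q ->
  continuous f' -> continuous p' -> continuous q' ->
  (forall s, 0 <= s -> f' s = f (t + s)) ->
  (forall s, 0 <= s -> p' s = p (t + s)) ->
  (forall s, 0 <= s -> q' s = q (t + s)) ->
  avg f' p' q' d tau 0 = avg f p q d tau t.
Proof.
move=> tau0 cf cp cq cf' cp' cq' Ef Ep Eq.
have cs (h : R -> R) : continuous h -> continuous (fun s => h (t + s)).
  move=> ch s; apply: continuous_comp; last exact: ch.
  by apply: continuousD; [exact: cvg_cst|exact: cvg_id].
have wae r : 0 <= r -> weight_up p' d r = weight_up p d (t + r) / weight_up p d t.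
  move=> r0; rewrite /weight_up (prim_shift cp cp' r0 Ep) -expRN -expRD; congr expR; ring.
have wbe r : 0 <= r -> weight_down q' d r = weight_down q d (t + r) / weight_down q d t.
  move=> r0; rewrite /weight_down (prim_shift cq cq' r0 Eq) -expRN -expRD; congr expR; ring.
have na s : weight_up p d s != 0 by rewrite gt_eqF ?weight_up_gt0.
have nb s : weight_down q d s != 0 by rewrite gt_eqF ?weight_down_gt0.
have ga := @weight_up_gt0 p d; have gb := @weight_down_gt0 q d.
have ga' := @weight_up_gt0 p' d; have gb' := @weight_down_gt0 q' d.
have cwa := @continuous_weight_up p d cp; have cwb := @continuous_weight_down q d cq.
have cwa' := @continuous_weight_up p' d cp'; have cwb' := @continuous_weight_down q' d cq'.
have ca := continuous_div ga cf cwa; have cb := continuous_div gb cf cwb.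
rewrite !avgE add0r.
rewrite (@Int_congr _ (fun r => f' r / weight_down q' d r) (fun r => weight_down q d t * (f (t + r) / weight_down q d (t + r)))) //.
- rewrite (@Int_congr _ (fun r => f' r / weight_up p' d r) (fun r => weight_up p d t * (f (t + r) / weight_up p d (t + r)))) //.
  + rewrite !IntZ ?lerDl//; try exact: (cs _ ca); try exact: (cs _ cb).
    rewrite (Int_shift _ ca) ?lerDl// (Int_shift _ cb)// wae// wbe// addr0 !addrA.
    by rewrite [weight_down q d (t + tau) / _ * _]mulrA [weight_up p d (t + tau) / _ * _]mulrA !divfK.
  + exact: continuous_div.
  + exact: continuous_scal (cs _ ca).
  + by rewrite lerDl.
  + move=> r /andP[r0 _]; have {}r0 := le_trans tau0 r0.
    by rewrite Ef// wae// invf_div; ring.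
- exact: continuous_div.
- exact: continuous_scal (cs _ cb).
- by move=> r /andP[r0 _]; rewrite Ef// wbe// invf_div; ring.
Qed.

End AvgAlgebra.

Section JointConvergence.
Context {R : realType} {Y : Type} (F : set_system Y) {FF : Filter F}.
Implicit Types (y : Y).

(** Convergence that is locally uniform in the real variable, as a primitive
    needs, while the base point runs along a filter. *)
Definition joint_cvg (h : Y -> R -> R) (h0 : R -> R) := forall r0 : R,
  (fun z : Y * R => h z.1 z.2) @ filter_prod F (nbhs r0) --> h0 r0.

Lemma joint_cvg_cst (c : R) : joint_cvg (fun _ _ => c) (fun _ => c).
Proof. by move=> r0; exact: cvg_cst. Qed.

Lemma joint_cvg_fun (f : R -> R) : continuous f -> joint_cvg (fun _ => f) f.
Proof. by move=> cf r0; apply: (@cvg_comp _ _ _ snd f _ (nbhs r0)); [exact: cvg_snd|exact: cf]. Qed.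

Lemma joint_cvgD (h k : Y -> R -> R) (h0 k0 : R -> R) : joint_cvg h h0 -> joint_cvg k k0 ->
  joint_cvg (fun y r => h y r + k y r) (fun r => h0 r + k0 r).
Proof. by move=> ch ck r0; apply: cvgD; [exact: ch|exact: ck]. Qed.

Lemma joint_cvgN (h : Y -> R -> R) (h0 : R -> R) : joint_cvg h h0 -> joint_cvg (fun y r => - h y r) (fun r => - h0 r).
Proof. by move=> ch r0; apply: cvgN; exact: ch. Qed.

Lemma joint_cvgM (h k : Y -> R -> R) (h0 k0 : R -> R) : joint_cvg h h0 -> joint_cvg k k0 ->
  joint_cvg (fun y r => h y r * k y r) (fun r => h0 r * k0 r).
Proof. by move=> ch ck r0; apply: cvgM; [exact: ch|exact: ck]. Qed.

Lemma joint_cvgV (h : Y -> R -> R) (h0 : R -> R) : (forall r, h0 r != 0) -> joint_cvg h h0 ->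
  joint_cvg (fun y r => (h y r)^-1) (fun r => (h0 r)^-1).
Proof. by move=> nz ch r0; apply: cvgV => //; exact: ch. Qed.

Lemma joint_cvg_exp (h : Y -> R -> R) (h0 : R -> R) : joint_cvg h h0 ->
  joint_cvg (fun y r => expR (h y r)) (fun r => expR (h0 r)).
Proof. by move=> ch r0; apply: cvg_comp (ch r0) _; exact: continuous_expR. Qed.

Lemma prim_dist (f g : R -> R) (e M r : R) : continuous f -> continuous g ->
  `|r| <= M -> (forall s, - M <= s <= M -> `|f s - g s| <= e) ->
  `|prim f r - prim g r| <= e * `|r|.
Proof.
move=> cf cg rM fg.
have cc (c : R) : continuous (fun _ : R => c) by move=> ?; exact: cvg_cst.
have cge (c : R) : continuous (fun s => g s + c).
  by move=> s; apply: continuousD; [exact: cg|exact: cvg_cst].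
have H (a b : R) : a <= b -> -M <= a -> b <= M -> `|Int f a b - Int g a b| <= e * (b - a).
  move=> ab Ma bM.
  have lh s : a <= s <= b -> g s + - e <= f s <= g s + e.
    move=> /andP[as_ sb]; have /fg : - M <= s <= M by apply/andP; split; lra.
    by rewrite ler_distl.
  rewrite ler_distl; apply/andP; split.
    rewrite -mulNr -(Int_cst (- e))// -IntD//.
    by apply: Int_le => // s /lh/andP[].
  rewrite -(Int_cst e)// -IntD//.
  by apply: Int_le => // s /lh/andP[].
have : - M <= r <= M by rewrite -ler_norml.
move=> /andP[h1 h2].
have M0 : 0 <= M by apply: le_trans rM.
rewrite !prim_Int//; case: (lerP 0 r) => r0.
  have Mn : - M <= 0 by rewrite oppr_le0.
  by have := H 0 r r0 Mn h2; rewrite subr0 (ger0_norm r0).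
have := H r 0 (ltW r0) h1 M0; rewrite sub0r (ltr0_norm r0).
have -> : Int f r 0 - Int g r 0 = - (Int f 0 r - Int g 0 r) by rewrite /Int; ring.
by rewrite normrN.
Qed.

(** By compactness of a segment, joint convergence is uniform there, so the
    integrals converge as well. *)
Lemma joint_cvg_prim (h : Y -> R -> R) (h0 : R -> R) : continuous h0 -> (\forall y \near F, continuous (h y)) ->
  joint_cvg h h0 -> joint_cvg (fun y => prim (h y)) (prim h0).
Proof.
move=> ch0 ch hh r0; apply/cvgrPdist_le => /= e e0.
pose M := `|r0| + 1.
have M0 : 0 < M by rewrite ltr_wpDl.
pose e' := e / 2 / M.
have e'0 : 0 < e' by rewrite !divr_gt0.
have unif : \forall y \near F, `[- M, M] `<=` (fun s => `|h y s - h0 s| <= e').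
  have := @segment_compact R (- M) M => /compact_near_coveringP.
  apply => //= s _.
  have h1 : \forall s' \near s & y \near F, `|h0 s - h y s'| <= e' / 2.
    have := hh s => /cvgrPdist_le /(_ (e' / 2)); rewrite divr_gt0// => /(_ isT).
    move=> [[A B] [/= FA nB] AB]; exists (B, A) => //= -[s' y] [/= Bs' Ay].
    exact: (AB (y, s')).
  have h2 : \forall s' \near s & y \near F, `|h0 s - h0 s'| <= e' / 2.
    have : \forall s' \near s, `|h0 s - h0 s'| <= e' / 2.
      by have := ch0 s => /cvgrPdist_le; apply; rewrite divr_gt0.
    move=> H; exists ([set s' | `|h0 s - h0 s'| <= e' / 2], setT) => /=; last by move=> [s' y] [].
    by split => //; exact: filterT.
  apply: filterS (filterI h1 h2) => -[s' y] [/= e1 e2].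
  have := ler_distD (h0 s) (h y s') (h0 s'); rewrite (distrC _ (h0 s)) => h3; lra.
have cp0 : \forall r \near r0, `|prim h0 r0 - prim h0 r| <= e / 2.
  by have := continuous_prim ch0 (x := r0) => /cvgrPdist_le; apply; rewrite divr_gt0.
have rM : \forall r \near r0, `|r| <= M.
  near=> r; have : `|r0 - r| < 1 by near: r; apply: (@cvgr_dist_lt _ R^o).
  have := ler_distD r0 r 0; rewrite !subr0 (distrC r) /M => h1 h2; lra.
near=> y r.
have Er : `|r| <= M by near: r; exact: rM.
have E1 : `|prim h0 r0 - prim h0 r| <= e / 2 by near: r; exact: cp0.
have E2 : `|prim (h y) r - prim h0 r| <= e' * `|r|.
  apply: (@prim_dist _ _ e' M) => //; first by near: y; exact: ch.
  move=> s sM; have : `[- M, M] `<=` (fun s => `|h y s - h0 s| <= e') by near: y; exact: unif.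
  by apply; rewrite /= in_itv.
have E3 : e' * `|r| <= e / 2.
  by apply: le_trans (_ : e' * M <= _); [rewrite ler_pM2l|rewrite /e' divfK// gt_eqF].
have := ler_distD (prim h0 r) (prim h0 r0) (prim (h y) r).
rewrite [X in _ <= _ + X]distrC => h3; lra.
Unshelve. all: by end_near. Qed.

Lemma joint_cvg_at (h : Y -> R -> R) (h0 : R -> R) (r : R) : joint_cvg h h0 -> h y r @[y --> F] --> h0 r.
Proof.
move=> hh A /(hh r) [[B C] /= [FB nC] BC].
change (F (fun y => A (h y r))); apply: filterS FB => y By.
exact: (BC (y, r) (conj By (nbhs_singleton nC))).
Qed.

Lemma joint_cvg_avg (f p q : Y -> R -> R) (f0 p0 q0 : R -> R) (d tau t : R) :
  continuous f0 -> continuous p0 -> continuous q0 ->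
  (\forall y \near F, continuous (f y)) -> (\forall y \near F, continuous (p y)) ->
  (\forall y \near F, continuous (q y)) ->
  joint_cvg f f0 -> joint_cvg p p0 -> joint_cvg q q0 ->
  avg (f y) (p y) (q y) d tau t @[y --> F] --> avg f0 p0 q0 d tau t.
Proof.
move=> cf0 cp0 cq0 cf cp cq jf jp jq.
have ja : joint_cvg (fun y => weight_up (p y) d) (weight_up p0 d).
  apply: joint_cvg_exp; apply: joint_cvgD.
    by apply: joint_cvgM; [exact: joint_cvg_cst|exact: joint_cvg_prim].
  by apply: joint_cvg_fun; apply: continuous_scal => r; exact: cvg_id.
have jb : joint_cvg (fun y => weight_down (q y) d) (weight_down q0 d).
  apply: joint_cvg_exp; apply: joint_cvgD.
    by apply: joint_cvgM; [exact: joint_cvg_cst|exact: joint_cvg_prim].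
  by apply: joint_cvgN; apply: joint_cvg_fun; apply: continuous_scal => r; exact: cvg_id.
have jfa : joint_cvg (fun y => prim (fun r => f y r / weight_up (p y) d r)) (prim (fun r => f0 r / weight_up p0 d r)).
  apply: joint_cvg_prim; last by apply: joint_cvgM => //; apply: joint_cvgV => // r; rewrite gt_eqF ?weight_up_gt0.
    by apply: continuous_div => //; [exact: weight_up_gt0|exact: continuous_weight_up].
  near=> y; apply: continuous_div; [exact: weight_up_gt0|by near: y|apply: continuous_weight_up; by near: y].
have jfb : joint_cvg (fun y => prim (fun r => f y r / weight_down (q y) d r)) (prim (fun r => f0 r / weight_down q0 d r)).
  apply: joint_cvg_prim; last by apply: joint_cvgM => //; apply: joint_cvgV => // r; rewrite gt_eqF ?weight_down_gt0.
    by apply: continuous_div => //; [exact: weight_down_gt0|exact: continuous_weight_down].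
  near=> y; apply: continuous_div; [exact: weight_down_gt0|by near: y|apply: continuous_weight_down; by near: y].
have c1 := cvgM (joint_cvg_at (r := t + tau) jb) (cvgB (joint_cvg_at (r := t + tau) jfb) (joint_cvg_at (r := t) jfb)).
have c2 := cvgM (joint_cvg_at (r := t + tau) ja)
  (cvgB (joint_cvg_at (r := t + tau + tau) jfa) (joint_cvg_at (r := t + tau) jfa)).
exact: (cvgD (c1 FF FF) (c2 FF FF)).
Unshelve. all: by end_near. Qed.

End JointConvergence.

(** * Derivatives within a half-space *)

Section MatrixNorm.
Context {R : realType}.

Lemma mx_entry_le m n (A : 'M[R]_(m, n)) i j : `|A i j| <= `|A|.
Proof.
change (`|A i j| <= mx_norm A); rewrite mx_normrE.
exact: (@le_bigmax _ _ _ _ (fun ij : 'I_m * 'I_n => `|A ij.1 ij.2|) (i, j)).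
Qed.

Lemma mx_norm_leP m n (A : 'M[R]_(m, n)) (c : R) : 0 <= c ->
  (forall i j, `|A i j| <= c) -> `|A| <= c.
Proof.
by move=> c0 H; change (mx_norm A <= c); rewrite mx_normrE; apply: bigmax_le => // -[i j] _; exact: H.
Qed.

Lemma mulmxr_bounded m n (A : 'M[R]_(m, n)) :
  exists2 C : R, 0 < C & forall v : 'rV[R]_m, `|v *m A| <= C * `|v|.
Proof.
exists (\sum_i \sum_j `|A i j| + 1).
  by rewrite ltr_wpDl// sumr_ge0// => i _; rewrite sumr_ge0.
move=> v; apply: mx_norm_leP; first by rewrite mulr_ge0// addr_ge0// sumr_ge0// => i _; rewrite sumr_ge0.
move=> i j; rewrite mxE mulrDl mul1r.
apply: le_trans (_ : (\sum_k \sum_l `|A k l|) * `|v| <= _); last by rewrite lerDl.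
apply: le_trans (ler_norm_sum _ _ _) _; rewrite mulr_suml; apply: ler_sum => k _.
rewrite normrM mulrC; apply: ler_pM => //; last exact: mx_entry_le.
by rewrite (bigD1 j)//= lerDl sumr_ge0.
Qed.

Lemma linear_mulmxr m n (L : 'rV[R]_m -> 'rV[R]_n) : linear L ->
  exists A, L = mulmxr A.
Proof.
move=> linL; pose Lm := GRing.isLinear.Build _ _ _ _ L linL.
pose Ll : {linear 'rV[R]_m -> 'rV[R]_n} := HB.pack L Lm.
by exists (lin1_mx Ll); apply/funext => v; exact: (esym (mul_rV_lin1 Ll v)).
Qed.

End MatrixNorm.

Section DerivWithin.
Context {R : realType} {m : nat}.
Local Notation V := 'rV[R]_m.
Implicit Types (D : set V) (f g : V -> V) (x : V) (A B : 'M[R]_m).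

Lemma deriv_within_germ D D' f f' x (L : V -> V) :
  is_deriv_within D f x L -> f' x = f x ->
  (\forall y \near x, D' y -> D y /\ f' y = f y) ->
  is_deriv_within D' f' x L.
Proof.
move=> [linL dL] fx nb; split=> // e e0; have := dL e e0.
rewrite near_withinE => H; rewrite near_withinE.
apply: filterS (filterI H nb) => y [/= h1 h2] D'y.
by have [Dy ->] := h2 D'y; rewrite fx; exact: h1.
Qed.

Lemma deriv_within_near D f x A : is_deriv_within D f x (mulmxr A) ->
  exists2 C : R, 0 < C &
    \forall y \near x, D y -> `|f y - f x| <= C * `|y - x|.
Proof.
move=> [_ dL]; have [C C0 HC] := mulmxr_bounded A.
exists (C + 1); first by rewrite addr_gt0.
have := dL 1 ltr01; rewrite near_withinE; apply: filterS => y H Dy.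
have := H Dy; rewrite mul1r => h1; have := HC (y - x) => h2.
have := ler_normD (f y - f x - (y - x) *m A) ((y - x) *m A).
rewrite subrK /= mulrDl mul1r => h3; rewrite /= in h1; lra.
Qed.

Lemma deriv_within_cvg D f x A : is_deriv_within D f x (mulmxr A) ->
  f @ within D (nbhs x) --> f x.
Proof.
move=> /deriv_within_near[C C0 H]; apply/cvgrPdist_le => e e0.
rewrite near_withinE.
have h2 : \forall y \near x, `|x - y| <= e / C.
  have : (fun y : V => y) @ x --> x by exact: cvg_id.
  by move=> /cvgrPdist_le; apply; rewrite divr_gt0.
apply: filterS (filterI H h2) => y [/= h1 {}h2] Dy.
rewrite distrC; apply: le_trans (h1 Dy) _.
by rewrite distrC mulrC -ler_pdivlMr.
Qed.

Lemma deriv_within_comp D D' f g x A B :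
  is_deriv_within D f x (mulmxr A) -> is_deriv_within D' g (f x) (mulmxr B) ->
  (\forall y \near x, D y -> D' (f y)) ->
  is_deriv_within D (g \o f) x (mulmxr (A *m B)).
Proof.
move=> df dg nb; split; first exact: linearP.
move=> e e0.
have cf := deriv_within_cvg df.
have [C C0 fC] := deriv_within_near df.
have [K K0 BK] := mulmxr_bounded B.
have e1 : 0 < e / 2 / K by rewrite !divr_gt0.
have e2 : 0 < e / 2 / C by rewrite !divr_gt0.
have h1 := df.2 _ e1; rewrite near_withinE in h1.
have h2 : \forall y \near x, D y ->
    (D' (f y) -> `|g (f y) - g (f x) - (f y - f x) *m B| <= e / 2 / C * `|f y - f x|).
  by have := cf _ (dg.2 _ e2); rewrite /within/=.
rewrite near_withinE.
near=> y => Dy.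
have a1 : `|f y - f x - (y - x) *m A| <= e / 2 / K * `|y - x| by apply: (near h1 y).
have a0 : D' (f y) by apply: (near nb y).
have a2 : `|g (f y) - g (f x) - (f y - f x) *m B| <= e / 2 / C * `|f y - f x|.
  by apply: (near h2 y).
have a3 : `|f y - f x| <= C * `|y - x| by apply: (near fC y).
have -> : g (f y) - g (f x) - (y - x) *m (A *m B) =
  (g (f y) - g (f x) - (f y - f x) *m B) + (f y - f x - (y - x) *m A) *m B.
  set Q := f y - f x; set U := y - x.
  by rewrite (mulmxBl Q) -mulmxA addrA subrK.
apply: le_trans (ler_normD _ _) _.
have b1 := BK (f y - f x - (y - x) *m A).
have b2 : e / 2 / C * `|f y - f x| <= e / 2 * `|y - x|.
  apply: le_trans (_ : e / 2 / C * (C * `|y - x|) <= _); first by rewrite ler_pM2l.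
  by rewrite mulrA divfK// gt_eqF.
have b3 : K * `|f y - f x - (y - x) *m A| <= e / 2 * `|y - x|.
  apply: le_trans (_ : K * (e / 2 / K * `|y - x|) <= _); first by rewrite ler_pM2l.
  by rewrite mulrA [K * _]mulrC divfK// gt_eqF.
have : e * `|y - x| = e / 2 * `|y - x| + e / 2 * `|y - x| by rewrite -mulrDl -splitr.
move=> ->; apply: lerD; [exact: le_trans a2 b2|exact: le_trans b1 b3].
Unshelve. all: by end_near. Qed.

(** What uniqueness of the derivative at a possible boundary point needs: the
    domain contains a short segment in every direction that points into the
    half-space. Such directions span the whole space. *)
Definition halfspace_cone D x := forall u : V, (forall i : 'I_m, i = 0%N :> nat -> 0 <= u 0 i) ->
  \forall s \near (0 : R)^'+, D (x + s *: u).

(** Both matrices give the derivative along every admissible direction, and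
    each vector or its opposite is admissible. *)
Lemma deriv_within_unique D f x A B : halfspace_cone D x ->
  is_deriv_within D f x (mulmxr A) -> is_deriv_within D f x (mulmxr B) -> A = B.
Proof.
move=> fatD dA dB.
suff H (u : V) : (forall i : 'I_m, i = 0%N :> nat -> 0 <= u 0 i) -> u *m A = u *m B.
  have H' (u : V) : u *m A = u *m B.
    have [h|] := pselect (forall i : 'I_m, i = 0%N :> nat -> 0 <= u 0 i); first exact: H.
    move=> /existsNP[i /not_implyP[i0 /negP]]; rewrite -ltNge => ui.
    apply: oppr_inj; rewrite -!mulNmx; apply: H => j j0.
    have -> : j = i by apply: val_inj; rewrite /= j0 i0.
    by rewrite mxE oppr_ge0 ltW.
  by apply/row_matrixP => i; rewrite !rowE.
move=> hu; apply/eqP; rewrite -subr_eq0 -normr_eq0 -[_ == 0]negbK.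
apply/negP => nz.
have n0 : 0 < `|u *m A - u *m B| by rewrite lt_def nz normr_ge0.
set c := `|u *m A - u *m B| in n0.
have u0 : 0 < `|u| + 1 by rewrite ltr_wpDl.
pose e := c / 4 / (`|u| + 1).
have e0 : 0 < e by rewrite !divr_gt0.
have cx : (fun s : R => x + s *: u) @ 0^'+ --> x.
  have -> : nbhs x = nbhs (x + 0 *: u) by rewrite scale0r addr0.
  apply: cvgD; first exact: cvg_cst.
  apply: cvgZr_tmp; apply: cvg_at_right_filter; exact: cvg_id.
have hA : \forall s \near (0 : R)^'+, D (x + s *: u) ->
  `|f (x + s *: u) - f x - (x + s *: u - x) *m A| <= e * `|x + s *: u - x|.
  exact: (cx _ (dA.2 _ e0)).
have hB : \forall s \near (0 : R)^'+, D (x + s *: u) ->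
  `|f (x + s *: u) - f x - (x + s *: u - x) *m B| <= e * `|x + s *: u - x|.
  exact: (cx _ (dB.2 _ e0)).
have hD := fatD u hu.
have : \forall s \near (0 : R)^'+, False.
  near=> s.
  have s0 : 0 < s by near: s; exact: nbhs_right_gt.
  have Ds : D (x + s *: u) by near: s.
  have a1 : `|f (x + s *: u) - f x - (x + s *: u - x) *m A| <= e * `|x + s *: u - x|.
    by apply: (near hA s).
  have a2 : `|f (x + s *: u) - f x - (x + s *: u - x) *m B| <= e * `|x + s *: u - x|.
    by apply: (near hB s).
  have E : x + s *: u - x = s *: u by rewrite addrAC subrr add0r.
  rewrite E in a1 a2.
  set w := f _ - f x in a1 a2.
  have : `|s *: u *m A - s *: u *m B| <= e * `|s *: u| + e * `|s *: u|.
    have -> : s *: u *m A - s *: u *m B = (w - s *: u *m B) - (w - s *: u *m A).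
      by rewrite opprB [RHS]addrC addrA subrK.
    by apply: le_trans (ler_normB _ _) _; apply: lerD.
  rewrite -!scalemxAl -scalerBr !normrZ gtr0_norm// -/c -mulrDl -mulr2n.
  have -> : e *+ 2 * (s * `|u|) = s * (e *+ 2 * `|u|) by ring.
  rewrite ler_pM2l//.
  have : e *+ 2 * `|u| <= c / 2.
    apply: le_trans (_ : e *+ 2 * (`|u| + 1) <= _).
      by rewrite ler_wpM2l ?mulrn_wge0// ?ltW// ltrDl.
    by rewrite /e -mulrnAl divfK ?gt_eqF//; lra.
  lra.
by move=> /filter_ex[].
Unshelve. all: by end_near. Qed.

End DerivWithin.

(** * Maps read in charts *)

Section ChartMaps.
Context {R : realType} {m : nat} {M : topologicalType}.
Local Notation V := 'rV[R]_m.
Implicit Types (c d e : chart R m M) (f g : M -> M) (D : set M) (x y : M).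

Lemma chart_near c x (P : M -> Prop) : is_chart c -> cdom c x ->
  (\forall y \near x, P y) ->
  \forall v \near cmap c x, (cmap c @` cdom c) v -> P (cinv c v).
Proof.
move=> [_ _ invK _ /subspace_continuousP cinvc] cx nP.
have H : cinv c @ within (cmap c @` cdom c) (nbhs (cmap c x)) --> cinv c (cmap c x).
  by apply: cinvc; exists x.
by rewrite invK// in H; exact: (H _ nP).
Qed.

Lemma chart_dom_near c x : is_chart c -> cdom c x -> \forall y \near x, cdom c y.
Proof. by move=> [oc _ _ _ _] cx; exact: open_nbhs_nbhs. Qed.

Lemma chart_cmap_cvg c x : is_chart c -> cdom c x -> cmap c @ x --> cmap c x.
Proof.
move=> cc cx; have [_ _ _ /subspace_continuousP/(_ x cx) h _] := cc.
move=> B nB; change (nbhs x (fun y => B (cmap c y))).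
have nB' : nbhs x (fun y => cdom c y -> B (cmap c y)) := h B nB.
by apply: filterS (filterI nB' (chart_dom_near cc cx)) => y [/= + cy]; apply.
Qed.

(** The derivative of [f] at [x] read in the charts [c] and [d]; unlike
    [loc_diff] it is a relation, so that it can be composed before uniqueness
    is known. *)
Definition chart_deriv c d D f x A :=
  is_deriv_within (loc_dom c d D f) (loc_map c d f) (cmap c x) (mulmxr A).

Lemma chart_halfspace_cone c x (D : set M) (E : set V) : is_chart c -> cdom c x ->
  (\forall y \near x, D y) -> (forall y, cdom c y -> D y -> E (cmap c y)) ->
  halfspace_cone E (cmap c x).
Proof.
move=> cc cx nD DE u hu; have [oc [Ob oO im] invK _ _] := cc.
have cv : (fun s : R => cmap c x + s *: u) @ 0^'+ --> cmap c x.
  have -> : nbhs (cmap c x) = nbhs (cmap c x + 0 *: u) by rewrite scale0r addr0.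
  apply: cvgD; first exact: cvg_cst.
  apply: cvgZr_tmp; apply: cvg_at_right_filter; exact: cvg_id.
have /= imx : (Ob `&` halfspace) (cmap c x) by rewrite -im; exists x.
have h1 : \forall s \near (0 : R)^'+, Ob (cmap c x + s *: u).
  by apply: (cv Ob); apply: open_nbhs_nbhs; split => //; case: imx.
have h2 : \forall s \near (0 : R)^'+, (cmap c @` cdom c) (cmap c x + s *: u) ->
  D (cinv c (cmap c x + s *: u)) := cv _ (chart_near cc cx nD).
near=> s.
have s0 : 0 < s by near: s; exact: nbhs_right_gt.
have ims : (cmap c @` cdom c) (cmap c x + s *: u).
  rewrite im; split; first by near: s.
  move=> i i0; rewrite !mxE addr_ge0//; first by case: imx => _; apply.
  by rewrite mulr_ge0 ?hu// ltW.
have : D (cinv c (cmap c x + s *: u)) by apply: (near h2 s).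
by case: (ims) => y cy <-; rewrite invK// => Dy; exact: DE.
Unshelve. all: by end_near. Qed.

Lemma chart_deriv_unique c d D f x A B : is_chart c -> cdom c x ->
  (\forall y \near x, D y /\ cdom d (f y)) ->
  chart_deriv c d D f x A -> chart_deriv c d D f x B -> A = B.
Proof.
move=> cc cx nD; apply: deriv_within_unique.
by apply: (chart_halfspace_cone cc cx nD) => y cy [Dy dy]; exists y.
Qed.

Lemma loc_mapE c d f y : is_chart c -> cdom c y ->
  loc_map c d f (cmap c y) = cmap d (f y).
Proof. by move=> [_ _ invK _ _] cy; rewrite /loc_map invK. Qed.

Lemma chart_deriv_comp c d e D D' D0 f g h x A B : is_chart c -> is_chart d -> cdom c x ->
  cdom d (f x) ->
  chart_deriv c d D f x A -> chart_deriv d e D' g (f x) B ->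
  (\forall y \near x, D0 y -> [/\ D y, cdom d (f y), D' (f y) & g (f y) = h y]) ->
  g (f x) = h x ->
  chart_deriv c e D0 h x (A *m B).
Proof.
move=> cc cd cx dx fA gB nb hx.
have [_ _ invK _ _] := cc; have [_ _ invKd _ _] := cd.
have H : \forall v \near cmap c x, loc_dom c e D0 h v ->
   [/\ loc_dom c d D f v, loc_dom d e D' g (loc_map c d f v) &
       loc_map c e h v = loc_map d e g (loc_map c d f v)].
  apply: filterS (chart_near cc cx nb) => v /= nv [y [cy Dy ey] vy].
  have [||Dcy dfy D'fy gfy] := nv _ _; first by exists y.
    by rewrite -vy invK.
  rewrite -vy invK// in Dcy dfy D'fy gfy.
  rewrite -vy !loc_mapE//; split; first by exists y.
    by exists (f y) => //; split => //; rewrite gfy.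
  by rewrite gfy.
have fA' : is_deriv_within (loc_dom c e D0 h `&` loc_dom c d D f) (loc_map c d f)
   (cmap c x) (mulmxr A).
  by apply: deriv_within_germ fA _ _ => //; near=> v => -[].
have gB' : is_deriv_within (loc_dom d e D' g) (loc_map d e g)
   (loc_map c d f (cmap c x)) (mulmxr B) by rewrite loc_mapE.
have := deriv_within_comp fA' gB' _ => C.
apply: deriv_within_germ (C _) _ _.
- apply: (@filterS _ (nbhs (cmap c x)) _ _ _ _ H) => v Hv [hv _]; by have [] := Hv hv.
- by rewrite /= !loc_mapE// hx.
- by apply: (@filterS _ (nbhs (cmap c x)) _ _ _ _ H) => v Hv hv; have [] := Hv hv.
Unshelve. all: by end_near. Qed.

Lemma chart_deriv_id c D x : is_chart c -> cdom c x -> chart_deriv c c D id x 1%:M.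
Proof.
move=> cc cx; split; first exact: linearP.
move=> e e0; rewrite near_withinE; near=> v => -[y [cy Dy _] <-].
by rewrite !loc_mapE//= mulmx1 subrr normr0 mulr_ge0// ltW.
Unshelve. all: by end_near. Qed.

Lemma loc_diffP c d D f x A : chart_deriv c d D f x A -> chart_deriv c d D f x (loc_diff c d D f x).
Proof. by move=> dA; exact: (@getPex _ [set A | chart_deriv c d D f x A] (ex_intro _ A dA)). Qed.

End ChartMaps.

Section MatrixCvg.
Context {R : realType} {T : Type} {F : set_system T} {FF : Filter F}.

Lemma cvg_mx m n (A : T -> 'M[R]_(m, n)) (B : 'M[R]_(m, n)) :
  (forall i j, A y i j @[y --> F] --> B i j) -> A @ F --> B.
Proof.
move=> H; apply/cvgrPdist_le => /= e e0.
have Hij : \forall y \near F, forall ij : 'I_m * 'I_n, `|B ij.1 ij.2 - A y ij.1 ij.2| <= e.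
  apply: filter_forall => -[i j] /=.
  by have := H i j => /cvgrPdist_le; apply.
apply: filterS Hij => y Hy; apply: mx_norm_leP; first exact: ltW.
by move=> i j; have := Hy (i, j); rewrite !mxE.
Qed.

Lemma cvg_mx_entry m n (A : T -> 'M[R]_(m, n)) (B : 'M[R]_(m, n)) i j :
  A @ F --> B -> A y i j @[y --> F] --> B i j.
Proof. by move=> H; apply: (@cvg_comp _ _ _ A (fun B : 'M[R]_(m, n) => B i j) _ _ _ H); exact: coord_continuous. Qed.

Lemma cvg_sumR (I : Type) (r : seq I) (f : I -> T -> R) (a : I -> R) :
  (forall i, f i y @[y --> F] --> a i) ->
  \sum_(i <- r) f i y @[y --> F] --> \sum_(i <- r) a i.
Proof.
move=> H; elim: r => [|i r IH].
  by under eq_fun do rewrite big_nil; rewrite big_nil; exact: cvg_cst.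
under eq_fun do rewrite big_cons; rewrite big_cons.
exact: (cvgD (H i) IH).
Qed.

Lemma cvg_prodR (I : Type) (r : seq I) (f : I -> T -> R) (a : I -> R) :
  (forall i, f i y @[y --> F] --> a i) ->
  \prod_(i <- r) f i y @[y --> F] --> \prod_(i <- r) a i.
Proof.
move=> H; elim: r => [|i r IH].
  by under eq_fun do rewrite big_nil; rewrite big_nil; exact: cvg_cst.
under eq_fun do rewrite big_cons; rewrite big_cons.
exact: (cvgM (H i) IH).
Qed.

Lemma cvg_mulmx m n p (A : T -> 'M[R]_(m, n)) (B : T -> 'M[R]_(n, p))
    (A0 : 'M[R]_(m, n)) (B0 : 'M[R]_(n, p)) :
  A @ F --> A0 -> B @ F --> B0 -> (fun y => A y *m B y) @ F --> A0 *m B0.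
Proof.
move=> hA hB; apply: cvg_mx => i j.
under eq_fun do rewrite mxE; rewrite mxE.
apply: cvg_sumR => k; exact: (cvgM (cvg_mx_entry (i:=i) (j:=k) hA) (cvg_mx_entry (i:=k) (j:=j) hB)).
Qed.

Lemma cvg_trmx m n (A : T -> 'M[R]_(m, n)) (A0 : 'M[R]_(m, n)) :
  A @ F --> A0 -> (fun y => (A y)^T) @ F --> A0^T.
Proof.
move=> hA; apply: cvg_mx => i j.
under eq_fun do rewrite mxE; rewrite mxE; exact: (cvg_mx_entry hA).
Qed.

Lemma cvg_det n (A : T -> 'M[R]_n) (A0 : 'M[R]_n) :
  A @ F --> A0 -> \det (A y) @[y --> F] --> \det A0.
Proof.
move=> hA; rewrite /determinant.
apply: (@cvg_sumR _ _ (fun (s : 'S_n) y => (-1) ^+ s * \prod_i A y i (s i))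
  (fun s : 'S_n => (-1) ^+ s * \prod_i A0 i (s i))) => s.
apply: cvgM; first exact: cvg_cst.
apply: (@cvg_prodR _ _ (fun i y => A y i (s i)) (fun i => A0 i (s i))) => i.
exact: (cvg_mx_entry hA).
Qed.

End MatrixCvg.

(** * Continuity of the flow in forward time *)

Section Transition.
Context {R : realType} {m : nat} {M : topologicalType}.
Variable S : smooth_manifold R m M.
Local Notation V := 'rV[R]_m.

Lemma atlas_at x : is_chart (chart_at S x).
Proof. exact: atlas_chart (chart_at_atlas S x). Qed.

Lemma chart_at_domE x : cdom (chart_at S x) x.
Proof. exact: chart_at_dom. Qed.

Lemma transition_chart_deriv c d x : atlas S c -> atlas S d -> cdom c x -> cdom d x ->
  exists A, chart_deriv c d setT id x A.
Proof.
move=> ac ad cx dx; have [df [dfP _]] := atlas_smooth ac ad 1%N.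
have hx : loc_dom c d setT id (cmap c x) by exists x.
have h := dfP _ hx; have [A EA] := linear_mulmxr h.1.
by exists A; rewrite /chart_deriv -EA.
Qed.

Lemma tcoord_chart_deriv c x : atlas S c -> cdom c x ->
  chart_deriv (chart_at S x) c setT id x (tcoord S c x).
Proof.
move=> ac cx.
have [A hA] := transition_chart_deriv (chart_at_atlas S x) ac (chart_at_domE x) cx.
exact: loc_diffP hA.
Qed.

(** The change of charts in the other direction supplies an inverse, by the
    chain rule and uniqueness. *)
Lemma tcoord_unit c x : atlas S c -> cdom c x -> tcoord S c x \in unitmx.
Proof.
move=> ac cx; have cc := atlas_chart ac.
have h1 := tcoord_chart_deriv ac cx.
have [B h2] := transition_chart_deriv ac (chart_at_atlas S x) cx (chart_at_domE x).
have h3 : chart_deriv (chart_at S x) (chart_at S x) setT id x (tcoord S c x *m B).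
  apply: (chart_deriv_comp (atlas_at x) cc (chart_at_domE x) cx h1 h2) => //.
  by apply: filterS (chart_dom_near cc cx) => y cy _.
have h4 : chart_deriv (chart_at S x) (chart_at S x) setT id x 1%:M.
  by apply: chart_deriv_id; [exact: atlas_at|exact: chart_at_domE].
have E : tcoord S c x *m B = 1%:M.
  apply: (chart_deriv_unique _ _ _ h3 h4); [exact: atlas_at|exact: chart_at_domE|].
  apply: filterS (chart_dom_near (atlas_at x) (chart_at_domE x)) => y; by split.
by case: (mulmx1_unit E).
Qed.

End Transition.

Section Flow.
Context {R : realType} {m : nat} {M : topologicalType}.
Variable S : smooth_manifold R m M.
Variables (X : M -> 'rV[R]_m) (phi : R -> M -> M).
Hypothesis flow : is_flow S X phi.
Hypothesis cptM : compact [set: M].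
Local Notation V := 'rV[R]_m.
Local Notation A := (chart_at S).

Lemma flow_dom_ge0 t x : 0 <= t -> flow_dom S X t x.
Proof. by move=> t0; exact: (flow_forward flow). Qed.

Lemma flow_semigroup s t x : 0 <= s -> 0 <= t -> phi (s + t) x = phi t (phi s x).
Proof. by move=> s0 t0; have [] := flow_add flow (flow_dom_ge0 x s0) (flow_dom_ge0 (phi s x) t0). Qed.

Definition fdom (c d : chart R m M) := [set p : R * V |
  [/\ (cmap c @` cdom c) p.2, flow_dom S X p.1 (cinv c p.2) &
               cdom d (phi p.1 (cinv c p.2))]].

Lemma fdom_cmap c d t x : atlas S c -> cdom c x -> flow_dom S X t x ->
  cdom d (phi t x) -> fdom c d (t, cmap c x).
Proof.
move=> ac cx tx dx; have [_ _ invK _ _] := atlas_chart ac.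
by split => //=; rewrite ?invK//; exists x.
Qed.

(** The regularity of the flow in two charts is a statement on pairs (time,
    point); its derivative restricted to the directions of the second factor is
    the derivative of [phi t]. *)
Lemma flow_jacobian c d : atlas S c -> atlas S d ->
  exists J : R * V -> 'M[R]_m,
  [/\ forall t x, cdom c x -> flow_dom S X t x -> cdom d (phi t x) ->
        chart_deriv c d (flow_dom S X t) (phi t) x (J (t, cmap c x)),
      forall p, fdom c d p -> J @ within (fdom c d) (nbhs p) --> J p &
      forall p, fdom c d p ->
        (fun p => cmap d (phi p.1 (cinv c p.2))) @ within (fdom c d) (nbhs p) -->
        cmap d (phi p.1 (cinv c p.2))].
Proof.
move=> ac ad; have [_ _ invK _ _] := atlas_chart ac.
have [df [dfP dfc]] := flow_C1 flow ac ad.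
pose J p : 'M[R]_m := \matrix_i df p (0, delta_mx 0 i).
have linE p : fdom c d p -> forall v : V, df p (0, v) = v *m J p.
  move=> hp v; have [lin _] := dfP p hp.
  have add u w : df p (u + w) = df p u + df p w by have := lin 1 u w; rewrite !scale1r.
  have d0 : df p 0 = 0 by apply: (@addrI _ (df p 0)); rewrite -add !addr0.
  have scl a u : df p (a *: u) = a *: df p u by have := lin a u 0; rewrite d0 !addr0.
  have lin0 : linear (fun v : V => df p (0, v)).
    move=> a u w; rewrite -scl -add; congr df.
    by rewrite /GRing.scale/= /GRing.add/=; congr pair; rewrite /= ?scaler0 ?addr0.
  have [B EB] := linear_mulmxr lin0.
  have EB' u : df p (0, u) = u *m B by have := congr1 (fun f => f u) EB.
  rewrite EB'; congr (_ *m _); apply/row_matrixP => i.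
  by rewrite rowK EB' rowE.
exists J; split.
- move=> t x cx tx dx.
  have hp := fdom_cmap ac cx tx dx; have [lin H] := dfP _ hp.
  split; first exact: linearP.
  move=> e e0; have := H e e0; rewrite !near_withinE => H1.
  have cv : (fun v : V => (t, v)) @ cmap c x --> (t, cmap c x).
    move=> B [[P Q] [/= nP nQ] PQ]; apply: (@filterS _ (nbhs (cmap c x)) _ _ _ _ nQ) => v Qv.
    by apply: PQ; split => //=; exact: nbhs_singleton.
  have H2 : \forall v \near cmap c x, fdom c d (t, v) ->
    `|cmap d (phi t (cinv c v)) - cmap d (phi t (cinv c (cmap c x)))
      - df (t, cmap c x) ((t, v) - (t, cmap c x))| <= e * `|(t, v) - (t, cmap c x)|.
    exact: (cv _ H1).
  apply: (@filterS _ (nbhs (cmap c x)) _ _ _ _ H2) => v Hv [y [cy ty dy] yv].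
  have hv : fdom c d (t, v) by rewrite -yv; exact: fdom_cmap.
  have := Hv hv.
  have -> : (t, v) - (t, cmap c x) = (0, v - cmap c x).
    by rewrite /GRing.add/= /GRing.opp/=; congr pair; rewrite /= subrr.
  rewrite linE// prod_normE /= normr0 max_r//.
- move=> p hp; apply: cvg_mx => i j.
  have /subspace_continuousP/(_ p hp) := dfc (0, delta_mx 0 i) => h.
  have -> : (fun y => J y i j) = (fun y => df y (0, delta_mx 0 i) 0 j).
    by apply/funext => y; rewrite mxE.
  rewrite [J p i j]mxE; exact: (cvg_mx_entry h).
- move=> p hp; have [lin H] := dfP _ hp; apply/cvgrPdist_le => e e0.
  have add u w : df p (u + w) = df p u + df p w by have := lin 1 u w; rewrite !scale1r.
  have d0 : df p 0 = 0 by apply: (@addrI _ (df p 0)); rewrite -add !addr0.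
  have scl a u : df p (a *: u) = a *: df p u by have := lin a u 0; rewrite d0 !addr0.
  have [K K0 HK] := mulmxr_bounded (J p).
  pose C := `|df p (1, 0)| + K.
  have C0 : 0 < C + 1 by rewrite addr_gt0// /C ltr_wpDl.
  have bnd u : `|df p u| <= C * `|u|.
    have Eu : u = u.1 *: (1, 0) + (0, u.2).
      apply: injective_projections => /=; last by rewrite scaler0 add0r.
      by rewrite [_ *: _]mulr1 addr0.
    rewrite [in leLHS]Eu add scl linE// [C * _]mulrDl; apply: le_trans (ler_normD _ _) _.
    have [w1 w2] : `|u.1| <= `|u| /\ `|u.2| <= `|u|.
      by rewrite prod_normE/= !le_max !lexx orbT.
    rewrite normrZ; apply: lerD; first by rewrite mulrC ler_wpM2l.
    by apply: le_trans (HK _) _; rewrite ler_pM2l.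
  have := H 1 ltr01; rewrite !near_withinE => H1.
  have H2 : \forall y \near p, `|p - y| <= e / (C + 1).
    have : (fun y : R * V => y) @ p --> p by exact: cvg_id.
    by move=> /cvgrPdist_le; apply; rewrite divr_gt0.
  apply: filterS (filterI H1 H2) => y [/= h1 h2] Dy.
  have h3 := h1 Dy; have h4 := bnd (y - p).
  rewrite distrC.
  have := ler_normD (cmap d (phi y.1 (cinv c y.2)) - cmap d (phi p.1 (cinv c p.2))
     - df p (y - p)) (df p (y - p)).
  rewrite subrK => h5.
  rewrite mul1r in h3.
  have h6 : (C + 1) * `|y - p| <= e by rewrite mulrC -ler_pdivlMr// distrC.
  rewrite mulrDl mul1r in h6.
  lra.
Qed.

Lemma flow_curve_continuous t y : 0 <= t -> {within `[0, t], continuous (phi ^~ y)}.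
Proof.
move=> t0; have [h _] := flow_integral flow (flow_dom_ge0 y t0).
have E : `[0, t]%classic = seg t.
  by apply/seteqP; split => s /=; rewrite /seg /= in_itv/= min_l// max_r.
by rewrite E.
Qed.

(** Read in the chart, the flow is continuous at [(0, x)]: a curve that starts
    near [x] is, at those short times when it is in the chart, in a given small
    neighbourhood of [x]. So the set of these times is open and closed, and
    connectedness of the time interval makes it the whole interval. *)
Lemma flow_box c x : atlas S c -> cdom c x ->
  exists2 d : R, 0 < d & \forall y \near x, forall t, 0 <= t < d -> cdom c (phi t y).
Proof.
move=> ac cx; have cc := atlas_chart ac.
have [oc _ invK _ _] := cc.
(* [B] below is a neighbourhood of [x] whose closure lies in the chart. *)
have reg : {for x, regular_space M}.
  by apply: (@compact_regular _ x setT (mfd_hausdorff S) cptM); exact: filterT.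
have [B nB BK] := reg _ (chart_dom_near cc cx).
have [J [_ _ Fc]] := flow_jacobian ac ac.
have d0 := flow_dom_ge0 x (lexx 0).
have px : phi 0 x = x by exact: (flow0 flow).
have hp : fdom c c (0, cmap c x) by apply: fdom_cmap => //; rewrite px.
have H1 := Fc _ hp; rewrite /= invK// px in H1.
have H2 : \forall p \near (0 : R, cmap c x), fdom c c p ->
   ((cmap c @` cdom c) (cmap c (phi p.1 (cinv c p.2))) ->
     B (cinv c (cmap c (phi p.1 (cinv c p.2))))).
  exact: (H1 _ (chart_near cc cx nB)).
have [[P Q] [/= nP nQ] PQ] := H2.
have [d dpos dP] := nP.
exists d => //.
have nQ' : \forall y \near x, Q (cmap c y) by exact: (chart_cmap_cvg cc cx).
apply: filterS (filterI nQ' (chart_dom_near cc cx)) => y [Qy cy] t /andP[t0 td].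
have key s : 0 <= s < d -> cdom c (phi s y) -> B (phi s y).
  move=> /andP[s0 sd] cs.
  have Ps : P s by apply: dP; rewrite /ball_/= sub0r normrN ger0_norm.
  have := PQ (s, cmap c y) (conj Ps Qy) (fdom_cmap ac cy (flow_dom_ge0 y s0) _).
  by rewrite /= !invK//; apply => //; exists (phi s y).
have cg := @flow_curve_continuous t y t0.
pose Z := [set s : R | s \in `[0, t] /\ cdom c (phi s y)].
have Zt : Z = `[0, t]%classic.
  apply: (@segment_connected R 0 t).
  - by exists 0; split; rewrite ?in_itv/= ?lexx// (flow0 flow).
  - have /continuousP/(_ _ oc)/open_subspaceP[W oW WE] := cg.
    exists W => //; rewrite setIC WE; apply/seteqP; split => s /=; first by case.
    by case.
  - have /continuous_closedP/(_ _ (@closed_closure _ B))/closed_subspaceP[W cW WE] := cg.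
    exists W => //; rewrite setIC WE; apply/seteqP; split => s /=.
      move=> [st cs]; split => //; apply: subset_closure; apply: key => //.
      by move: st; rewrite in_itv/= => /andP[-> /le_lt_trans]; apply.
    by move=> [Ks st]; split => //; exact: BK.
have : Z t by rewrite Zt /= in_itv/= t0 lexx.
by case.
Qed.

Definition flow_cont s y :=
  (fun p : R * M => phi p.1 p.2) @ within [set p : R * M | 0 <= p.1] (nbhs (s, y)) --> phi s y.

(** Flow boxes give a uniform short time near each point; compactness of the
    manifold gives one short time for all points. *)
Lemma flow_cont_small : exists2 d : R, 0 < d & forall y s, 0 <= s < d -> flow_cont s y.
Proof.
pose P (d : R) (y : M) := forall s, 0 <= s < d -> flow_cont s y.
have : \forall d \near (0 : R)^'+, [set: M] `<=` P d.
  have /compact_near_coveringP := cptM; apply => x _.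
  pose c := A x; have ac := chart_at_atlas S x; have cx := chart_at_domE S x.
  have cc := atlas_chart ac; have [oc _ invK _ _] := cc.
  have [d d0 box] := flow_box ac cx.
  have H : \forall y \near x, P d y.
    have b1 : \forall y \near x, nbhs y [set y | forall t, 0 <= t < d -> cdom c (phi t y)].
      exact: near_join box.
    have b2 : \forall y \near x, nbhs y (cdom c) by exact: near_join (chart_dom_near cc cx).
    apply: filterS (filterI b1 b2) => y [by1 cy1] s /andP[s0 sd].
    have cy := nbhs_singleton cy1; have cs := nbhs_singleton by1 s.
    rewrite s0 sd in cs; have {}cs := cs isT.
    have [J [_ _ Fc]] := flow_jacobian ac ac.
    have hp := fdom_cmap ac cy (flow_dom_ge0 y s0) cs.
    have H1 := Fc _ hp; rewrite /= invK// in H1.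
    move=> W nW.
    have H2 : \forall p \near (s, cmap c y), fdom c c p ->
      ((cmap c @` cdom c) (cmap c (phi p.1 (cinv c p.2))) ->
       W (cinv c (cmap c (phi p.1 (cinv c p.2))))).
      exact: (H1 _ (chart_near cc cs nW)).
    have cv : (fun p : R * M => (p.1, cmap c p.2)) @ (s, y) --> (s, cmap c y).
      move=> U [[U1 U2] [/= n1 n2] U12].
      have n2' : \forall z \near y, U2 (cmap c z) by exact: (chart_cmap_cvg cc cy).
      exists (U1, [set z | U2 (cmap c z)]) => //= -[r z] [/= u1 u2].
      by apply: U12.
    have H3 : \forall p \near (s, y), fdom c c (p.1, cmap c p.2) ->
      ((cmap c @` cdom c) (cmap c (phi p.1 (cinv c (cmap c p.2)))) ->
       W (cinv c (cmap c (phi p.1 (cinv c (cmap c p.2)))))).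
      exact: (cv _ H2).
    have H4 : \forall p \near (s, y), [/\ p.1 < d, cdom c p.2 & forall t, 0 <= t < d -> cdom c (phi t p.2)].
      have n1 : \forall r \near s, r < d by near=> r; near: r; exact: lt_nbhsl.
      exists ([set r | r < d], [set z | cdom c z /\ forall t, 0 <= t < d -> cdom c (phi t z)]).
        by split => //=; exact: filterI.
      by move=> [r z] [/= ? []].
    change (\forall p \near (s, y), 0 <= p.1 -> W (phi p.1 p.2)).
    apply: filterS (filterI H3 H4) => -[r z] [/= h3 [rd cz bz]] r0.
    have cr : cdom c (phi r z) by apply: bz; rewrite r0 rd.
    rewrite !invK// in h3; apply: h3; first exact: (fdom_cmap ac cz (flow_dom_ge0 z r0) cr).
    by exists (phi r z).
  exists (P d, [set e | 0 < e < d]) => /=.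
    split => //.
    near=> e; apply/andP; split; first by near: e; exact: nbhs_right_gt.
    by near: e; exact: nbhs_right_lt.
  move=> [y e] [/= Py /andP[e0 ed]] s /andP[s0 se].
  by apply: Py; rewrite s0 (lt_trans se).
move=> H; have [d [d0 dP]] : exists d : R, 0 < d /\ [set: M] `<=` P d.
  have n : \forall d \near (0 : R)^'+, 0 < d /\ [set: M] `<=` P d.
    by near=> d; split; near: d; [exact: nbhs_right_gt|exact: H].
  by have [d] := filter_ex n; exists d.
by exists d => // y s; exact: dP.
Unshelve. all: by end_near. Qed.

(** A time is halved until it is short: [phi r] is [phi (r / 2)] applied twice.
    *)
Lemma flow_continuous s y : 0 <= s -> flow_cont s y.
Proof.
have [d d0 Hd] := flow_cont_small.
suff H n : forall y s, 0 <= s < d *+ (2 ^ n)%N -> flow_cont s y.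
  move=> s0; apply: (H (Num.truncn (s / d)).+1); rewrite s0/=.
  rewrite -mulr_natr -ltr_pdivrMl// mulrC.
  have := truncnS_gt (s / d) => /lt_trans; apply.
  by rewrite ltr_nat ltn_expl.
elim: n => [|n IH] {}y {}s; first by rewrite expn0 mulr1n; exact: Hd.
move=> /andP[s0 sd].
have h0 : 0 <= s / 2 by rewrite divr_ge0.
have h1 : 0 <= s / 2 < d *+ (2 ^ n)%N.
  by rewrite h0/= ltr_pdivrMr// mulr_natr -mulrnA -expnSr.
have c1 := IH y _ h1; have c2 := IH (phi (s / 2) y) _ h1.
have E r z : 0 <= r -> phi r z = phi (r / 2) (phi (r / 2) z).
  by move=> r0; rewrite -flow_semigroup -?splitr// divr_ge0.
move=> W nW; rewrite E// in nW.
have n1 : \forall p \near (s / 2, phi (s / 2) y), 0 <= p.1 -> W (phi p.1 p.2) := c2 _ nW.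
have [[U1 U2] [/= m1 m2] U12] := n1.
have n2 : \forall p \near (s / 2, y), 0 <= p.1 -> U2 (phi p.1 p.2) := c1 _ m2.
have cv : (fun p : R * M => (p.1 / 2, p.2)) @ (s, y) --> (s / 2, y).
  move=> U [[V1 V2] [/= k1 k2] V12].
  have k1' : \forall r \near s, V1 (r / 2).
    have : (fun r : R => r / 2) @ s --> s / 2 by apply: cvgM; [exact: cvg_id|exact: cvg_cst].
    by apply.
  by exists ([set r | V1 (r / 2)], V2) => //= -[r z] [/= u1 u2]; apply: V12.
have n3 : \forall p \near (s, y), 0 <= p.1 / 2 -> U2 (phi (p.1 / 2) p.2) := cv _ n2.
have n4 : \forall p \near (s, y), U1 (p.1 / 2).
  have n4' : \forall p \near (s / 2, y), U1 p.1 by exists (U1, setT) => /=; [split => //; exact: filterT|case=> ? ? []].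
  exact: (cv _ n4').
change (\forall p \near (s, y), 0 <= p.1 -> W (phi p.1 p.2)).
apply: filterS (filterI n3 n4) => -[r z] [/= a3 a4] r0.
have r20 : 0 <= r / 2 by rewrite divr_ge0.
by rewrite E//; apply: (U12 (r / 2, phi (r / 2) z)) => //; split => //=; exact: a3.
Qed.

End Flow.

(** * The derivative cocycle of the flow *)

Section FlowDifferential.
Context {R : realType} {m : nat} {M : topologicalType}.
Variable S : smooth_manifold R m M.
Variables (X : M -> 'rV[R]_m) (phi : R -> M -> M).
Hypothesis flow : is_flow S X phi.
Hypothesis cptM : compact [set: M].
Local Notation V := 'rV[R]_m.
Local Notation A := (chart_at S).
Local Notation DX := (flow_diff S X phi).

Lemma flow_near t x (P : M -> Prop) : 0 <= t -> (\forall y \near phi t x, P y) ->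
  \forall y \near x, P (phi t y).
Proof.
move=> t0 nP.
have H : \forall p \near (t, x), 0 <= p.1 -> P (phi p.1 p.2) :=
  flow_continuous flow cptM t0 nP.
have [[U1 U2] [/= n1 n2] U12] := H.
apply: filterS n2 => y U2y; apply: (U12 (t, y)) => //; split => //=.
exact: nbhs_singleton.
Qed.

Lemma flow_diff_chart_deriv t x : flow_dom S X t x ->
  chart_deriv (A x) (A (phi t x)) (flow_dom S X t) (phi t) x (DX t x).
Proof.
move=> tx; have [J [H _ _]] := flow_jacobian flow (chart_at_atlas S x) (chart_at_atlas S (phi t x)).
by apply: (loc_diffP (H _ _ _ _ _)) => //; exact: chart_at_domE.
Qed.

Lemma flow_diff_jacobian c d t x J : atlas S c -> atlas S d -> 0 <= t ->
  cdom c x -> cdom d (phi t x) -> chart_deriv c d (flow_dom S X t) (phi t) x J ->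
  tcoord S c x *m J = DX t x *m tcoord S d (phi t x).
Proof.
move=> ac ad t0 cx dx hJ.
have tx := flow_dom_ge0 flow _ t0.
have Ax := atlas_at S x; have cAx := chart_at_domE S x.
have h1 : chart_deriv (A x) d (flow_dom S X t) (phi t) x (tcoord S c x *m J).
  apply: (chart_deriv_comp Ax (atlas_chart ac) cAx cx (tcoord_chart_deriv ac cx) hJ) => //.
  by apply: filterS (chart_dom_near (atlas_chart ac) cx) => y cy _.
have h2 : chart_deriv (A x) d (flow_dom S X t) (phi t) x (DX t x *m tcoord S d (phi t x)).
  apply: (chart_deriv_comp Ax (atlas_at S (phi t x)) cAx (chart_at_domE S (phi t x)) (flow_diff_chart_deriv (tx x)) (tcoord_chart_deriv ad dx)) => //.
  have := chart_dom_near (atlas_at S (phi t x)) (chart_at_domE S (phi t x)).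
  by move=> /(flow_near t0); apply: filterS => y dy; split.
apply: (chart_deriv_unique _ _ _ h1 h2) => //.
have := chart_dom_near (atlas_chart ad) dx.
by move=> /(flow_near t0); apply: filterS => y dy; split.
Qed.

Lemma flow_diffD s t x : 0 <= s -> 0 <= t ->
  DX (s + t) x = DX s x *m DX t (phi s x).
Proof.
move=> s0 t0; have st0 : 0 <= s + t by rewrite addr_ge0.
have tx := flow_dom_ge0 flow _ t0; have sx := flow_dom_ge0 flow _ s0.
have stx := flow_dom_ge0 flow _ st0.
have E y : phi (s + t) y = phi t (phi s y) by exact: (flow_semigroup flow y s0 t0).
have h1 := flow_diff_chart_deriv (stx x).
have h2 : chart_deriv (A x) (A (phi (s + t) x)) (flow_dom S X (s + t)) (phi (s + t)) x
  (DX s x *m DX t (phi s x)).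
  have h3 := flow_diff_chart_deriv (tx (phi s x)); rewrite -E in h3.
  apply: (chart_deriv_comp (atlas_at S x) (atlas_at S (phi s x)) (chart_at_domE S x)
    (chart_at_domE S (phi s x)) (flow_diff_chart_deriv (sx x)) h3) => //.
  have := chart_dom_near (atlas_at S (phi s x)) (chart_at_domE S (phi s x)).
  by move=> /(flow_near s0); apply: filterS => y dy _; split.
apply: (chart_deriv_unique _ _ _ h1 h2); [exact: atlas_at|exact: chart_at_domE|].
have := chart_dom_near (atlas_at S (phi (s + t) x)) (chart_at_domE S (phi (s + t) x)).
by move=> /(flow_near st0); apply: filterS => y; split => //; exact: stx.
Qed.

Lemma flow_dom_back t x : 0 <= t -> flow_dom S X (- t) (phi t x).
Proof.
move=> t0; have [cc area_rate] := flow_integral flow (flow_dom_ge0 flow x t0).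
have segE s : seg (- t) s -> seg t (t + s).
  rewrite /seg /= min_r ?oppr_le0// max_l ?oppr_le0// min_l// max_r//.
  by move=> /andP[h1 h2]; apply/andP; split; lra.
have cvs s : (fun r : R => t + r) @ s --> t + s.
  by apply: cvgD; [exact: cvg_cst|exact: cvg_id].
exists (fun s => phi (t + s) x); first by rewrite addr0.
split.
  apply/subspace_continuousP => s hs.
  have /subspace_continuousP/(_ _ (segE _ hs)) h := cc.
  move=> W nW; have n1 : \forall r \near t + s, seg t r -> W (phi r x) := h _ nW.
  have n2 : \forall r \near s, seg t (t + r) -> W (phi (t + r) x) := cvs s _ n1.
  change (\forall r \near s, seg (- t) r -> W (phi (t + r) x)).
  by apply: (@filterS _ (nbhs s) _ _ _ _ n2) => r nr /segE.
move=> s hs; have [lin H] := area_rate _ (segE _ hs).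
split => // e e0; have n1 := H e e0; rewrite near_withinE in n1.
rewrite near_withinE; have n2 := cvs s _ n1.
apply: (@filterS _ (nbhs s) _ _ _ _ n2) => r /= nr /segE hr.
have := nr hr.
by have -> : t + r - (t + s) = r - s by ring.
Qed.

Lemma flow_back t x : 0 <= t -> phi (- t) (phi t x) = x.
Proof.
move=> t0.
have [_ <-] := flow_add flow (flow_dom_ge0 flow x t0) (flow_dom_back x t0).
by rewrite subrr (flow0 flow).
Qed.

(** The map [X_{-t} o X_t] is the identity on the whole manifold for [t >= 0],
    although [X_{-t}] need not be defined on all of it; so the chain rule is
    applied at [x]. *)
Lemma flow_diff_back t x : 0 <= t -> DX t x *m DX (- t) (phi t x) = 1%:M.
Proof.
move=> t0; have tx := flow_dom_ge0 flow _ t0.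
have h1 := flow_diff_chart_deriv (flow_dom_back x t0); rewrite flow_back// in h1.
have h2 := flow_diff_chart_deriv (tx x).
have h3 : chart_deriv (A x) (A x) (flow_dom S X t) id x (DX t x *m DX (- t) (phi t x)).
  apply: (chart_deriv_comp (atlas_at S x) (atlas_at S (phi t x)) (chart_at_domE S x)
    (chart_at_domE S (phi t x)) h2 h1); last exact: flow_back.
  have := chart_dom_near (atlas_at S (phi t x)) (chart_at_domE S (phi t x)).
  move=> /(flow_near t0); apply: filterS => y dy _; split => //; first exact: flow_dom_back.
  exact: flow_back.
apply: (chart_deriv_unique _ _ _ h3); [exact: atlas_at|exact: chart_at_domE| |].
  have := chart_dom_near (atlas_at S x) (chart_at_domE S x).
  by apply: filterS => y; split.
by apply: chart_deriv_id; [exact: atlas_at|exact: chart_at_domE].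
Qed.

Lemma flow_diff_unit t x : 0 <= t -> DX t x \in unitmx.
Proof. by move=> t0; have [] := mulmx1_unit (flow_diff_back x t0). Qed.

End FlowDifferential.

(** * Quadratic forms, areas and frames of planes *)

Section Forms.
Context {R : realType} {m : nat}.
Local Notation V := 'rV[R]_m.
Implicit Types (G H A : 'M[R]_m) (u v w : V) (U : {vspace V}).

Lemma dotgDl G u v w : dotg G (u + v) w = dotg G u w + dotg G v w.
Proof. by rewrite /dotg !mulmxDl mxE. Qed.

Lemma dotgDr G u v w : dotg G u (v + w) = dotg G u v + dotg G u w.
Proof. by rewrite /dotg linearD mulmxDr mxE. Qed.

Lemma dotgZl G a u w : dotg G (a *: u) w = a * dotg G u w.
Proof. by rewrite /dotg -!scalemxAl mxE. Qed.

Lemma dotgZr G a u w : dotg G u (a *: w) = a * dotg G u w.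
Proof. by rewrite /dotg linearZ -scalemxAr mxE. Qed.

Lemma dotg0l G w : dotg G 0 w = 0.
Proof. by rewrite /dotg !mul0mx mxE. Qed.

Lemma dotgC G u w : G^T = G -> dotg G u w = dotg G w u.
Proof.
move=> sG; have E : (u *m G *m w^T)^T = w *m G *m u^T.
  by rewrite trmx_mul trmxK trmx_mul sG mulmxA.
by rewrite /dotg -E [RHS]mxE.
Qed.

Lemma dotgDf G H u w : dotg (G + H) u w = dotg G u w + dotg H u w.
Proof. by rewrite /dotg mulmxDr mulmxDl mxE. Qed.

Lemma dotgZf a G u w : dotg (a *: G) u w = a * dotg G u w.
Proof. by rewrite /dotg -scalemxAr -scalemxAl mxE. Qed.

Definition pull_form A G := A *m G *m A^T.

Lemma dotg_pull A G u w : dotg (pull_form A G) u w = dotg G (u *m A) (w *m A).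
Proof. by rewrite /dotg /pull_form trmx_mul !mulmxA. Qed.

Lemma pull_form_sym A G : G^T = G -> (pull_form A G)^T = pull_form A G.
Proof. by move=> sG; rewrite /pull_form !trmx_mul trmxK sG mulmxA. Qed.

Lemma pull_formM A B G : pull_form (A *m B) G = pull_form A (pull_form B G).
Proof. by rewrite /pull_form trmx_mul !mulmxA. Qed.

Lemma pull_form1 G : pull_form 1%:M G = G.
Proof. by rewrite /pull_form trmx1 mulmx1 mul1mx. Qed.

Lemma dotg_entry G i j : G i j = dotg G (delta_mx 0 i) (delta_mx 0 j).
Proof. by rewrite /dotg trmx_delta -rowE -colE !mxE. Qed.

Definition psd G := G^T = G /\ forall v, 0 <= dotg G v v.

Lemma psd_pull A G : psd G -> psd (pull_form A G).
Proof. by move=> [sG pG]; split; [exact: pull_form_sym|move=> v; rewrite dotg_pull]. Qed.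

Lemma psdZ a G : 0 <= a -> psd G -> psd (a *: G).
Proof.
move=> a0 [sG pG]; split; first by rewrite linearZ/= sG.
by move=> v; rewrite dotgZf mulr_ge0.
Qed.

Lemma inner_psd G : inner_product G -> psd G.
Proof.
move=> [sG pG]; split => // v; have [->|/pG/ltW//] := eqVneq v 0.
by rewrite dotg0l.
Qed.

Lemma inner_pull A G : A \in unitmx -> inner_product G -> inner_product (pull_form A G).
Proof.
move=> uA [sG pG]; split; first exact: pull_form_sym.
move=> v v0; rewrite dotg_pull; apply: pG; apply: contra v0 => /eqP E.
by rewrite -(mulmxK uA v) E mul0mx.
Qed.

Lemma psd_CS G v w : psd G -> (dotg G v w) ^+ 2 <= dotg G v v * dotg G w w.
Proof.
move=> [sG pG].
set a := dotg G v v; set b := dotg G v w; set c := dotg G w w.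
have H (s t : R) : 0 <= s ^+ 2 * a + 2 * s * t * b + t ^+ 2 * c.
  have := pG (s *: v + t *: w).
  rewrite !(dotgDl, dotgDr, dotgZl, dotgZr) (dotgC w v sG) -/a -/b -/c.
  by congr (0 <= _); ring.
have a0 : 0 <= a by exact: pG.
have c0 : 0 <= c by exact: pG.
have [ca|ca] := eqVneq c 0.
  have [->|b0] := eqVneq b 0; first by rewrite expr0n mulr_ge0.
  have := H 1 (- (a + 1) / (2 * b)); rewrite ca mulr0 addr0 expr1n mul1r mulr1.
  have -> : 2 * (- (a + 1) / (2 * b)) * b = - (a + 1) by field.
  lra.
have cp : 0 < c by rewrite lt_def ca.
have := H c (- b).
have -> : c ^+ 2 * a + 2 * c * - b * b + (- b) ^+ 2 * c = c * (a * c - b ^+ 2) by ring.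
by rewrite pmulr_rge0// subr_ge0.
Qed.

(** The squared area of the parallelogram on [v] and [w]. *)
Definition gram2 G v w := dotg G v v * dotg G w w - dotg G v w ^+ 2.

(** The polar form of [gram2]. Divided by [gram2 G v w] it is the trace of [H]
    relative to [G] on the span of [v] and [w], that is, a squared
    Hilbert-Schmidt norm when [H] is a pulled back inner product. *)
Definition mix2 G H v w :=
  dotg G v v * dotg H w w + dotg G w w * dotg H v v - 2 * (dotg G v w * dotg H v w).

Lemma gram2_ge0 G v w : psd G -> 0 <= gram2 G v w.
Proof. by move=> /(psd_CS v w); rewrite subr_ge0. Qed.

Lemma gram2D G H v w : gram2 (G + H) v w = gram2 G v w + gram2 H v w + mix2 G H v w.
Proof. rewrite /gram2 /mix2 !dotgDf; ring. Qed.

Lemma gram2Z a G v w : gram2 (a *: G) v w = a ^+ 2 * gram2 G v w.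
Proof. rewrite /gram2 !dotgZf; ring. Qed.

(** By the Cauchy-Schwarz inequality for both forms and the inequality between
    arithmetic and geometric means. *)
Lemma mix2_ge0 G H v w : psd G -> psd H -> 0 <= mix2 G H v w.
Proof.
move=> pG pH; have cG := psd_CS v w pG; have cH := psd_CS v w pH.
have [g1 g2] : 0 <= dotg G v v /\ 0 <= dotg G w w by split; exact: pG.2.
have [h1 h2] : 0 <= dotg H v v /\ 0 <= dotg H w w by split; exact: pH.2.
rewrite /mix2.
move: g1 g2 h1 h2 cG cH.
set a := dotg G v v; set b := dotg G w w; set c := dotg G v w.
set a' := dotg H v v; set b' := dotg H w w; set c' := dotg H v w.
move=> g1 g2 h1 h2 cG cH.
rewrite subr_ge0; apply: le_trans (ler_norm _) _.
rewrite -(@ler_pXn2r _ 2) ?nnegrE// ?addr_ge0 ?mulr_ge0//.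
rewrite real_normK ?num_real//.
have h3 : (c * c') ^+ 2 <= (a * b) * (a' * b').
  by rewrite exprMn; apply: ler_pM => //; exact: sqr_ge0.
have := sqr_ge0 (a * b' - b * a'); lra.
Qed.

Lemma mix2C G H v w : mix2 G H v w = mix2 H G v w.
Proof. rewrite /mix2; ring. Qed.

Lemma mix2Zl a G H v w : mix2 (a *: G) H v w = a * mix2 G H v w.
Proof. rewrite /mix2 !dotgZf; ring. Qed.

Lemma psdB G H : G^T = G -> H^T = H -> (forall v, dotg H v v <= dotg G v v) ->
  psd (G - H).
Proof.
move=> sG sH le; split; first by rewrite linearB/= sG sH.
by move=> v; rewrite -scaleN1r dotgDf dotgZf mulN1r subr_ge0.
Qed.

(** The mixed area is bilinear in the two forms and nonnegative on positive
    ones, hence monotone in each. *)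
Lemma mix2_le G H G' H' v w : psd G -> psd H -> psd G' -> psd H' ->
  (forall v, dotg G v v <= dotg G' v v) -> (forall v, dotg H v v <= dotg H' v v) ->
  mix2 G H v w <= mix2 G' H' v w.
Proof.
move=> pG pH pG' pH' leG leH.
have p1 := psdB pG'.1 pG.1 leG; have p2 := psdB pH'.1 pH.1 leH.
have E (P Q : 'M[R]_m) : mix2 (G + P) (H + Q) v w =
    mix2 G H v w + mix2 G Q v w + mix2 P H v w + mix2 P Q v w.
  by rewrite /mix2 !dotgDf; ring.
have eG : G + (G' - G) = G' by rewrite addrC subrK.
have eH : H + (H' - H) = H' by rewrite addrC subrK.
have := E (G' - G) (H' - H); rewrite eG eH => ->.
have := mix2_ge0 v w pG p2; have := mix2_ge0 v w p1 pH; have := mix2_ge0 v w p1 p2.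
lra.
Qed.

Lemma gram2_le G H v w : psd G -> psd H ->
  (forall v, dotg G v v <= dotg H v v) -> gram2 G v w <= gram2 H v w.
Proof.
move=> pG pH le; have p1 := psdB pH.1 pG.1 le.
have eH : G + (H - G) = H by rewrite addrC subrK.
have := gram2D G (H - G) v w; rewrite eH => ->.
have := mix2_ge0 v w pG p1; have := gram2_ge0 v w p1; lra.
Qed.

Definition lincomb2 (a b : R) v w := a *: v + b *: w.

Lemma gram2_comb G a b c d v w : G^T = G ->
  gram2 G (lincomb2 a b v w) (lincomb2 c d v w) = (a * d - b * c) ^+ 2 * gram2 G v w.
Proof.
move=> sG; rewrite /gram2 /lincomb2 !(dotgDl, dotgDr, dotgZl, dotgZr) (dotgC w v sG); ring.
Qed.

Lemma mix2_comb G H a b c d v w : G^T = G -> H^T = H ->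
  mix2 G H (lincomb2 a b v w) (lincomb2 c d v w) = (a * d - b * c) ^+ 2 * mix2 G H v w.
Proof.
move=> sG sH; rewrite /mix2 /lincomb2 !(dotgDl, dotgDr, dotgZl, dotgZr) (dotgC w v sG) (dotgC w v sH); ring.
Qed.

Definition pos_def_on G U := G^T = G /\ forall v, v \in U -> v != 0 -> 0 < dotg G v v.

Lemma inner_pos_def_on G U : inner_product G -> pos_def_on G U.
Proof. by move=> [sG pG]; split => // v _; exact: pG. Qed.

Definition frame2 U v w := basis_of U [:: v; w].

Lemma frame2_comb U v w u : frame2 U v w -> u \in U ->
  exists a b, u = lincomb2 a b v w.
Proof.
move=> /andP[/eqP <- _]; rewrite span_cons span_seq1 => /memv_addP[x /vlineP[a ->]].
by move=> [y /vlineP[b ->] ->]; exists a, b.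
Qed.

Lemma frame2_mem U v w a b : frame2 U v w -> lincomb2 a b v w \in U.
Proof.
move=> /andP[/eqP <- _]; rewrite span_cons span_seq1.
by apply/memv_addP; exists (a *: v); [exact: memvZ (memv_line v)|exists (b *: w) => //; exact: memvZ (memv_line w)].
Qed.

Lemma frame2_meml U v w : frame2 U v w -> v \in U.
Proof. by move=> /(frame2_mem 1 0); rewrite /lincomb2 scale1r scale0r addr0. Qed.

Lemma frame2_memr U v w : frame2 U v w -> w \in U.
Proof. by move=> /(frame2_mem 0 1); rewrite /lincomb2 scale1r scale0r add0r. Qed.

Lemma frame2_free U v w : frame2 U v w -> v \notin <[w]>%VS /\ w != 0.
Proof. by move=> /andP[_]; rewrite free_cons span_seq1 seq1_free => /andP[]. Qed.

Lemma gram2_gt0 G U v w : pos_def_on G U -> frame2 U v w -> 0 < gram2 G v w.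
Proof.
move=> pG fr; have [vw w0] := frame2_free fr.
have wU := frame2_memr fr; have vU := frame2_meml fr.
have gw : 0 < dotg G w w by exact: pG.2.
pose t := dotg G v w / dotg G w w.
pose z := lincomb2 1 (- t) v w.
have zU : z \in U by exact: frame2_mem.
have z0 : z != 0.
  apply: contra vw => /eqP; rewrite /z /lincomb2 scale1r scaleNr => /eqP.
  rewrite subr_eq0 => /eqP ->; exact: memvZ (memv_line w).
have gz : 0 < dotg G z z by exact: pG.2.
have -> : gram2 G v w = dotg G w w * dotg G z z.
  rewrite /gram2 /z /lincomb2 !(dotgDl, dotgDr, dotgZl, dotgZr) (dotgC w v pG.1) /t.
  by field; rewrite gt_eqF.
exact: mulr_gt0.
Qed.

(** A vector orthogonal, for [G], to the combination [a v + b w], scaled so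
    that its coordinates, and the identities below, are polynomial. *)
Definition perp2 G a b v w :=
  lincomb2 (- (a * dotg G v w + b * dotg G w w)) (a * dotg G v v + b * dotg G v w) v w.

Lemma perp2_gram G Q a b v w : G^T = G -> Q^T = Q ->
  gram2 Q (lincomb2 a b v w) (perp2 G a b v w) =
  dotg G (lincomb2 a b v w) (lincomb2 a b v w) ^+ 2 * gram2 Q v w.
Proof.
move=> sG sQ; rewrite /perp2 gram2_comb//; congr (_ ^+ 2 * _).
rewrite /lincomb2 !(dotgDl, dotgDr, dotgZl, dotgZr) (dotgC w v sG); ring.
Qed.

Lemma perp2_norm G a b v w : G^T = G ->
  dotg G (perp2 G a b v w) (perp2 G a b v w) =
  dotg G (lincomb2 a b v w) (lincomb2 a b v w) * gram2 G v w.
Proof.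
move=> sG; rewrite /gram2 /perp2 /lincomb2 !(dotgDl, dotgDr, dotgZl, dotgZr) (dotgC w v sG); ring.
Qed.

Lemma perp2_mix G Q a b v w : G^T = G -> Q^T = Q ->
  mix2 Q G v w * dotg G (lincomb2 a b v w) (lincomb2 a b v w) =
  dotg Q (lincomb2 a b v w) (lincomb2 a b v w) * gram2 G v w +
  dotg Q (perp2 G a b v w) (perp2 G a b v w).
Proof.
move=> sG sQ; rewrite /mix2 /gram2 /perp2 /lincomb2 !(dotgDl, dotgDr, dotgZl, dotgZr).
rewrite (dotgC w v sG) (dotgC w v sQ); ring.
Qed.

(** The operator norm of a map between planes is at most its Hilbert-Schmidt
    norm. *)
Lemma frame2_upper G Q U v w u : G^T = G -> Q^T = Q ->
  (forall z, z \in U -> 0 <= dotg Q z z) -> frame2 U v w -> u \in U ->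
  dotg Q u u * gram2 G v w <= mix2 Q G v w * dotg G u u.
Proof.
move=> sG sQ pQ fr /(frame2_comb fr)[a [b ->]].
rewrite perp2_mix// lerDl; apply: pQ; exact: frame2_mem.
Qed.

(** [frame2_upper] with the two forms exchanged, that is, for the inverse map:
    its Hilbert-Schmidt norm is that of the map divided by the determinant. *)
Lemma frame2_lower G Q U v w u : G^T = G -> Q^T = Q ->
  (forall z, z \in U -> 0 <= dotg G z z) -> frame2 U v w -> u \in U ->
  gram2 Q v w * dotg G u u <= mix2 Q G v w * dotg Q u u.
Proof. by move=> sG sQ pG fr uU; rewrite mulrC mix2C; exact: (frame2_upper sQ sG pG fr uU). Qed.

(** In a plane the squared Hilbert-Schmidt norm is the sum of two squared
    lengths, hence at most twice the squared operator norm. *)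
Lemma frame2_hs G Q U v w c : pos_def_on G U -> Q^T = Q -> frame2 U v w ->
  (forall z, z \in U -> dotg Q z z <= c * dotg G z z) ->
  mix2 Q G v w <= 2 * c * gram2 G v w.
Proof.
move=> pG sQ fr le; have g := gram2_gt0 pG fr.
have [vw w0] := frame2_free fr.
have wU := frame2_memr fr.
have gw : 0 < dotg G w w by exact: pG.2.
have := @perp2_mix G Q 0 1 v w pG.1 sQ.
have -> : lincomb2 0 1 v w = w by rewrite /lincomb2 scale1r scale0r add0r.
have h1 := le _ wU.
have := le _ (frame2_mem _ _ fr : perp2 G 0 1 v w \in U).
rewrite perp2_norm ?pG.1//; have -> : lincomb2 0 1 v w = w by rewrite /lincomb2 scale1r scale0r add0r.
move=> h2 h3.
rewrite -(ler_pM2r gw) h3.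
have : dotg Q w w * gram2 G v w <= c * dotg G w w * gram2 G v w by rewrite ler_pM2r.
lra.
Qed.

(** The area of the image of an orthogonal pair is at most the product of the
    lengths, and one of these is bounded by the operator norm. *)
Lemma frame2_det_upper G Q U v w u c : pos_def_on G U -> psd Q ->
  frame2 U v w -> u \in U -> (forall z, z \in U -> dotg Q z z <= c * dotg G z z) ->
  gram2 Q v w * dotg G u u <= c * dotg Q u u * gram2 G v w.
Proof.
move=> pG pQ fr uU le; have [->|u0] := eqVneq u 0.
  by rewrite !dotg0l !mulr0 mul0r.
have gu : 0 < dotg G u u by exact: pG.2.
have [a [b ue]] := frame2_comb fr uU.
have sG := pG.1; have sQ := pQ.1.
have e1 := perp2_gram a b v w sG sQ; have e2 := perp2_norm a b v w sG.
have h := le _ (frame2_mem _ _ fr : perp2 G a b v w \in U).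
rewrite -ue in e1 e2 h; rewrite e2 in h.
have qu : 0 <= dotg Q u u by exact: pQ.2.
have : gram2 Q u (perp2 G a b v w) <= dotg Q u u * (c * (dotg G u u * gram2 G v w)).
  apply: le_trans (_ : dotg Q u u * dotg Q (perp2 G a b v w) (perp2 G a b v w) <= _).
    by rewrite /gram2 lerBlDr lerDl sqr_ge0.
  exact: ler_wpM2l.
rewrite e1 expr2 => h3; rewrite -(ler_pM2l gu).
by move: h3; congr (_ <= _); ring.
Qed.

Lemma frame2_change U v w v' w' : frame2 U v w -> frame2 U v' w' ->
  exists2 k : R, k != 0 &
    (forall G, G^T = G -> gram2 G v' w' = k * gram2 G v w) /\
    (forall G H, G^T = G -> H^T = H -> mix2 G H v' w' = k * mix2 G H v w).
Proof.
move=> fr fr'.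
have [a [b ev]] := frame2_comb fr (frame2_meml fr').
have [c [d ew]] := frame2_comb fr (frame2_memr fr').
exists ((a * d - b * c) ^+ 2); last first.
  by split => [G sG|G H sG sH]; rewrite ev ew ?gram2_comb// mix2_comb.
have iI : pos_def_on (1%:M : 'M[R]_m) U.
  split; first exact: trmx1.
  move=> z _ z0; rewrite /dotg mulmx1 lt_def; apply/andP; split; last first.
    by rewrite mxE sumr_ge0// => i _; rewrite mxE -expr2 sqr_ge0.
  apply: contra z0; rewrite mxE psumr_eq0; last by move=> i _; rewrite mxE -expr2 sqr_ge0.
  move=> /allP H; apply/eqP/rowP => i; rewrite mxE.
  by have := H i (mem_index_enum i); rewrite mxE /= -expr2 sqrf_eq0 => /eqP.
have := gram2_gt0 iI fr'; rewrite ev ew gram2_comb ?trmx1//.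
by apply: contraTneq => ->; rewrite mul0r ltxx.
Qed.

End Forms.

Section NormsAndDets.
Context {R : realType} {m : nat}.
Local Notation V := 'rV[R]_m.
Implicit Types (G H A : 'M[R]_m) (u v w : V) (U : {vspace V}).

Lemma normg_ge0 G v : 0 <= normg G v.
Proof. exact: sqrtr_ge0. Qed.

Lemma normgZ G a v : psd G -> normg G (a *: v) = `|a| * normg G v.
Proof.
by move=> pG; rewrite /normg dotgZl dotgZr mulrA -expr2 sqrtrM ?sqr_ge0// sqrtr_sqr.
Qed.

Lemma normg_sq G v : psd G -> normg G v ^+ 2 = dotg G v v.
Proof. by move=> pG; rewrite sqr_sqrtr//; exact: pG.2. Qed.

Lemma opnorm_ge0 G H A U : 0 <= opnorm G H A U.
Proof.
rewrite /opnorm; set B := (X in sup X).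
have B0 : B 0.
  exists 0; last by rewrite mul0mx /normg dotg0l sqrtr0.
  by split; [exact: mem0v|rewrite /normg dotg0l sqrtr0].
have [hB|] := pselect (has_sup B); first exact: sup_upper_bound.
by move=> /sup_out ->.
Qed.

Lemma opnorm_le G H A U (c : R) : 0 <= c ->
  (forall v, v \in U -> normg H (v *m A) <= c * normg G v) -> opnorm G H A U <= c.
Proof.
move=> c0 le; apply: ge_sup.
  by exists (normg H (0 *m A)), 0 => //; split; [exact: mem0v|rewrite /normg dotg0l sqrtr0].
move=> _ [v [vU v1] <-]; apply: le_trans (le _ vU) _.
by rewrite ler_piMr.
Qed.

(** A positive definite form attains a positive minimum on the compact unit
    sphere. *)
Lemma inner_coercive G : inner_product G ->
  exists2 c : R, 0 < c & forall v, c * `|v| ^+ 2 <= dotg G v v.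
Proof.
move=> iG.
pose B := [set v : V | `|v| = 1].
have cB : compact B.
  apply: bounded_closed_compact.
    by exists 1; split => // N N1 v /= ->; exact: ltW.
  apply: (@closed_comp _ _ (fun v : V => `|v|) [set 1]); last exact: closed_eq.
  by move=> v _; exact: norm_continuous.
have cd : continuous (fun v : V => dotg G v v).
  move=> v; have h1 : (fun u : V => u) @ v --> v by exact: cvg_id.
  have h2 : (fun _ : V => G) @ nbhs v --> G by apply: cvg_mx => i j; exact: cvg_cst.
  exact: (cvg_mx_entry (cvg_mulmx (cvg_mulmx h1 h2) (cvg_trmx h1))).
have H : \forall c \near (0 : R)^'+, B `<=` [set v | c <= dotg G v v].
  have /compact_near_coveringP := cB; apply => v v1.
  have v0 : v != 0 by rewrite -normr_gt0 v1.
  have a0 : 0 < dotg G v v / 2 by rewrite divr_gt0// iG.2.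
  have n0 : dotg G v v / 2 < dotg G v v by lra.
  have n1 : \forall u \near v, dotg G v v / 2 < dotg G u u := cd v _ (lt_nbhsr n0).
  exists ([set u | dotg G v v / 2 < dotg G u u], [set c | c < dotg G v v / 2]) => /=.
    by split => //; exact: nbhs_right_lt.
  by move=> [u c] [/= h1 h2]; rewrite ltW// (lt_trans h2).
have [c [c0 hc]] : exists c : R, 0 < c /\ B `<=` [set v | c <= dotg G v v].
  have n : \forall c \near (0 : R)^'+, 0 < c /\ B `<=` [set v | c <= dotg G v v].
    by near=> c; split; near: c; [exact: nbhs_right_gt|exact: H].
  by have [c] := filter_ex n; exists c.
exists c => // v; have [->|v0] := eqVneq v 0.
  by rewrite normr0 dotg0l expr0n mulr0.
have nv : 0 < `|v| by rewrite normr_gt0.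
have /= := hc (`|v|^-1 *: v).
rewrite /B/= normrZ normfV normr_id mulVf ?gt_eqF// => /(_ erefl).
rewrite dotgZl dotgZr mulrA -expr2 exprVn mulrC ler_pdivlMr ?exprn_gt0//.
Unshelve. all: by end_near. Qed.

Lemma dotg_bound H v : `|dotg H v v| <= (\sum_i \sum_j `|H i j|) * `|v| ^+ 2.
Proof.
rewrite /dotg mxE; apply: le_trans (ler_norm_sum _ _ _) _.
rewrite exchange_big mulr_suml; apply: ler_sum => j _.
rewrite !mxE normrM expr2 mulrA; apply: ler_pM => //; last exact: mx_entry_le.
rewrite mulr_suml; apply: le_trans (ler_norm_sum _ _ _) _; apply: ler_sum => i _.
by rewrite normrM mulrC ler_wpM2l// mx_entry_le.
Qed.

Lemma form_bound G H : inner_product G ->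
  exists2 c : R, 0 < c & forall v, dotg H v v <= c * dotg G v v.
Proof.
move=> iG; have [c c0 hc] := inner_coercive iG.
set K := \sum_i \sum_j `|H i j|.
have K0 : 0 <= K by apply: sumr_ge0 => i _; exact: sumr_ge0.
exists ((K + 1) / c); first by rewrite divr_gt0// ltr_wpDl.
move=> v; have h1 := le_trans (ler_norm _) (dotg_bound H v).
apply: le_trans h1 _; rewrite -/K mulrAC ler_pdivlMr//.
have h2 := hc v; have v2 := sqr_ge0 `|v|.
apply: le_trans (_ : (K + 1) * (c * `|v| ^+ 2) <= _); last first.
  by rewrite ler_pM2l// ltr_wpDl.
have h3 : 0 <= c * `|v| ^+ 2 by rewrite mulr_ge0// ltW.
lra.
Qed.

(** The supremum defining [opnorm] is finite because forms on a
    finite-dimensional space are bounded by a positive definite one. *)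
Lemma opnorm_ub G H A U v : inner_product G -> psd H -> v \in U ->
  normg H (v *m A) <= opnorm G H A U * normg G v.
Proof.
move=> iG pH vU; have pG := inner_psd iG.
have [c c0 hc] := form_bound (pull_form A H) iG.
have [v0|v0] := eqVneq v 0.
  by rewrite v0 mul0mx /normg !dotg0l sqrtr0 mulr0.
have nv : 0 < normg G v by rewrite sqrtr_gt0; exact: iG.2.
rewrite -ler_pdivrMr//.
have -> : normg H (v *m A) / normg G v = normg H (((normg G v)^-1 *: v) *m A).
  by rewrite -scalemxAl normgZ// ger0_norm ?invr_ge0 ?normg_ge0// mulrC.
apply: sup_upper_bound.
  split.
    by exists (normg H (0 *m A)), 0 => //; split; [exact: mem0v|rewrite /normg dotg0l sqrtr0].
  exists (Num.sqrt c) => _ [u [uU u1] <-].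
  apply: ler_wsqrtr; rewrite -dotg_pull; apply: le_trans (hc u) _.
  rewrite ler_piMr ?(ltW c0)// -normg_sq//.
  by rewrite expr_le1// normg_ge0.
exists ((normg G v)^-1 *: v) => //; split; first exact: memvZ.
by rewrite normgZ// ger0_norm ?invr_ge0 ?normg_ge0// mulVf// gt_eqF.
Qed.

End NormsAndDets.

(** * Determinants on planes *)

Section Absdet.
Context {R : realType} {m : nat}.
Local Notation V := 'rV[R]_m.
Implicit Types (G H A : 'M[R]_m) (u v w : V) (U : {vspace V}).

Lemma det_mx2 (B : 'M[R]_2) : \det B = B 0 0 * B 1 1 - B 0 1 * B 1 0.
Proof.
rewrite (expand_det_row _ 0) !big_ord_recl big_ord0 addr0 /cofactor !det_mx11 !mxE /=.
have -> : lift 0 0 = 1 :> 'I_2 by exact: val_inj.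
have -> : lift 1 0 = 0 :> 'I_2 by exact: val_inj.
by rewrite expr0 expr1 mul1r mulN1r mulrN.
Qed.

Lemma dim2_frame U : \dim U = 2%N -> exists v w, frame2 U v w.
Proof.
move=> d2; have h := vbasisP U; have : size (tval (vbasis U)) = 2%N by rewrite size_tuple.
by move: h; case: (tval _) => [|v [|w [|]]]// h _; exists v, w.
Qed.

Lemma frame2_dim U v w : frame2 U v w -> \dim U = 2%N.
Proof. by move=> /andP[/eqP <-] /eqP ->. Qed.

Lemma dim2_orthonormal G U : pos_def_on G U -> \dim U = 2%N ->
  exists v w, [/\ frame2 U v w, dotg G v v = 1, dotg G w w = 1 & dotg G v w = 0].
Proof.
move=> pG /dim2_frame[v [w fr]].
have [vw w0] := frame2_free fr.
have wU := frame2_memr fr; have vU := frame2_meml fr.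
have gw : 0 < dotg G w w by exact: pG.2.
pose t := dotg G v w / dotg G w w.
pose z := lincomb2 1 (- t) v w.
have zU : z \in U by exact: frame2_mem.
have zE : z = v - t *: w by rewrite /z /lincomb2 scale1r scaleNr.
have z0 : z != 0.
  apply: contra vw; rewrite zE subr_eq0 => /eqP ->; exact: memvZ (memv_line w).
have gz : 0 < dotg G z z by exact: pG.2.
have gzw : dotg G z w = 0.
  by rewrite /z /lincomb2 !(dotgDl, dotgZl) /t; field; rewrite gt_eqF.
pose a := (Num.sqrt (dotg G z z))^-1; pose b := (Num.sqrt (dotg G w w))^-1.
have a0 : a != 0 by rewrite invr_eq0 gt_eqF// sqrtr_gt0.
have b0 : b != 0 by rewrite invr_eq0 gt_eqF// sqrtr_gt0.
have sq (x : R) : 0 < x -> (Num.sqrt x)^-1 * ((Num.sqrt x)^-1 * x) = 1.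
  by move=> x0; rewrite mulrA -expr2 exprVn sqr_sqrtr ?ltW// mulVf// gt_eqF.
exists (a *: z), (b *: w); split.
- rewrite /frame2 basisEdim (frame2_dim fr) /= leqnn andbT.
  move: fr => /andP[/eqP <- _].
  rewrite !span_cons span_nil !addv0; apply/subvP => u /memv_addP[x /vlineP[k ->]] [y /vlineP[l ->] ->].
  apply/memv_addP; exists ((k / a) *: (a *: z)); first exact: memvZ (memv_line _).
  exists (((l + k * t) / b) *: (b *: w)); first exact: memvZ (memv_line _).
  by rewrite !scalerA !divfK// zE scalerBr scalerDl scalerA addrACA addNr addr0.
- by rewrite dotgZl dotgZr sq.
- by rewrite dotgZl dotgZr sq.
- by rewrite dotgZl dotgZr gzw !mulr0.
Qed.

Lemma push_dim A U : A \in unitmx -> \dim (push A U) = \dim U.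
Proof.
move=> uA; apply: limg_dim_eq; apply/eqP; rewrite -subv0; apply/subvP => v.
rewrite memv_cap memv_ker lfunE /= memv0 => /andP[_ /eqP E].
by rewrite -(mulmxK uA v) E mul0mx.
Qed.

Lemma push_mem A U v : v \in U -> v *m A \in push A U.
Proof.
move=> vU; have -> : v *m A = linfun (mulmxr A) v by rewrite lfunE.
exact: memv_img.
Qed.

Lemma push_memP A U w : w \in push A U -> exists2 v, v \in U & w = v *m A.
Proof. by move=> /memv_imgP[v vU ->]; exists v => //; rewrite lfunE. Qed.

(** This characterizes the determinant on a plane without orthonormal bases: it
    is the ratio of areas in an arbitrary frame. *)
Lemma absdetP G H A U v w : inner_product G -> inner_product H -> A \in unitmx ->
  frame2 U v w ->
  0 <= absdet G H A U /\ absdet G H A U ^+ 2 * gram2 G v w = gram2 (pull_form A H) v w.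
Proof.
move=> iG iH uA fr; have d2 := frame2_dim fr.
pose D (k : nat) (d : R) := exists b b' : k.-tuple V,
    [/\ orthonormal_basis G U b, orthonormal_basis H (push A U) b' &
        d = `|\det (\matrix_(i, j) dotg H (tnth b i *m A) (tnth b' j))|].
have absE : absdet G H A U = get (D 2%N) by rewrite -d2.
have mk K W (x y : V) : inner_product K -> frame2 W x y -> dotg K x x = 1 -> dotg K y y = 1 ->
    dotg K x y = 0 -> orthonormal_basis K W [tuple x; y].
  move=> iK f xx yy xy; split => // i j.
  have yx : dotg K y x = 0 by rewrite dotgC ?iK.1.
  by case: i => -[|[|]]//= ?; case: j => -[|[|]]//= ?; rewrite /tnth /=.
have D0 : exists d, D 2%N d.
  have [x [y [f1 xx yy xy]]] := dim2_orthonormal (inner_pos_def_on U iG) d2.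
  have d2' : \dim (push A U) = 2%N by rewrite push_dim.
  have [x' [y' [f1' xx' yy' xy']]] := dim2_orthonormal (inner_pos_def_on (push A U) iH) d2'.
  eexists; exists [tuple x; y], [tuple x'; y']; split; [exact: mk|exact: mk|reflexivity].
have : D 2%N (absdet G H A U) by rewrite absE; case: D0 => d Dd; exact: (getPex (ex_intro _ d Dd)).
move=> [b [b' [[bb ob] [bb' ob'] ->]]]; split => //.
have tupE (c : 2.-tuple V) : tval c = [:: tnth c 0; tnth c 1].
  by case: c => -[|x [|y [|]]]//= i; rewrite /tnth /=.
have f1 : frame2 U (tnth b 0) (tnth b 1) by rewrite /frame2 -tupE.
have f2 : frame2 (push A U) (tnth b' 0) (tnth b' 1) by rewrite /frame2 -tupE.
set x := tnth b 0 in f1 *; set y := tnth b 1 in f1 *.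
set x' := tnth b' 0 in f2 *; set y' := tnth b' 1 in f2 *.
have xx : gram2 G x y = 1.
  by rewrite /gram2 (ob 0 0) (ob 1 1) (ob 0 1) expr0n mulr1 subr0.
have xx' : gram2 H x' y' = 1.
  by rewrite /gram2 (ob' 0 0) (ob' 1 1) (ob' 0 1) expr0n mulr1 subr0.
have [p [q e1]] := frame2_comb f2 (push_mem A (frame2_meml f1)).
have [r [s e2]] := frame2_comb f2 (push_mem A (frame2_memr f1)).
have [h11 h12] : dotg H x' x' = 1 /\ dotg H x' y' = 0 by rewrite (ob' 0 0) (ob' 0 1).
have [h21 h22] : dotg H y' x' = 0 /\ dotg H y' y' = 1 by rewrite (ob' 1 0) (ob' 1 1).
have key : gram2 (pull_form A H) x y = `|\det (\matrix_(i, j) dotg H (tnth b i *m A) (tnth b' j))| ^+ 2.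
  rewrite real_normK ?num_real// det_mx2 !mxE -/x -/y -/x' -/y' e1 e2.
  have -> : gram2 (pull_form A H) x y = gram2 H (x *m A) (y *m A) by rewrite /gram2 !dotg_pull.
  rewrite e1 e2 gram2_comb ?iH.1// xx' /lincomb2 !(dotgDl, dotgZl) h11 h12 h21 h22; ring.
have [k k0 [kg _]] := frame2_change fr f1.
rewrite -key; have sP : (pull_form A H)^T = pull_form A H by apply: pull_form_sym; exact: iH.1.
by rewrite (kg _ sP) mulrAC -(kg _ iG.1) xx mul1r.
Qed.

End Absdet.

(** * Continuous fields of quadratic forms *)

Section InvmxCvg.
Context {R : realType} {T : Type} {F : set_system T} {FF : Filter F}.

Lemma cvg_cofactor n (A : T -> 'M[R]_n) (A0 : 'M[R]_n) i j : A @ F --> A0 ->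
  cofactor (A y) i j @[y --> F] --> cofactor A0 i j.
Proof.
move=> hA; rewrite /cofactor; apply: cvgM; first exact: cvg_cst.
apply: cvg_det; apply: cvg_mx => k l.
have -> : (fun y => row' i (col' j (A y)) k l) = (fun y => A y (lift i k) (lift j l)).
  by apply/funext => y; rewrite !mxE.
rewrite !mxE; exact: (cvg_mx_entry hA).
Qed.

(** Through the adjugate, inversion is a rational function of the entries. *)
Lemma cvg_invmx n (A : T -> 'M[R]_n) (A0 : 'M[R]_n) : A0 \in unitmx -> A @ F --> A0 ->
  (fun y => invmx (A y)) @ F --> invmx A0.
Proof.
move=> uA hA; have dA : \det (A y) @[y --> F] --> \det A0 by exact: cvg_det.
have d0 : \det A0 != 0 by rewrite -unitfE -unitmxE.
have nu : \forall y \near F, A y \in unitmx.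
  have := @cvgr_neq0 _ _ _ F FF _ _ dA d0; by apply: filterS => y; rewrite unitmxE unitfE.
have h : (fun y => (\det (A y))^-1 *: \adj (A y)) @ F --> invmx A0.
  rewrite /invmx uA; apply: cvg_mx => i j.
  have -> : (fun y => ((\det (A y))^-1 *: \adj (A y)) i j) =
      (fun y => (\det (A y))^-1 * cofactor (A y) j i).
    by apply/funext => y; rewrite !mxE.
  rewrite !mxE; apply: cvgM; first exact: (cvgV d0 dA).
  exact: cvg_cofactor.
apply: cvg_trans h; apply: near_eq_cvg.
by apply: filterS nu => y uy; rewrite /invmx uy.
Qed.

Lemma cvg_pull_form n (A G : T -> 'M[R]_n) (A0 G0 : 'M[R]_n) :
  A @ F --> A0 -> G @ F --> G0 -> (fun y => pull_form (A y) (G y)) @ F --> pull_form A0 G0.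
Proof. by move=> hA hG; exact: (cvg_mulmx (cvg_mulmx hA hG) (cvg_trmx hA)). Qed.

Lemma cvg_dotg n (G : T -> 'M[R]_n) (u v : T -> 'rV[R]_n) (G0 : 'M[R]_n) (u0 v0 : 'rV[R]_n) :
  G @ F --> G0 -> u @ F --> u0 -> v @ F --> v0 ->
  dotg (G y) (u y) (v y) @[y --> F] --> dotg G0 u0 v0.
Proof.
move=> hG hu hv; exact: (cvg_mx_entry (cvg_mulmx (cvg_mulmx hu hG) (cvg_trmx hv))).
Qed.

Lemma cvg_gram2 n (G : T -> 'M[R]_n) (u v : T -> 'rV[R]_n) (G0 : 'M[R]_n) (u0 v0 : 'rV[R]_n) :
  G @ F --> G0 -> u @ F --> u0 -> v @ F --> v0 ->
  gram2 (G y) (u y) (v y) @[y --> F] --> gram2 G0 u0 v0.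
Proof.
move=> hG hu hv.
have H (a b : T -> 'rV[R]_n) (a0 b0 : 'rV[R]_n) (ha : a @ F --> a0) (hb : b @ F --> b0) :
  dotg (G y) (a y) (b y) @[y --> F] --> dotg G0 a0 b0 by exact: cvg_dotg.
exact: (cvgB (cvgM (H _ _ _ _ hu hu) (H _ _ _ _ hv hv)) (cvgM (H _ _ _ _ hu hv) (H _ _ _ _ hu hv))).
Qed.

Lemma cvg_mix2 n (G H : T -> 'M[R]_n) (u v : T -> 'rV[R]_n) (G0 H0 : 'M[R]_n) (u0 v0 : 'rV[R]_n) :
  G @ F --> G0 -> H @ F --> H0 -> u @ F --> u0 -> v @ F --> v0 ->
  mix2 (G y) (H y) (u y) (v y) @[y --> F] --> mix2 G0 H0 u0 v0.
Proof.
move=> hG hH hu hv.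
have D (Q : T -> 'M[R]_n) (Q0 : 'M[R]_n) (hQ : Q @ F --> Q0)
    (a b : T -> 'rV[R]_n) (a0 b0 : 'rV[R]_n) (ha : a @ F --> a0) (hb : b @ F --> b0) :
  dotg (Q y) (a y) (b y) @[y --> F] --> dotg Q0 a0 b0 by exact: cvg_dotg.
apply: cvgB.
  exact: (cvgD (cvgM (D _ _ hG _ _ _ _ hu hu) (D _ _ hH _ _ _ _ hv hv))
   (cvgM (D _ _ hG _ _ _ _ hv hv) (D _ _ hH _ _ _ _ hu hu))).
apply: cvgM; first exact: cvg_cst.
exact: (cvgM (D _ _ hG _ _ _ _ hu hv) (D _ _ hH _ _ _ _ hu hv)).
Qed.

(** A coercivity constant of the limit form, halved, serves all nearby forms.
    *)
Lemma near_compare n (G Q : T -> 'M[R]_n) (G0 Q0 : 'M[R]_n) :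
  inner_product G0 -> G @ F --> G0 -> Q @ F --> Q0 ->
  exists C : R, \forall y \near F, forall v, dotg (Q y) v v <= C * dotg (G y) v v.
Proof.
move=> iG hG hQ; have [c c0 hc] := inner_coercive iG.
pose nm (H : 'M[R]_n) : R := \sum_i \sum_j `|H i j|.
have cvg_nm (H : T -> 'M[R]_n) (H0 : 'M[R]_n) : H @ F --> H0 -> nm (H y) @[y --> F] --> nm H0.
  move=> hH; apply: cvg_sumR => i; apply: cvg_sumR => j.
  exact: (cvg_norm (cvg_mx_entry hH)).
have h1 : \forall y \near F, nm (Q y) <= nm Q0 + 1.
  have lt1 : nm Q0 < nm Q0 + 1 by rewrite ltrDl.
  have h0 : \forall y \near F, nm (Q y) < nm Q0 + 1 := cvg_nm _ _ hQ _ (lt_nbhsl lt1).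
  by apply: filterS h0 => y /ltW.
have h2 : \forall y \near F, nm (G0 - G y) <= c / 2.
  have hD : (fun y => G0 - G y) @ F --> G0 - G0.
    apply: cvg_mx => i j.
    have -> : (fun y => (G0 - G y) i j) = (fun y => G0 i j - G y i j).
      by apply/funext => y; rewrite !mxE.
    by rewrite !mxE; apply: cvgB; [exact: cvg_cst|exact: (cvg_mx_entry hG)].
  have n0 : nm (G0 - G0) < c / 2.
    rewrite subrr /nm big1 ?divr_gt0// => i _; rewrite big1// => j _.
    by rewrite mxE normr0.
  have h0 : \forall y \near F, nm (G0 - G y) < c / 2 := cvg_nm _ _ hD _ (lt_nbhsl n0).
  by apply: filterS h0 => y /ltW.
exists ((nm Q0 + 1) * (2 / c)); apply: filterS (filterI h1 h2) => y [/= {}h1 {}h2] v.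
have q := le_trans (ler_norm _) (dotg_bound (Q y) v).
have g1 := le_trans (ler_norm _) (dotg_bound (G0 - G y) v).
have g2 := hc v; have v2 := sqr_ge0 `|v|.
have e : dotg (G0 - G y) v v = dotg G0 v v - dotg (G y) v v.
  by rewrite -scaleN1r dotgDf dotgZf mulN1r.
rewrite e in g1.
have g3 : c / 2 * `|v| ^+ 2 <= dotg (G y) v v.
  have : nm (G0 - G y) * `|v| ^+ 2 <= c / 2 * `|v| ^+ 2 by rewrite ler_wpM2r.
  rewrite /nm; lra.
apply: le_trans q _.
apply: le_trans (_ : (nm Q0 + 1) * `|v| ^+ 2 <= _); first by rewrite ler_wpM2r.
have n1 : 0 <= nm Q0 + 1.
  by rewrite addr_ge0// /nm; apply: sumr_ge0 => i _; exact: sumr_ge0.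
rewrite -mulrA ler_wpM2l// mulrC -ler_pdivrMr ?divr_gt0//.
by rewrite invf_div mulrC.
Qed.

End InvmxCvg.

Section FormFields.
Context {R : realType} {m : nat} {M : topologicalType}.
Variable S : smooth_manifold R m M.
Variables (X : M -> 'rV[R]_m) (phi : R -> M -> M) (Gamma : set M).
Hypothesis flow : is_flow S X phi.
Hypothesis cptM : compact [set: M].
Hypothesis cptG : compact Gamma.
Hypothesis inv : forall t x, 0 <= t -> Gamma x -> Gamma (phi t x).
Local Notation V := 'rV[R]_m.
Local Notation DX := (flow_diff S X phi).
Implicit Types (x y : M) (r s t : R) (Q G : M -> 'M[R]_m) (c d : chart R m M).

Lemma metric_inE Q c x : metric_in S Q c x = pull_form (invmx (tcoord S c x)) (Q x).
Proof. by []. Qed.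

Lemma dotg_metric_in Q c x v w : atlas S c -> cdom c x ->
  dotg (metric_in S Q c x) (v *m tcoord S c x) (w *m tcoord S c x) = dotg (Q x) v w.
Proof. by move=> ac cx; rewrite metric_inE dotg_pull !mulmxK// tcoord_unit. Qed.

(** Continuity at [x] is required in every chart around [x], since the matrix
    [Q y] itself refers to the distinguished chart at [y], which may jump with
    [y]. *)
Definition cont_form Q := forall c x, atlas S c -> cdom c x -> Gamma x ->
  metric_in S Q c @ within Gamma (nbhs x) --> metric_in S Q c x.

Definition cont_fun (p : M -> R) := forall x, Gamma x ->
  p @ within Gamma (nbhs x) --> p x.

Lemma cont_form_within Q c : atlas S c -> cont_form Q ->
  {within Gamma `&` cdom c, continuous (metric_in S Q c)}.
Proof.
move=> ac cQ; apply/subspace_continuousP => x [Gx cx].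
apply: cvg_trans (cQ c x ac cx Gx); apply: cvg_app.
move=> W hW; have hW' : \forall y \near x, Gamma y -> W y := hW.
change (\forall y \near x, (Gamma `&` cdom c) y -> W y).
by apply: filterS hW' => y H [Gy _]; exact: H.
Qed.

Lemma cont_form_metric g : riemannian_metric S g -> cont_form g.
Proof.
move=> [_ H] c x ac cx Gx; have cc := atlas_chart ac; have [_ _ invK _ _] := cc.
have /= h0 := H c ac 0%N.
have h : (fun v => metric_in S g c (cinv c v)) @ within (cmap c @` cdom c) (nbhs (cmap c x)) -->
    metric_in S g c (cinv c (cmap c x)).
  by move/subspace_continuousP : h0; apply; exists x.
have ex : cinv c (cmap c x) = x by exact: invK.
move: h; rewrite ex => h.
move=> W nW; have h1 : \forall v \near cmap c x, (cmap c @` cdom c) v ->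
  W (metric_in S g c (cinv c v)) := h _ nW.
have h2 : \forall y \near x, (cmap c @` cdom c) (cmap c y) ->
  W (metric_in S g c (cinv c (cmap c y))) := chart_cmap_cvg cc cx h1.
change (\forall y \near x, Gamma y -> W (metric_in S g c y)).
apply: filterS (filterI h2 (chart_dom_near cc cx)) => y [/= h3 cy] _.
by move: h3; rewrite invK//; apply; exists y.
Qed.

Lemma cont_formD Q Q' : cont_form Q -> cont_form Q' -> cont_form (fun x => Q x + Q' x).
Proof.
move=> h h' c x ac cx Gx.
have E y : metric_in S (fun x => Q x + Q' x) c y = metric_in S Q c y + metric_in S Q' c y.
  by rewrite /metric_in mulmxDr mulmxDl.
rewrite (_ : metric_in S (fun x => Q x + Q' x) c =
  (fun y => metric_in S Q c y + metric_in S Q' c y)); last exact/funext.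
exact: (cvgD (h c x ac cx Gx) (h' c x ac cx Gx)).
Qed.

Lemma cont_formZ p Q : cont_fun p -> cont_form Q -> cont_form (fun x => p x *: Q x).
Proof.
move=> hp h c x ac cx Gx; have hQ := h c x ac cx Gx.
have E y : metric_in S (fun x => p x *: Q x) c y = p y *: metric_in S Q c y.
  by rewrite /metric_in -scalemxAr -scalemxAl.
rewrite (_ : metric_in S (fun x => p x *: Q x) c =
  (fun y => p y *: metric_in S Q c y)); last exact/funext.
exact: (cvgZ (hp x Gx) hQ).
Qed.

(** Pairs of a point of [Gamma] near [x] and a nonnegative time near [r]: the
    domain on which the flow is known to be continuous and to preserve [Gamma].
    *)
Definition flow_filter (x : M) (r : R) := filter_prod (within Gamma (nbhs x)) (within [set r : R | 0 <= r] (nbhs r)).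

Global Instance flow_filter_filter x r : Filter (flow_filter x r).
Proof. exact: filter_prod_filter. Qed.

Lemma flow_filter_near x r (P : M * R -> Prop) :
  (\forall p \near (x, r), P p) -> \forall p \near flow_filter x r, P p.
Proof.
move=> [[A B] [/= nA nB] AB]; exists (A, B) => //=; split.
  by rewrite /within/=; apply: filterS nA.
by rewrite /within/=; apply: filterS nB.
Qed.

Lemma flow_filter_in x r : \forall p \near flow_filter x r, Gamma p.1 /\ 0 <= p.2.
Proof.
exists (Gamma, [set r : R | 0 <= r]) => /=; last by move=> [y s] [].
by split; rewrite /within/=; apply: nearW.
Qed.

Lemma flow_filter_within x r (P : M * R -> Prop) :
  (\forall p \near flow_filter x r, P p) ->
  \forall p \near (x, r), Gamma p.1 -> 0 <= p.2 -> P p.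
Proof.
move=> [[A B] [/= nA nB] AB]; exists ((fun y => Gamma y -> A y), (fun s => 0 <= s -> B s)) => //.
by move=> [y s] [/= h1 h2] Gy s0; apply: AB; split; [exact: h1|exact: h2].
Qed.

Lemma flow_filter_flow x r : 0 <= r -> Gamma x ->
  (fun p : M * R => phi p.2 p.1) @ flow_filter x r --> within Gamma (nbhs (phi r x)).
Proof.
move=> r0 Gx W nW.
have H : \forall p \near (r, x), 0 <= p.1 -> (Gamma (phi p.1 p.2) -> W (phi p.1 p.2)) :=
  flow_continuous flow cptM r0 nW.
have [[A B] [/= nA nB] AB] := H.
have H2 : \forall p \near (x, r), 0 <= p.2 -> (Gamma (phi p.2 p.1) -> W (phi p.2 p.1)).
  by exists (B, A) => //= -[y s] [/= By As]; exact: (AB (s, y)).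
change (\forall p \near flow_filter x r, W (phi p.2 p.1)).
apply: filterS (filterI (flow_filter_near H2) (flow_filter_in x r)) => -[y s] [/= h [Gy s0]].
by apply: h => //; exact: inv.
Qed.

End FormFields.

Section PulledForms.
Context {R : realType} {m : nat} {M : topologicalType}.
Variable S : smooth_manifold R m M.
Variables (X : M -> 'rV[R]_m) (phi : R -> M -> M) (Gamma : set M).
Hypothesis flow : is_flow S X phi.
Hypothesis cptM : compact [set: M].
Hypothesis inv : forall t x, 0 <= t -> Gamma x -> Gamma (phi t x).
Local Notation V := 'rV[R]_m.
Local Notation DX := (flow_diff S X phi).
Implicit Types (x y : M) (r s t : R) (Q G : M -> 'M[R]_m) (c d : chart R m M).

Definition pulled Q (r : R) (x : M) := pull_form (DX r x) (Q (phi r x)).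

(** In charts at both ends the pulled back form is a product of the Jacobian of
    the flow, which is continuous, with the form; the distinguished charts drop
    out. *)
Lemma pulled_cvg Q c x r : cont_form S Gamma Q -> atlas S c -> cdom c x -> Gamma x -> 0 <= r ->
  (fun p : M * R => metric_in S (pulled Q p.2) c p.1) @ flow_filter Gamma x r -->
  metric_in S (pulled Q r) c x.
Proof.
move=> cQ ac cx Gx r0.
pose d := chart_at S (phi r x).
have ad := chart_at_atlas S (phi r x); have dx := chart_at_domE S (phi r x).
have cc := atlas_chart ac; have cd := atlas_chart ad; have [_ _ invK _ _] := cc.
have [J [HJ cJ _]] := flow_jacobian flow ac ad.
have E s y : 0 <= s -> cdom c y -> cdom d (phi s y) ->
  metric_in S (pulled Q s) c y = pull_form (J (s, cmap c y)) (metric_in S Q d (phi s y)).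
  move=> s0 cy dy; have sy := flow_dom_ge0 flow y s0.
  have e := flow_diff_jacobian flow cptM ac ad s0 cy dy (HJ _ _ cy sy dy).
  have uc := tcoord_unit ac cy; have ud := tcoord_unit ad dy.
  have eJ : J (s, cmap c y) = invmx (tcoord S c y) *m (DX s y *m tcoord S d (phi s y)).
    by rewrite -e; exact: (esym (mulKmx uc _)).
  rewrite !metric_inE /pulled eJ !pull_formM; congr pull_form; congr pull_form.
  by rewrite -pull_formM mulmxV// pull_form1.
have ff := flow_filter_flow flow cptM inv r0 Gx.
have nd : \forall p \near flow_filter Gamma x r, cdom d (phi p.2 p.1).
  apply: (ff (cdom d)); rewrite /within/=.
  by apply: filterS (chart_dom_near cd dx) => z.
have nc : \forall p \near flow_filter Gamma x r, cdom c p.1.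
  apply: flow_filter_near; exists (cdom c, setT) => /=; last by move=> [y s] [].
  by split; [exact: (chart_dom_near cc cx)|exact: filterT].
have lim : (fun p : M * R => pull_form (J (p.2, cmap c p.1)) (metric_in S Q d (phi p.2 p.1)))
    @ flow_filter Gamma x r --> metric_in S (pulled Q r) c x.
  rewrite E//; apply: cvg_pull_form.
    move=> W nW.
    have hp := fdom_cmap ac cx (flow_dom_ge0 flow x r0) dx.
    have H1 : \forall p \near (r, cmap c x), fdom S X phi c d p -> W (J p) := cJ _ hp _ nW.
    have cv : (fun p : M * R => (p.2, cmap c p.1)) @ (x, r) --> (r, cmap c x).
      move=> U [[U1 U2] [/= n1 n2] U12].
      have n2' : \forall z \near x, U2 (cmap c z) by exact: (chart_cmap_cvg cc cx).
      exists ([set z | U2 (cmap c z)], U1) => //= -[z s] [/= u1 u2].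
      by apply: U12.
    have H2 : \forall p \near (x, r), fdom S X phi c d (p.2, cmap c p.1) -> W (J (p.2, cmap c p.1)).
      exact: (cv _ H1).
    have H3 : \forall p \near flow_filter Gamma x r,
      fdom S X phi c d (p.2, cmap c p.1) -> W (J (p.2, cmap c p.1)).
      exact: flow_filter_near H2.
    have H4 := flow_filter_in Gamma x r.
    have H5 : \forall p \near flow_filter Gamma x r, W (J (p.2, cmap c p.1)).
      apply: filterS (filterI H3 (filterI H4 (filterI nd nc))).
      move=> [y s] [/= h [[Gy s0] [dy cy]]]; apply: h.
      exact: (fdom_cmap ac cy (flow_dom_ge0 flow y s0) dy).
    exact: H5.
  have h := cQ d (phi r x) ad dx (inv r0 Gx).
  move=> W nW; have nW2 : within Gamma (nbhs (phi r x)) (fun z => W (metric_in S Q d z)) := h W nW.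
  have nW3 : \forall p \near flow_filter Gamma x r, W (metric_in S Q d (phi p.2 p.1)) := ff _ nW2.
  exact: nW3.
apply: cvg_trans lim; apply: near_eq_cvg.
apply: filterS (filterI (flow_filter_in Gamma x r) (filterI nd nc)) => -[y s] [/= [Gy s0] [dy cy]].
by rewrite E.
Qed.

End PulledForms.

(** * Comparison along compact pieces of orbits *)

Section FlowForms.
Context {R : realType} {m : nat} {M : topologicalType}.
Variable S : smooth_manifold R m M.
Variables (X : M -> 'rV[R]_m) (phi : R -> M -> M) (Gamma : set M).
Hypothesis flow : is_flow S X phi.
Hypothesis cptM : compact [set: M].
Hypothesis cptG : compact Gamma.
Hypothesis inv : forall t x, 0 <= t -> Gamma x -> Gamma (phi t x).
Local Notation V := 'rV[R]_m.
Local Notation DX := (flow_diff S X phi).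
Implicit Types (x y : M) (r s t : R) (Q G : M -> 'M[R]_m) (c d : chart R m M).

Definition cont_flow_form (Q : R -> M -> 'M[R]_m) := forall c x r, atlas S c -> cdom c x ->
  Gamma x -> 0 <= r ->
  (fun p : M * R => metric_in S (Q p.2) c p.1) @ flow_filter Gamma x r -->
  metric_in S (Q r) c x.

Lemma cont_flow_form_pulled Q : cont_form S Gamma Q -> cont_flow_form (pulled S X phi Q).
Proof. by move=> cQ c x r ac cx Gx r0; exact: pulled_cvg. Qed.

Lemma flow_filter_fst x r (W : M -> Prop) : within Gamma (nbhs x) W ->
  \forall p \near flow_filter Gamma x r, W p.1.
Proof.
move=> nW; exists (W, setT) => /=; last by move=> [y s] [].
by split => //; exact: filterT.
Qed.

Lemma cont_flow_form_cst Q : cont_form S Gamma Q -> cont_flow_form (fun=> Q).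
Proof.
move=> cQ c x r ac cx Gx r0 W nW; have h := cQ c x ac cx Gx W nW.
exact: (@flow_filter_fst x r (fun y => W (metric_in S Q c y)) h).
Qed.

Lemma flow_filter_dom c x r : atlas S c -> cdom c x ->
  \forall p \near flow_filter Gamma x r, cdom c p.1.
Proof.
move=> ac cx; apply: flow_filter_fst.
have h := chart_dom_near (atlas_chart ac) cx.
change (\forall y \near x, Gamma y -> cdom c y).
by apply: filterS h.
Qed.

Lemma flow_filter_slice (h : M * R -> R) x r (l : R) : 0 <= r ->
  h @ flow_filter Gamma x r --> l -> (fun y => h (y, r)) @ within Gamma (nbhs x) --> l.
Proof.
move=> r0 H W nW; have [[A B] [/= nA nB] AB] := H W nW.
change (within Gamma (nbhs x) (fun y => W (h (y, r)))).
apply: filterS nA => y Ay; apply: (AB (y, r)); split => //=.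
by have := nbhs_singleton nB; apply.
Qed.

(** Extending a function of nonnegative times by its value at 0 turns one-sided
    convergence into convergence on the line, where primitives are taken. *)
Lemma joint_cvg_max (h : M -> R -> R) (l : R -> R) x :
  (forall r, 0 <= r -> (fun p : M * R => h p.1 p.2) @ flow_filter Gamma x r --> l r) ->
  joint_cvg (within Gamma (nbhs x)) (fun y r => h y (Num.max 0 r)) (fun r => l (Num.max 0 r)).
Proof.
move=> H r0 W nW.
have m0 : 0 <= Num.max 0 r0 by rewrite le_max lexx.
have [[A B] [/= nA nB] AB] := H _ m0 W nW.
have cm : (fun r : R => Num.max 0 r) @ r0 --> Num.max 0 r0.
  by apply: continuous_max; [exact: cvg_cst|exact: cvg_id].
have nB' : \forall r \near r0, 0 <= Num.max 0 r -> B (Num.max 0 r) := cm _ nB.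
exists (A, [set r | B (Num.max 0 r)]) => /=.
  split => //; apply: filterS nB' => r; apply.
  by rewrite le_max lexx.
by move=> [y r] [/= Ay Br]; exact: (AB (y, Num.max 0 r)).
Qed.

Lemma joint_cvg_continuous (h : M -> R -> R) x : Gamma x ->
  joint_cvg (within Gamma (nbhs x)) h (h x) -> continuous (h x).
Proof.
move=> Gx H r W nW; have [[A B] [/= nA nB] AB] := H r W nW.
change (\forall s \near r, W (h x s)); apply: filterS nB => s Bs.
by apply: (AB (x, s)); split => //=; exact: (nbhs_singleton nA).
Qed.

Lemma flow_compact T : compact [set p : M * R | Gamma p.1 /\ 0 <= p.2 <= T].
Proof.
have -> : [set p : M * R | Gamma p.1 /\ 0 <= p.2 <= T] = Gamma `*` `[0, T]%classic.
  by apply/seteqP; split => -[y s] /=; rewrite in_itv/=.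
by apply: compact_setX => //; exact: segment_compact.
Qed.

(** The comparison holds locally by continuity; compactness of [Gamma] and of
    the time interval makes it uniform. *)
Lemma flow_compare (Qa Qb : R -> M -> 'M[R]_m) T : cont_flow_form Qa -> cont_flow_form Qb ->
  (forall x r, Gamma x -> 0 <= r -> inner_product (Qb r x)) ->
  exists2 C : R, 1 <= C & forall x r v, Gamma x -> 0 <= r <= T ->
    dotg (Qa r x) v v <= C * dotg (Qb r x) v v.
Proof.
move=> fa fb iQ.
have /near_covering_withinP/(_ R (pinfty_nbhs R)
  (fun C p => forall v, dotg (Qa p.2 p.1) v v <= C * dotg (Qb p.2 p.1) v v)) :=
  (compact_near_coveringP _).1 (flow_compact (T := T)).
move=> /(_ _) H.
have {}H : \forall C \near +oo, [set p : M * R | Gamma p.1 /\ 0 <= p.2 <= T] `<=`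
   (fun p => forall v, dotg (Qa p.2 p.1) v v <= C * dotg (Qb p.2 p.1) v v).
  apply: H => -[x r] /= [Gx /andP[r0 rT]].
  pose c := chart_at S x; have ac := chart_at_atlas S x; have cx := chart_at_domE S x.
  have ib : inner_product (metric_in S (Qb r) c x).
    by rewrite metric_inE; apply: inner_pull; [rewrite unitmx_inv tcoord_unit|exact: iQ].
  have [C0 hC0] := near_compare ib (fb c x r ac cx Gx r0) (fa c x r ac cx Gx r0).
  have h1 := flow_filter_within (filterI hC0 (flow_filter_dom r ac cx)).
  exists ([set p | Gamma p.1 -> 0 <= p.2 ->
     (forall v, dotg (metric_in S (Qa p.2) c p.1) v v <= C0 * dotg (metric_in S (Qb p.2) c p.1) v v) /\
      cdom c p.1], [set C | C0 <= C]) => /=.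
    by split; [exact: h1|exists C0; split; [exact: num_real|move=> C; exact: ltW]].
  move=> [[y s] C] [/= h C0C] [Gy /andP[s0 sT]] v.
  have [hv cy] := h Gy s0; have := hv (v *m tcoord S c y).
  rewrite !dotg_metric_in// => le1; apply: le_trans le1 _.
  by apply: ler_wpM2r => //; exact: (inner_psd (iQ _ _ Gy s0)).2.
have [C [C1 hC]] : exists C : R, 1 <= C /\ [set p : M * R | Gamma p.1 /\ 0 <= p.2 <= T] `<=`
   (fun p => forall v, dotg (Qa p.2 p.1) v v <= C * dotg (Qb p.2 p.1) v v).
  have n : \forall C \near +oo, 1 <= C /\ [set p : M * R | Gamma p.1 /\ 0 <= p.2 <= T] `<=`
   (fun p => forall v, dotg (Qa p.2 p.1) v v <= C * dotg (Qb p.2 p.1) v v).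
    by near=> C; split; near: C; [exact: nbhs_pinfty_ge|exact: H].
  by have [C] := filter_ex n; exists C.
exists C => // x r v Gx r0; exact: (hC (x, r)).
Unshelve. all: by end_near. Qed.

Lemma cont_fun_bounded (p : M -> R) : cont_fun Gamma p -> exists2 B : R, 0 <= B & forall x, Gamma x -> `|p x| <= B.
Proof.
move=> cp.
have H : \forall B \near +oo, Gamma `<=` (fun x => `|p x| <= B).
  have /near_covering_withinP/(_ R (pinfty_nbhs R) (fun B x => `|p x| <= B)) :=
    (compact_near_coveringP _).1 cptG.
  apply => x Gx.
  have n1 : \forall y \near x, Gamma y -> `|p y| < `|p x| + 1.
    have lt1 : `|p x| < `|p x| + 1 by rewrite ltrDl.
    have hn : (fun y => `|p y|) @ within Gamma (nbhs x) --> `|p x|.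
      exact: (cvg_norm (cp x Gx)).
    exact: (hn _ (lt_nbhsl lt1)).
  exists ([set y | Gamma y -> `|p y| < `|p x| + 1], [set B | `|p x| + 1 <= B]) => /=.
    by split => //; exists (`|p x| + 1); split; [exact: num_real|move=> C; exact: ltW].
  by move=> [y B] [/= h hB] Gy; exact: le_trans (ltW (h Gy)) hB.
have [B [B0 hB]] : exists B : R, 0 <= B /\ Gamma `<=` (fun x => `|p x| <= B).
  have n : \forall B \near +oo, 0 <= B /\ Gamma `<=` (fun x => `|p x| <= B).
    by near=> B; split; near: B; [exact: nbhs_pinfty_ge|exact: H].
  by have [B] := filter_ex n; exists B.
by exists B.
Unshelve. all: by end_near. Qed.

Lemma cont_fun_flow (p : M -> R) x r : cont_fun Gamma p -> Gamma x -> 0 <= r ->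
  (fun z : M * R => p (phi z.2 z.1)) @ flow_filter Gamma x r --> p (phi r x).
Proof.
move=> cp Gx r0 W nW; have h := cp _ (inv r0 Gx) W nW.
exact: (flow_filter_flow flow cptM inv r0 Gx h).
Qed.

Variable E : M -> {vspace V}.
Hypothesis subE : subbundle S Gamma 2 E.

(** A frame of the plane at each point, with no continuity in the point: the
    ratios below do not depend on the frame ([area_ratioE], [hs_ratioE]), and a
    continuous local frame can be substituted to study their continuity. *)
Definition frame_fst x := (vbasis (E x))`_0.
Definition frame_snd x := (vbasis (E x))`_1.

Lemma subbundle2_frame x : Gamma x -> exists (U : set M) (e f : M -> V),
  [/\ open U, U x, U `<=` cdom (chart_at S x),
    (fun y => e y *m tcoord S (chart_at S x) y) @ within Gamma (nbhs x) -->
       e x *m tcoord S (chart_at S x) x /\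
    (fun y => f y *m tcoord S (chart_at S x) y) @ within Gamma (nbhs x) -->
       f x *m tcoord S (chart_at S x) x &
    forall y, Gamma y -> U y -> frame2 (E y) (e y) (f y)].
Proof.
move=> Gx.
have [U [e [oU Ux Uc ce be]]] := subE Gx (chart_at_atlas S x) (chart_at_domE S x).
exists U, (e ord0), (e ord_max); split => //.
  have H i : (fun y => e i y *m tcoord S (chart_at S x) y) @ within Gamma (nbhs x) -->
       e i x *m tcoord S (chart_at S x) x.
    have h : (fun y => e i y *m tcoord S (chart_at S x) y) @ within (Gamma `&` U) (nbhs x) -->
       e i x *m tcoord S (chart_at S x) x.
      by have /subspace_continuousP := ce i; apply.
    move=> W nW; have h1 : \forall y \near x, (Gamma `&` U) y ->
      W (e i y *m tcoord S (chart_at S x) y) := h W nW.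
    have h2 : \forall y \near x, U y by exact: open_nbhs_nbhs.
    change (\forall y \near x, Gamma y -> W (e i y *m tcoord S (chart_at S x) y)).
    by apply: filterS (filterI h1 h2) => y [/= k1 k2] Gy; exact: k1.
  by split; exact: H.
move=> y Gy Uy; have := be y Gy Uy; rewrite /frame2.
suff -> : [seq e i y | i <- enum 'I_2] = [:: e ord0 y; e ord_max y] by [].
rewrite enum_ordSl enum_ordSl /= enum_ord0 /=; congr [:: _; e _ _]; exact: val_inj.
Qed.

Lemma frame_fst_snd x : Gamma x -> frame2 (E x) (frame_fst x) (frame_snd x).
Proof.
move=> Gx; have [U [e [f [_ Ux _ _ fr]]]] := subbundle2_frame Gx.
have d2 := frame2_dim (fr x Gx Ux).
have h := vbasisP (E x); have s2 : size (tval (vbasis (E x))) = 2%N by rewrite size_tuple.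
rewrite /frame2 /frame_fst /frame_snd; move: h s2; case: (tval _) => [|v [|w [|]]]//.
Qed.

Definition area_ratio (Q G : 'M[R]_m) x := gram2 Q (frame_fst x) (frame_snd x) / gram2 G (frame_fst x) (frame_snd x).
Definition hs_ratio (Q G : 'M[R]_m) x := mix2 Q G (frame_fst x) (frame_snd x) / gram2 G (frame_fst x) (frame_snd x).

Lemma area_ratioE (Q G : 'M[R]_m) x v w : Gamma x -> Q^T = Q -> pos_def_on G (E x) -> frame2 (E x) v w ->
  area_ratio Q G x = gram2 Q v w / gram2 G v w.
Proof.
move=> Gx sQ pG fr; have [k k0 [hk _]] := frame2_change (frame_fst_snd Gx) fr.
have g0 := gram2_gt0 pG (frame_fst_snd Gx).
by rewrite !hk ?pG.1// /area_ratio -mulf_div divff// mul1r.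
Qed.

Lemma hs_ratioE (Q G : 'M[R]_m) x v w : Gamma x -> Q^T = Q -> pos_def_on G (E x) -> frame2 (E x) v w ->
  hs_ratio Q G x = mix2 Q G v w / gram2 G v w.
Proof.
move=> Gx sQ pG fr; have [k k0 [hk hm]] := frame2_change (frame_fst_snd Gx) fr.
by rewrite hk ?pG.1// hm ?pG.1// /hs_ratio -mulf_div divff// mul1r.
Qed.

Lemma ratio_cvg (Qa Qb : R -> M -> 'M[R]_m) x r : cont_flow_form Qa -> cont_flow_form Qb ->
  (forall y s, Gamma y -> 0 <= s -> (Qa s y)^T = Qa s y /\ pos_def_on (Qb s y) (E y)) ->
  Gamma x -> 0 <= r ->
  (fun p : M * R => area_ratio (Qa p.2 p.1) (Qb p.2 p.1) p.1) @ flow_filter Gamma x r -->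
     area_ratio (Qa r x) (Qb r x) x /\
  (fun p : M * R => hs_ratio (Qa p.2 p.1) (Qb p.2 p.1) p.1) @ flow_filter Gamma x r -->
     hs_ratio (Qa r x) (Qb r x) x.
Proof.
move=> fa fb pos Gx r0.
have [U [e [f [oU Ux Uc [ce cf] fr]]]] := subbundle2_frame Gx.
pose c := chart_at S x; have ac := chart_at_atlas S x; have cx := chart_at_domE S x.
have ha := fa c x r ac cx Gx r0; have hb := fb c x r ac cx Gx r0.
have he : (fun p : M * R => e p.1 *m tcoord S c p.1) @ flow_filter Gamma x r --> e x *m tcoord S c x.
  by move=> W /ce nW; exact: (flow_filter_fst r nW).
have hf : (fun p : M * R => f p.1 *m tcoord S c p.1) @ flow_filter Gamma x r --> f x *m tcoord S c x.
  by move=> W /cf nW; exact: (flow_filter_fst r nW).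
have gE (Q : M -> 'M[R]_m) y : cdom c y ->
    gram2 (metric_in S Q c y) (e y *m tcoord S c y) (f y *m tcoord S c y) = gram2 (Q y) (e y) (f y).
  by move=> cy; rewrite /gram2 !dotg_metric_in.
have mE (Q G : M -> 'M[R]_m) y : cdom c y ->
    mix2 (metric_in S Q c y) (metric_in S G c y) (e y *m tcoord S c y) (f y *m tcoord S c y) =
    mix2 (Q y) (G y) (e y) (f y).
  by move=> cy; rewrite /mix2 !dotg_metric_in.
have nU : \forall p \near flow_filter Gamma x r, U p.1.
  apply: flow_filter_fst; change (\forall y \near x, Gamma y -> U y).
  by have h : \forall y \near x, U y; [exact: open_nbhs_nbhs|apply: filterS h].
have nz : gram2 (metric_in S (Qb r) c x) (e x *m tcoord S c x) (f x *m tcoord S c x) != 0.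
  rewrite gE// gt_eqF//; apply: gram2_gt0 (fr x Gx Ux).
  by have [] := pos x r Gx r0.
have near : \forall p \near flow_filter Gamma x r, [/\ Gamma p.1, 0 <= p.2, cdom c p.1 & U p.1].
  apply: filterS (filterI (flow_filter_in Gamma x r) nU) => -[y s] [/= [Gy s0] Uy].
  by split => //; exact: Uc.
pose te y := e y *m tcoord S c y; pose tf y := f y *m tcoord S c y.
pose qa (p : M * R) := metric_in S (Qa p.2) c p.1; pose qb (p : M * R) := metric_in S (Qb p.2) c p.1.
have l1 : gram2 (qa p) (te p.1) (tf p.1) @[p --> flow_filter Gamma x r] -->
  gram2 (metric_in S (Qa r) c x) (te x) (tf x) by exact: cvg_gram2.
have l2 : gram2 (qb p) (te p.1) (tf p.1) @[p --> flow_filter Gamma x r] -->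
  gram2 (metric_in S (Qb r) c x) (te x) (tf x) by exact: cvg_gram2.
have l3 : mix2 (qa p) (qb p) (te p.1) (tf p.1) @[p --> flow_filter Gamma x r] -->
  mix2 (metric_in S (Qa r) c x) (metric_in S (Qb r) c x) (te x) (tf x) by exact: cvg_mix2.
have l4 : (gram2 (qb p) (te p.1) (tf p.1))^-1 @[p --> flow_filter Gamma x r] -->
  (gram2 (metric_in S (Qb r) c x) (te x) (tf x))^-1 by exact: cvgV.
split.
- have -> : area_ratio (Qa r x) (Qb r x) x =
     gram2 (metric_in S (Qa r) c x) (e x *m tcoord S c x) (f x *m tcoord S c x) /
     gram2 (metric_in S (Qb r) c x) (e x *m tcoord S c x) (f x *m tcoord S c x).
    have [sa pb] := pos x r Gx r0.
    by rewrite !gE// (area_ratioE Gx sa pb (fr x Gx Ux)).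
  have lim : gram2 (qa p) (te p.1) (tf p.1) / gram2 (qb p) (te p.1) (tf p.1) @[p --> flow_filter Gamma x r] -->
    gram2 (metric_in S (Qa r) c x) (te x) (tf x) / gram2 (metric_in S (Qb r) c x) (te x) (tf x).
    exact: (cvgM l1 l4).
  apply: cvg_trans lim; apply: near_eq_cvg.
  apply: filterS near => -[y s] [/= Gy s0 cy Uy].
  have [sa pb] := pos y s Gy s0.
  by rewrite /qa /qb /te /tf /= !gE// (area_ratioE Gy sa pb (fr y Gy Uy)).
- have -> : hs_ratio (Qa r x) (Qb r x) x =
     mix2 (metric_in S (Qa r) c x) (metric_in S (Qb r) c x) (e x *m tcoord S c x) (f x *m tcoord S c x) /
     gram2 (metric_in S (Qb r) c x) (e x *m tcoord S c x) (f x *m tcoord S c x).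
    have [sa pb] := pos x r Gx r0.
    by rewrite gE// mE// (hs_ratioE Gx sa pb (fr x Gx Ux)).
  have lim : mix2 (qa p) (qb p) (te p.1) (tf p.1) / gram2 (qb p) (te p.1) (tf p.1) @[p --> flow_filter Gamma x r] -->
    mix2 (metric_in S (Qa r) c x) (metric_in S (Qb r) c x) (te x) (tf x) / gram2 (metric_in S (Qb r) c x) (te x) (tf x).
    exact: (cvgM l3 l4).
  apply: cvg_trans lim; apply: near_eq_cvg.
  apply: filterS near => -[y s] [/= Gy s0 cy Uy].
  have [sa pb] := pos y s Gy s0.
  by rewrite /qa /qb /te /tf /= gE// mE// (hs_ratioE Gy sa pb (fr y Gy Uy)).
Qed.

End FlowForms.

(** * Projections of a continuous splitting *)

Section Projections.
Context {R : realType} {m : nat} {M : topologicalType}.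
Variable S : smooth_manifold R m M.
Variable Gamma : set M.
Local Notation V := 'rV[R]_m.
Implicit Types (x y : M) (E F : M -> {vspace V}).

Lemma map_enum_ord_cat k l (T : Type) (h : 'I_(k + l) -> T) :
  [seq h i | i <- enum 'I_(k + l)] =
  [seq h (lshift l i) | i <- enum 'I_k] ++ [seq h (rshift k i) | i <- enum 'I_l].
Proof.
have E1 : map val (map (@lshift k l) (enum 'I_k)) = iota 0 k.
  by rewrite -map_comp -[RHS]val_enum_ord; exact: eq_map.
have E2 : map val (map (@rshift k l) (enum 'I_l)) = iota k l.
  by rewrite -map_comp -[in RHS](addn0 k) iotaDl -val_enum_ord -map_comp; exact: eq_map.
have E : enum 'I_(k + l) = map (@lshift k l) (enum 'I_k) ++ map (@rshift k l) (enum 'I_l).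
  by apply: (inj_map val_inj); rewrite map_cat E1 E2 -iotaD; exact: val_enum_ord.
by rewrite E map_cat -!map_comp.
Qed.

Lemma frame_rows k (U : {vspace V}) (e : 'I_k -> V) v :
  basis_of U [seq e i | i <- enum 'I_k] -> v \in U ->
  exists u : 'rV_k, v = u *m (\matrix_i e i).
Proof.
move=> be vU; pose Xt := [tuple e i | i < k].
have vX : v \in <<Xt>>%VS.
  by move: vU; have /andP[/eqP EU _] := be; rewrite -{1}EU.
exists (\row_i coord Xt i v); rewrite {1}(coord_span vX) mulmx_sum_row.
by apply: eq_bigr => i _; rewrite mxE rowK (nth_mktuple e).
Qed.

(** The solution of a linear system with invertible limit matrix depends
    continuously on the data, by Cramer's rule. *)
Lemma cvg_solve (T : Type) (Fi : set_system T) (FF : Filter Fi) n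
    (A C : T -> 'M[R]_(n, m)) (Y : T -> 'M[R]_m) (A0 C0 : 'M[R]_(n, m)) (Y0 : 'M[R]_m) :
  n = m -> (forall w : V, exists u, w = u *m A0) ->
  A @ Fi --> A0 -> C @ Fi --> C0 -> A0 *m Y0 = C0 ->
  (\forall z \near Fi, A z *m Y z = C z) -> Y @ Fi --> Y0.
Proof.
move=> enm; case: m / enm A C Y A0 C0 Y0 => A C Y A0 C0 Y0 full hA hC e0 eY.
have uA : A0 \in unitmx.
  rewrite -row_full_unit -sub1mx; apply/row_subP => i.
  by have [u ->] := full (row i 1%:M); exact: submxMl.
have -> : Y0 = invmx A0 *m C0 by rewrite -e0 mulKmx.
have lim : (fun z => invmx (A z) *m C z) @ Fi --> invmx A0 *m C0.
  by apply: cvg_mulmx => //; exact: cvg_invmx.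
apply: cvg_trans lim; apply: near_eq_cvg.
have nu : \forall z \near Fi, \det (A z) != 0.
  have d0 : \det A0 != 0 by rewrite -unitfE -unitmxE.
  have dA : \det (A z) @[z --> Fi] --> \det A0 by exact: cvg_det.
  exact: (@cvgr_neq0 _ _ _ Fi FF _ _ dA d0).
apply: filterS (filterI nu eY) => z [/= nz <-].
by rewrite mulKmx// unitmxE unitfE.
Qed.

Lemma subbundle_frame_cvg k E x c : subbundle S Gamma k E -> Gamma x -> atlas S c ->
  cdom c x -> exists e : 'I_k -> M -> V,
  [/\ forall i, (fun y => e i y *m tcoord S c y) @ within Gamma (nbhs x) --> e i x *m tcoord S c x,
      \forall y \near within Gamma (nbhs x), basis_of (E y) [seq e i y | i <- enum 'I_k] &
      basis_of (E x) [seq e i x | i <- enum 'I_k]].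
Proof.
move=> sE Gx ac cx; have [U [e [oU Ux Uc ce be]]] := sE x c Gx ac cx.
have h2 : \forall y \near x, U y by exact: open_nbhs_nbhs.
exists e; split; last exact: be.
- move=> i.
  have h : (fun y => e i y *m tcoord S c y) @ within (Gamma `&` U) (nbhs x) -->
       e i x *m tcoord S c x.
    by have /subspace_continuousP := ce i; apply.
  move=> W nW; have h1 : \forall y \near x, (Gamma `&` U) y ->
      W (e i y *m tcoord S c y) := h W nW.
  change (\forall y \near x, Gamma y -> W (e i y *m tcoord S c y)).
  by apply: filterS (filterI h1 h2) => y [/= k1 k2] Gy; exact: k1.
- change (\forall y \near x, Gamma y -> basis_of (E y) [seq e i y | i <- enum 'I_k]).
  by apply: filterS h2 => y Uy Gy; exact: be.
Qed.

Definition proj E F x : 'M[R]_m := lin1_mx (daddv_pi (E x) (F x)).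

Definition complementary E F := forall x, Gamma x ->
  (E x :&: F x)%VS = 0%VS /\ (E x + F x)%VS = fullv.

Section Pair.
Variables E F : M -> {vspace V}.
Hypothesis EF : complementary E F.

Lemma projE x v : v *m proj E F x = daddv_pi (E x) (F x) v.
Proof. exact: mul_rV_lin1. Qed.

Lemma proj_in x v : v *m proj E F x \in E x.
Proof. by rewrite projE memv_pi. Qed.

Lemma proj_id x v : Gamma x -> v \in E x -> v *m proj E F x = v.
Proof. by move=> /EF[h _] vE; rewrite projE daddv_pi_id. Qed.

Lemma proj_ker x v : Gamma x -> v \in F x -> v *m proj E F x = 0.
Proof.
move=> /EF[h hf] vF; rewrite projE; apply: (@addIr _ v).
have h' : (F x :&: E x)%VS = 0%VS by rewrite capvC.
have := daddv_pi_add h (_ : v \in (E x + F x)%VS).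
by rewrite hf memvf => /(_ isT); rewrite (daddv_pi_id h' vF) add0r.
Qed.

Variables k l : nat.
Hypothesis sE : subbundle S Gamma k E.
Hypothesis sF : subbundle S Gamma l F.

(** In continuous frames of the two bundles the projection is the solution of a
    linear system with continuous coefficients. *)
Lemma proj_cvg c x : atlas S c -> cdom c x -> Gamma x ->
  (fun y => invmx (tcoord S c y) *m proj E F y *m tcoord S c y) @ within Gamma (nbhs x) -->
  invmx (tcoord S c x) *m proj E F x *m tcoord S c x.
Proof.
move=> ac cx Gx.
have [e [ce ne be]] := subbundle_frame_cvg sE Gx ac cx.
have [f [cf nf bf]] := subbundle_frame_cvg sF Gx ac cx.
have [h0 hf] := EF Gx.
have ek : \dim (E x) = k by rewrite (size_basis be) card_ord.
have fl : \dim (F x) = l by rewrite (size_basis bf) card_ord.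
have ekl : (k + l)%N = m.
  rewrite -ek -fl -(dimv_disjoint_sum h0) hf dimvf /dim /= mul1n//.
pose A y : 'M[R]_(k + l, m) :=
  col_mx (\matrix_i (e i y *m tcoord S c y)) (\matrix_i (f i y *m tcoord S c y)).
pose C y : 'M[R]_(k + l, m) := col_mx (\matrix_i (e i y *m tcoord S c y)) (0 : 'M[R]_(l, m)).
have eqn y : cdom c y -> Gamma y -> basis_of (E y) [seq e i y | i <- enum 'I_k] ->
   basis_of (F y) [seq f i y | i <- enum 'I_l] ->
   A y *m (invmx (tcoord S c y) *m proj E F y *m tcoord S c y) = C y.
  move=> cy Gy bey bfy; rewrite /A /C mul_col_mx; have u := tcoord_unit ac cy.
  congr col_mx; apply/row_matrixP => i; rewrite row_mul !rowK ?row0 !mulmxA (mulmxK u).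
    rewrite proj_id//; apply: (basis_mem bey); apply/mapP; exists i => //.
    by rewrite mem_enum.
  rewrite proj_ker ?mul0mx//; apply: (basis_mem bfy); apply/mapP; exists i => //.
  by rewrite mem_enum.
have nc : \forall y \near within Gamma (nbhs x), Gamma y /\ cdom c y.
  change (\forall y \near x, Gamma y -> Gamma y /\ cdom c y).
  by have h := chart_dom_near (atlas_chart ac) cx; apply: filterS h.
apply: (@cvg_solve _ _ _ (k + l)%N A C _ (A x) (C x)) => //.
- move=> w; pose v := w *m invmx (tcoord S c x).
  have : v \in (E x + F x)%VS by rewrite hf memvf.
  move=> /memv_addP[a aE [b bF vab]].
  have [u1 e1] := frame_rows be aE; have [u2 e2] := frame_rows bf bF.
  exists (row_mx u1 u2); rewrite /A mul_row_col.
  have -> : w = v *m tcoord S c x by rewrite /v mulmxKV// tcoord_unit.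
  have rm n (h : 'I_n -> V) : (\matrix_i h i) *m tcoord S c x = \matrix_i (h i *m tcoord S c x).
    by apply/row_matrixP => i; rewrite row_mul !rowK.
  by rewrite vab mulmxDl e1 e2 -!mulmxA !rm.
- apply: cvg_mx => i j; rewrite /A; case: (split_ordP i) => a ->.
    under eq_fun do rewrite col_mxEu mxE; rewrite col_mxEu mxE.
    exact: (cvg_mx_entry (ce a)).
  under eq_fun do rewrite col_mxEd mxE; rewrite col_mxEd mxE.
  exact: (cvg_mx_entry (cf a)).
- apply: cvg_mx => i j; rewrite /C; case: (split_ordP i) => a ->.
    under eq_fun do rewrite col_mxEu mxE; rewrite col_mxEu mxE.
    exact: (cvg_mx_entry (ce a)).
  under eq_fun do rewrite col_mxEd mxE; rewrite col_mxEd mxE.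
  exact: cvg_cst.
- exact: eqn.
- apply: filterS (filterI nc (filterI ne nf)) => y [/= [Gy cy] [bey bfy]].
  exact: eqn.
Qed.

Lemma cont_form_proj Q : cont_form S Gamma Q -> cont_form S Gamma (fun x => pull_form (proj E F x) (Q x)).
Proof.
move=> cQ c x ac cx Gx.
have E1 y : cdom c y -> metric_in S (fun x => pull_form (proj E F x) (Q x)) c y =
  pull_form (invmx (tcoord S c y) *m proj E F y *m tcoord S c y) (metric_in S Q c y).
  move=> cy; rewrite !metric_inE -!pull_formM; congr pull_form.
  by rewrite mulmxK// tcoord_unit.
rewrite E1//.
have lim := cvg_pull_form (proj_cvg ac cx Gx) (cQ c x ac cx Gx).
apply: cvg_trans (lim _); apply: near_eq_cvg.
change (\forall y \near x, Gamma y ->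
  pull_form (invmx (tcoord S c y) *m proj E F y *m tcoord S c y) (metric_in S Q c y) =
  metric_in S (fun x => pull_form (proj E F x) (Q x)) c y).
have h := chart_dom_near (atlas_chart ac) cx.
by apply: filterS h => y cy _; rewrite E1.
Qed.

End Pair.

Lemma subbundle_add E F k l : (forall x, Gamma x -> (E x :&: F x)%VS = 0%VS) ->
  subbundle S Gamma k E -> subbundle S Gamma l F ->
  subbundle S Gamma (k + l) (fun x => (E x + F x)%VS).
Proof.
move=> d sE sF x c Gx ac cx.
have [U [e [oU Ux Uc ce be]]] := sE x c Gx ac cx.
have [W [f [oW Wx Wc cf bf]]] := sF x c Gx ac cx.
pose h (i : 'I_(k + l)) := match fintype.split i with inl a => e a | inr b => f b end.
have hl i : h (lshift l i) = e i by rewrite /h (unsplitK (inl i) : fintype.split (lshift l i) = _).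
have hr i : h (rshift k i) = f i by rewrite /h (unsplitK (inr i) : fintype.split (rshift k i) = _).
exists (U `&` W), h; split.
- exact: openI.
- by [].
- by move=> y [/Uc].
- have sub1 : Gamma `&` (U `&` W) `<=` Gamma `&` U by move=> y [? []].
  have sub2 : Gamma `&` (U `&` W) `<=` Gamma `&` W by move=> y [? []].
  move=> i; case: (split_ordP i) => a ->; rewrite ?hl ?hr.
    exact: (continuous_subspaceW sub1 (ce a)).
  exact: (continuous_subspaceW sub2 (cf a)).
- move=> y Gy [Uy Wy].
  rewrite map_enum_ord_cat.
  have -> : [seq h (lshift l i) y | i <- enum 'I_k] = [seq e i y | i <- enum 'I_k].
    by apply: eq_map => i; rewrite hl.
  have -> : [seq h (rshift k i) y | i <- enum 'I_l] = [seq f i y | i <- enum 'I_l].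
    by apply: eq_map => i; rewrite hr.
  apply: cat_basis; [|exact: be|exact: bf].
  by apply/directv_addP; exact: d.
Qed.

End Projections.

(** * Averaged forms on an invariant bundle *)

Section AdaptedForm.
Context {R : realType} {m : nat} {M : topologicalType}.
Variable S : smooth_manifold R m M.
Variables (X : M -> 'rV[R]_m) (phi : R -> M -> M) (Gamma : set M).
Hypothesis flow : is_flow S X phi.
Hypothesis cptM : compact [set: M].
Hypothesis cptG : compact Gamma.
Hypothesis inv : forall t x, 0 <= t -> Gamma x -> Gamma (phi t x).
Variable g0 : M -> 'M[R]_m.
Hypothesis ig : forall x, inner_product (g0 x).
Hypothesis cg : cont_form S Gamma g0.
Local Notation V := 'rV[R]_m.
Local Notation DX := (flow_diff S X phi).
Local Notation Q := (pulled S X phi g0).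
Implicit Types (x y : M) (r s t : R) (u v w : V).

Lemma pulled_inner x r : 0 <= r -> inner_product (Q r x).
Proof. by move=> r0; apply: inner_pull => //; exact: flow_diff_unit. Qed.

Lemma dotg_pulled r x u w : dotg (Q r x) u w = dotg (g0 (phi r x)) (u *m DX r x) (w *m DX r x).
Proof. exact: dotg_pull. Qed.

Lemma pulledD r s x u w : 0 <= r -> 0 <= s ->
  dotg (Q (r + s) x) u w = dotg (Q s (phi r x)) (u *m DX r x) (w *m DX r x).
Proof.
move=> r0 s0.
have eA : DX (r + s) x = DX r x *m DX s (phi r x) by exact: (flow_diffD flow cptM x r0 s0).
have ey : phi (r + s) x = phi s (phi r x) by exact: (flow_semigroup flow x r0 s0).
have pull A B C y z : A = C *m B -> y = z ->
    dotg (pull_form A (g0 y)) u w = dotg (pull_form B (g0 z)) (u *m C) (w *m C).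
  by move=> -> ->; rewrite !dotg_pull !mulmxA.
exact: pull eA ey.
Qed.

(** The function [p] along the forward orbit of [x], extended by its value at
    [x] to negative times so that it is continuous on the line. *)
Definition along (p : M -> R) x r := p (phi (Num.max 0 r) x).
Definition orbit_form x u w r := dotg (Q (Num.max 0 r) x) u w.

Lemma joint_cvg_along p x : cont_fun Gamma p -> Gamma x ->
  joint_cvg (within Gamma (nbhs x)) (along p) (along p x).
Proof.
move=> cp Gx; apply: (joint_cvg_max (h := fun y r => p (phi r y)) (l := fun r => p (phi r x))).
by move=> r r0; exact: (cont_fun_flow flow cptM inv cp Gx r0).
Qed.

Lemma along_continuous p x : cont_fun Gamma p -> Gamma x -> continuous (along p x).
Proof. by move=> cp Gx; apply: (joint_cvg_continuous Gx); exact: joint_cvg_along. Qed.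

Lemma joint_cvg_form c x (u w : V) : atlas S c -> cdom c x -> Gamma x ->
  joint_cvg (within Gamma (nbhs x)) (fun y r => dotg (metric_in S (Q (Num.max 0 r)) c y) u w)
    (fun r => dotg (metric_in S (Q (Num.max 0 r)) c x) u w).
Proof.
move=> ac cx Gx.
apply: (joint_cvg_max (h := fun y r => dotg (metric_in S (Q r) c y) u w)
  (l := fun r => dotg (metric_in S (Q r) c x) u w)) => r r0.
have h := cont_flow_form_pulled flow cptM inv cg ac cx Gx r0.
exact: (cvg_dotg h (cvg_cst u) (cvg_cst w)).
Qed.

Lemma orbit_form_continuous x u w : Gamma x -> continuous (orbit_form x u w).
Proof.
move=> Gx; pose c := chart_at S x.
have ac := chart_at_atlas S x; have cx := chart_at_domE S x.
have h := joint_cvg_continuous Gx (joint_cvg_form (u := u *m tcoord S c x) (w := w *m tcoord S c x) ac cx Gx).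
by have -> : orbit_form x u w = (fun r => dotg (metric_in S (Q (Num.max 0 r)) c x)
  (u *m tcoord S c x) (w *m tcoord S c x)) by apply/funext => r; rewrite dotg_metric_in.
Qed.

Section Weights.
Variables (p q : M -> R) (d tau : R).
Hypothesis (cp : cont_fun Gamma p) (cq : cont_fun Gamma q).
Hypothesis tau0 : 0 < tau.

(** The averages of all entries, that is, of the bilinear form itself; the
    averaging is linear in the form. *)
Definition adapted x : 'M[R]_m := \matrix_(i, j)
  avg (orbit_form x (delta_mx 0 i) (delta_mx 0 j)) (along p x) (along q x) d tau 0.

Lemma dotg_adapted x u w : Gamma x ->
  dotg (adapted x) u w = avg (orbit_form x u w) (along p x) (along q x) d tau 0.
Proof.
move=> Gx.
have cpx := along_continuous cp Gx; have cqx := along_continuous cq Gx.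
have co i j := orbit_form_continuous (u := delta_mx 0 i) (w := delta_mx 0 j) Gx.
have E : orbit_form x u w = (fun r => \sum_j \sum_i (u 0 i * w 0 j) * orbit_form x (delta_mx 0 i) (delta_mx 0 j) r).
  apply/funext => r; rewrite {1}/orbit_form /dotg mxE; apply: eq_bigr => j _.
  rewrite !mxE mulr_suml; apply: eq_bigr => i _.
  by rewrite /orbit_form -dotg_entry; ring.
have cs j : continuous (fun r => \sum_i (u 0 i * w 0 j) * orbit_form x (delta_mx 0 i) (delta_mx 0 j) r).
  by apply: continuous_sum => i; exact: continuous_scal.
rewrite E (avg_sum _ _ _ (ltW tau0))//.
rewrite /dotg mxE; apply: eq_bigr => j _.
rewrite (avg_sum _ _ _ (ltW tau0))//; last by move=> i; exact: continuous_scal.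
rewrite !mxE mulr_suml; apply: eq_bigr => i _.
by rewrite avgZ// ?ltW// mxE; ring.
Qed.

Lemma adapted_inner x : Gamma x -> inner_product (adapted x).
Proof.
move=> Gx; have max0 r : 0 <= Num.max 0 r by rewrite le_max lexx.
split.
  apply/matrixP => i j; rewrite !mxE; congr avg; apply/funext => r.
  by apply: dotgC; have [] := pulled_inner x (max0 r).
move=> v v0; rewrite dotg_adapted//; apply: avg_gt0 => //; try exact: along_continuous.
  exact: orbit_form_continuous.
by move=> r; have [_] := pulled_inner x (max0 r); apply.
Qed.

Lemma adapted_cont_form : cont_form S Gamma adapted.
Proof.
move=> c x ac cx Gx.
have E y i j : Gamma y -> cdom c y -> metric_in S adapted c y i j =
  avg (fun r => dotg (metric_in S (Q (Num.max 0 r)) c y) (delta_mx 0 i) (delta_mx 0 j))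
      (along p y) (along q y) d tau 0.
  move=> Gy cy; rewrite dotg_entry metric_inE dotg_pull dotg_adapted//.
  by congr avg; apply/funext => r; rewrite metric_inE dotg_pull.
apply: cvg_mx => i j; rewrite E//.
have near : \forall y \near within Gamma (nbhs x), Gamma y /\ cdom c y.
  change (\forall y \near x, Gamma y -> Gamma y /\ cdom c y).
  by have h := chart_dom_near (atlas_chart ac) cx; apply: filterS h.
have jf := joint_cvg_form (u := delta_mx 0 i) (w := delta_mx 0 j) ac cx Gx.
have cf y : Gamma y -> cdom c y -> continuous (fun r => dotg (metric_in S (Q (Num.max 0 r)) c y)
   (delta_mx 0 i) (delta_mx 0 j)).
  move=> Gy cy; exact: (joint_cvg_continuous Gy (joint_cvg_form (u := delta_mx 0 i) (w := delta_mx 0 j) ac cy Gy)).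
have n1 : \forall y \near within Gamma (nbhs x), continuous (fun r =>
    dotg (metric_in S (Q (Num.max 0 r)) c y) (delta_mx 0 i) (delta_mx 0 j)).
  by apply: filterS near => y [Gy cy]; exact: cf.
have n2 : \forall y \near within Gamma (nbhs x), continuous (along p y).
  by apply: filterS near => y [Gy cy]; exact: along_continuous.
have n3 : \forall y \near within Gamma (nbhs x), continuous (along q y).
  by apply: filterS near => y [Gy cy]; exact: along_continuous.
have lim : avg (fun r => dotg (metric_in S (Q (Num.max 0 r)) c y) (delta_mx 0 i) (delta_mx 0 j))
      (along p y) (along q y) d tau 0 @[y --> within Gamma (nbhs x)] -->
   avg (fun r => dotg (metric_in S (Q (Num.max 0 r)) c x) (delta_mx 0 i) (delta_mx 0 j))
      (along p x) (along q x) d tau 0.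
  apply: (joint_cvg_avg (f := fun y r => dotg (metric_in S (Q (Num.max 0 r)) c y) (delta_mx 0 i) (delta_mx 0 j))
    (p := along p) (q := along q)) => //.
  - exact: cf.
  - exact: along_continuous.
  - exact: along_continuous.
  - exact: joint_cvg_along.
  - exact: joint_cvg_along.
apply: cvg_trans lim; apply: near_eq_cvg.
by apply: filterS near => y [Gy cy]; rewrite E.
Qed.

(** By the cocycle property, the average at a later point of the orbit is the
    average over a later window. *)
Lemma adapted_shift x v t : Gamma x -> 0 <= t ->
  dotg (adapted (phi t x)) (v *m DX t x) (v *m DX t x) =
  avg (orbit_form x v v) (along p x) (along q x) d tau t.
Proof.
move=> Gx t0; have Gt := inv t0 Gx.
rewrite dotg_adapted//; apply: avg_shift; try exact: along_continuous; try exact: orbit_form_continuous.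
- exact: ltW.
- by move=> s s0; rewrite /orbit_form !max_r ?addr_ge0// pulledD.
- by move=> s s0; rewrite /along !max_r ?addr_ge0// (flow_semigroup flow).
- by move=> s s0; rewrite /along !max_r ?addr_ge0// (flow_semigroup flow).
Qed.

End Weights.

Variable E : M -> {vspace V}.
Hypothesis invE : forall t x v, 0 <= t -> Gamma x -> v \in E x -> v *m DX t x \in E (phi t x).

(** Along the orbit of each vector the average is that of [avg_growth];
    compactness of [Gamma] makes the constants of that lemma, and hence [tau0],
    uniform. *)
Lemma adapted_growth (p q : M -> R) (T d : R) : cont_fun Gamma p -> cont_fun Gamma q ->
  1 <= T -> 0 < d ->
  (forall x, Gamma x -> q x <= p x) ->
  (forall x v, Gamma x -> v \in E x ->
     expR (2 * T * q x) * dotg (g0 x) v v <= dotg (Q T x) v v <=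
     expR (2 * T * p x) * dotg (g0 x) v v) ->
  exists tau0 : R, forall tau, tau0 <= tau -> 1 <= tau ->
    forall x v t, Gamma x -> v \in E x -> 0 <= t ->
    expR (2 * Int (along q x) tau (t + tau) - 4 * d * t) * dotg (adapted p q d tau x) v v
      <= dotg (adapted p q d tau (phi t x)) (v *m DX t x) (v *m DX t x) /\
    dotg (adapted p q d tau (phi t x)) (v *m DX t x) (v *m DX t x) <=
    expR (2 * Int (along p x) tau (t + tau) + 4 * d * t) * dotg (adapted p q d tau x) v v.
Proof.
move=> cp cq T1 d0 qp gr.
have T0 : 0 <= T by exact: le_trans T1.
have fQ : cont_flow_form S Gamma Q by exact: cont_flow_form_pulled.
have fg : cont_flow_form S Gamma (fun=> g0) by exact: cont_flow_form_cst.
have [C1 C11 hC1] := flow_compare cptG T fQ fg (fun x r _ _ => ig x).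
have iQ x r : Gamma x -> 0 <= r -> inner_product (Q r x) by move=> _; exact: pulled_inner.
have [C2 C21 hC2] := flow_compare cptG T fg fQ iQ.
have [B B0 hB] := cont_fun_bounded cptG cp.
pose C := Num.max C1 C2.
have C1' : 1 <= C by rewrite le_max C11.
pose K := C ^+ 3 * expR (2 * (B + d)).
exists (K / (2 * d) / (2 * d)) => tau htau tau1 x v t Gx vE t0.
have tau0 : 0 < tau by exact: lt_le_trans tau1.
have [->|v0] := eqVneq v 0.
  by rewrite !mul0mx !dotg0l !mulr0.
have max0 r : 0 <= Num.max 0 r by rewrite le_max lexx.
have f0 r : 0 < orbit_form x v v r by exact: (pulled_inner _ (max0 r)).2.
have area_rate : 0 < 2 * d by rewrite mulr_gt0.
have tauP : C ^+ 3 * expR (2 * (B + d)) * expR (- (2 * d * tau)) <= 2 * d.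
  rewrite -/K expRN ler_pdivrMr ?expR_gt0//.
  have h := expR_ge1Dx (2 * d * tau).
  have h1 : K / (2 * d) <= tau * (2 * d) by rewrite -ler_pdivrMr.
  have h2 : tau * (2 * d) <= expR (2 * d * tau) by lra.
  by have := le_trans h1 h2; rewrite ler_pdivrMr// mulrC.
have bnd y w : Gamma y -> 0 <= dotg (g0 y) w w by move=> _; exact: (inner_psd (ig y)).2.
have e1 r : 0 <= r -> orbit_form x v v r = dotg (g0 (phi r x)) (v *m DX r x) (v *m DX r x).
  by move=> r0; rewrite /orbit_form max_r//; exact: dotg_pulled.
have e2 r s : 0 <= r -> 0 <= s ->
    orbit_form x v v (r + s) = dotg (Q s (phi r x)) (v *m DX r x) (v *m DX r x).
  by move=> r0 s0; rewrite /orbit_form max_r ?addr_ge0//; exact: pulledD.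
have fC r s : 0 <= r -> 0 <= s <= T ->
   orbit_form x v v r <= C * orbit_form x v v (r + s) /\ orbit_form x v v (r + s) <= C * orbit_form x v v r.
  move=> r0 /andP[s0 sT].
  have Gr := inv r0 Gx.
  have s0T : 0 <= s <= T by rewrite s0.
  have h1 := hC1 _ _ (v *m DX r x) Gr s0T; have h2 := hC2 _ _ (v *m DX r x) Gr s0T.
  rewrite e1// e2//; split.
    apply: le_trans h2 _; apply: ler_wpM2r; last by rewrite le_max lexx orbT.
    by have [_] := inner_psd (pulled_inner (phi r x) s0); apply.
  by apply: le_trans h1 _; apply: ler_wpM2r; [exact: bnd|rewrite le_max lexx].
have fT r : 0 <= r -> expR (2 * T * along q x r) * orbit_form x v v r <= orbit_form x v v (r + T) <=
    expR (2 * T * along p x r) * orbit_form x v v r.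
  move=> r0.
  have h := gr (phi r x) (v *m DX r x) (inv r0 Gx) (invE r0 Gx vE).
  by rewrite e1// e2// /along max_r.
have pB r : along p x r <= B.
  by apply: le_trans (ler_norm _) (hB _ _); exact: inv.
have qp' r : along q x r <= along p x r by apply: qp; exact: inv.
have cpx := along_continuous cp Gx; have cqx := along_continuous cq Gx.
have cf := orbit_form_continuous (u := v) (w := v) Gx.
have [g1 g2] := avg_growth cf cpx cqx f0 T1 C1' fC fT pB qp' B0 d0 tau1 tauP t0.
by rewrite adapted_shift// dotg_adapted.
Qed.

End AdaptedForm.

(** * The block of the plane bundle *)

Lemma gram2_congr (R : realType) (m : nat) (G H A : 'M[R]_m) (v w : 'rV[R]_m) :
  (forall a b : 'rV[R]_m, dotg G a b = dotg H (a *m A) (b *m A)) ->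
  gram2 G v w = gram2 H (v *m A) (w *m A).
Proof. by move=> e; rewrite /gram2 !e. Qed.

Lemma Int_sumE (R : realType) (f g h : R -> R) (a b : R) :
  continuous f -> continuous g -> continuous h -> a <= b ->
  (forall s, a <= s <= b -> f s = g s + h s) -> Int f a b = Int g a b + Int h a b.
Proof.
move=> cf cg ch ab e; rewrite -IntD//; apply: Int_congr => //.
by move=> s; apply: (@continuousD R R R g h); [exact: cg|exact: ch].
Qed.

(** On a plane, the area ratio of two forms is squeezed between the products of
    their extremal ratios; so rescaling two forms to a prescribed area ratio
    [l * k] keeps the lower ratio [l]. *)
Lemma plane_rescale (R : realType) (m : nat) (E : {vspace 'rV[R]_m})
    (A B : 'M[R]_m) (v w u : 'rV[R]_m) (a b l k : R) :
  inner_product A -> inner_product B -> frame2 E v w -> u \in E ->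
  0 < a -> 0 < b -> 0 <= l -> 0 <= k ->
  b ^+ 2 * gram2 B v w = l * k * (a ^+ 2 * gram2 A v w) ->
  l * dotg A u u <= dotg B u u ->
  (forall z, z \in E -> dotg B z z <= k * dotg A z z) ->
  l * (a * dotg A u u) <= b * dotg B u u.
Proof.
move=> iA iB fr uE a0 b0 l0 k0 ar lo up.
have det := frame2_det_upper (inner_pos_def_on E iA) (inner_psd iB) fr uE up.
have gA := gram2_gt0 (inner_pos_def_on E iA) fr; have gB := gram2_gt0 (inner_pos_def_on E iB) fr.
have p0 := (inner_psd iA).2 u; have q0 := (inner_psd iB).2 u.
move: (dotg A u u) (dotg B u u) (gram2 A v w) (gram2 B v w) p0 q0 gA gB det ar lo.
move=> p q ga gb p0 q0 ga0 gb0 det ar lo.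
rewrite -(@ler_pXn2r _ 2) ?nnegrE ?mulr_ge0 ?(ltW a0) ?(ltW b0)//.
rewrite -(ler_pM2r gb0).
have -> : (b * q) ^+ 2 * gb = a ^+ 2 * (l * k * ga * q ^+ 2).
  by rewrite exprMn mulrAC ar; ring.
have -> : (l * (a * p)) ^+ 2 * gb = a ^+ 2 * (l ^+ 2 * p * (gb * p)) by ring.
rewrite ler_pM2l ?exprn_gt0//.
apply: (@le_trans _ _ (l ^+ 2 * p * (k * q * ga))).
  by apply: ler_wpM2l => //; rewrite mulr_ge0 ?sqr_ge0.
have -> : l ^+ 2 * p * (k * q * ga) = l * k * ga * q * (l * p) by ring.
rewrite expr2 [leRHS]mulrA; apply: ler_wpM2l => //.
by rewrite !mulr_ge0// ltW.
Qed.

Section PlaneField.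
Context {R : realType} {m : nat} {M : topologicalType}.
Variable S : smooth_manifold R m M.
Variables (X : M -> 'rV[R]_m) (phi : R -> M -> M) (Gamma : set M).
Hypothesis flow : is_flow S X phi.
Hypothesis cptM : compact [set: M].
Hypothesis cptG : compact Gamma.
Hypothesis inv : forall (t : R) (x : M), 0 <= t -> Gamma x -> Gamma (phi t x).
Variable g0 : M -> 'M[R]_m.
Hypothesis ig : forall x, inner_product (g0 x).
Hypothesis cg : cont_form S Gamma g0.
Local Notation V := 'rV[R]_m.
Local Notation DX := (flow_diff S X phi).
Local Notation Q := (pulled S X phi g0).
Variable E : M -> {vspace V}.
Hypothesis subE : subbundle S Gamma 2 E.
Hypothesis invE : forall (t : R) (x : M) (v : 'rV[R]_m), 0 <= t -> Gamma x -> v \in E x -> v *m DX t x \in E (phi t x).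
Implicit Types (x y : M) (r s t : R) (u v w : V).

Let iQ x r : 0 <= r -> inner_product (Q r x).
Proof. by move=> r0; exact: (pulled_inner flow cptM ig). Qed.

Let fQ : cont_flow_form S Gamma Q. Proof. exact: cont_flow_form_pulled. Qed.
Let fg : cont_flow_form S Gamma (fun=> g0). Proof. exact: cont_flow_form_cst. Qed.

Lemma push_frame t x v w : 0 <= t -> Gamma x -> frame2 (E x) v w ->
  frame2 (E (phi t x)) (v *m DX t x) (w *m DX t x).
Proof.
move=> t0 Gx fr; have u := flow_diff_unit flow cptM x t0.
have d1 := frame2_dim (frame_fst_snd subE (inv t0 Gx)).
rewrite /frame2 basisEfree d1 leqnn andbT; apply/andP; split; last first.
  apply/span_subvP => z; rewrite !inE => /orP[] /eqP ->; apply: invE => //.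
    exact: frame2_meml fr.
  exact: frame2_memr fr.
have [vw w0] := frame2_free fr.
rewrite free_cons span_seq1 seq1_free; apply/andP; split.
  apply: contra vw => /vlineP[k e]; apply/vlineP; exists k.
  by rewrite -(mulmxK u v) e scalemxAl mulmxK.
by apply: contra w0 => /eqP e; rewrite -(mulmxK u w) e mul0mx.
Qed.

(** The squared area expansion of [DX_r] on the plane at [x], with respect to
    [g0]. *)
Definition area_growth r x := area_ratio E (Q r x) (g0 x) x.
(** The squared Hilbert-Schmidt norm of [DX_r] on the plane at [x], with
    respect to [g0]. *)
Definition hs_growth r x := hs_ratio E (Q r x) (g0 x) x.

Lemma gram2_pulledD r s x v w : 0 <= r -> 0 <= s ->
  gram2 (Q (r + s) x) v w = gram2 (Q s (phi r x)) (v *m DX r x) (w *m DX r x).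
Proof.
by move=> r0 s0; apply: gram2_congr => a b; exact: pulledD.
Qed.

Lemma gram2_pulled r x v w :
  gram2 (Q r x) v w = gram2 (g0 (phi r x)) (v *m DX r x) (w *m DX r x).
Proof.
by apply: gram2_congr => a b; exact: dotg_pulled.
Qed.

Lemma area_growthP r x v w : Gamma x -> 0 <= r -> frame2 (E x) v w ->
  gram2 (Q r x) v w = area_growth r x * gram2 (g0 x) v w.
Proof.
move=> Gx r0 fr; have pg := inner_pos_def_on (E x) (ig x).
rewrite /area_growth (area_ratioE subE Gx (iQ x r0).1 pg fr) divfK// gt_eqF//.
exact: gram2_gt0 pg fr.
Qed.

Lemma hs_growthP r x v w : Gamma x -> 0 <= r -> frame2 (E x) v w ->
  mix2 (Q r x) (g0 x) v w = hs_growth r x * gram2 (g0 x) v w.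
Proof.
move=> Gx r0 fr; have pg := inner_pos_def_on (E x) (ig x).
rewrite /hs_growth (hs_ratioE subE Gx (iQ x r0).1 pg fr) divfK// gt_eqF//.
exact: gram2_gt0 pg fr.
Qed.

Lemma area_growth_gt0 r x : Gamma x -> 0 <= r -> 0 < area_growth r x.
Proof.
move=> Gx r0; have fr := frame_fst_snd subE Gx.
rewrite divr_gt0//; first exact: gram2_gt0 (inner_pos_def_on _ (iQ x r0)) fr.
exact: gram2_gt0 (inner_pos_def_on _ (ig x)) fr.
Qed.

Lemma area_growth_cocycle r s x : Gamma x -> 0 <= r -> 0 <= s ->
  area_growth (r + s) x = area_growth r x * area_growth s (phi r x).
Proof.
move=> Gx r0 s0; have fr := frame_fst_snd subE Gx.
have fr' := push_frame r0 Gx fr; have Gr := inv r0 Gx.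
have pg := gram2_gt0 (inner_pos_def_on _ (ig x)) fr.
have rs := addr_ge0 r0 s0.
have e1 := area_growthP Gx rs fr; have e2 := area_growthP Gr s0 fr'; have e3 := area_growthP Gx r0 fr.
have e4 := gram2_pulledD x (frame_fst E x) (frame_snd E x) r0 s0.
have e5 := gram2_pulled r x (frame_fst E x) (frame_snd E x).
apply: (mulIf (lt0r_neq0 pg)); rewrite -[LHS]e1 e4 e2 -e5 e3.
by rewrite mulrCA mulrA.
Qed.

Lemma hs_growth_upper r x v : Gamma x -> 0 <= r -> v \in E x ->
  dotg (Q r x) v v <= hs_growth r x * dotg (g0 x) v v.
Proof.
move=> Gx r0 vE; have fr := frame_fst_snd subE Gx.
have pg := gram2_gt0 (inner_pos_def_on _ (ig x)) fr.
have h := frame2_upper (ig x).1 (iQ x r0).1 (fun z _ => (inner_psd (iQ x r0)).2 z) fr vE.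
by rewrite hs_growthP// mulrAC ler_pM2r// in h.
Qed.

Lemma hs_growth_lower r x v : Gamma x -> 0 <= r -> v \in E x ->
  area_growth r x * dotg (g0 x) v v <= hs_growth r x * dotg (Q r x) v v.
Proof.
move=> Gx r0 vE; have fr := frame_fst_snd subE Gx.
have pg := gram2_gt0 (inner_pos_def_on _ (ig x)) fr.
have h := frame2_lower (ig x).1 (iQ x r0).1 (fun z _ => (inner_psd (ig x)).2 z) fr vE.
by rewrite hs_growthP// area_growthP// mulrAC [leRHS]mulrAC ler_pM2r// in h.
Qed.

Lemma hs_growth_gt0 r x : Gamma x -> 0 <= r -> 0 < hs_growth r x.
Proof.
move=> Gx r0; have fr := frame_fst_snd subE Gx.
have [_ w0] := frame2_free fr; have wE := frame2_memr fr.
have h := hs_growth_upper Gx r0 wE.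
have gw : 0 < dotg (g0 x) (frame_snd E x) (frame_snd E x) by exact: (ig x).2.
have qw : 0 < dotg (Q r x) (frame_snd E x) (frame_snd E x) by exact: (iQ x r0).2.
by rewrite -(pmulr_lgt0 _ gw); exact: lt_le_trans h.
Qed.

Lemma hs_growth_le r x (c : R) : Gamma x -> 0 <= r ->
  (forall v, v \in E x -> dotg (Q r x) v v <= c * dotg (g0 x) v v) -> hs_growth r x <= 2 * c.
Proof.
move=> Gx r0 le; have fr := frame_fst_snd subE Gx.
have pg := gram2_gt0 (inner_pos_def_on _ (ig x)) fr.
have h := frame2_hs (inner_pos_def_on (E x) (ig x)) (iQ x r0).1 fr le.
by rewrite hs_growthP// ler_pM2r// in h.
Qed.

(** A lower bound on the stretching of all vectors bounds the Hilbert-Schmidt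
    norm of the inverse, which is the one of the map divided by the area
    expansion. *)
Lemma hs_growth_le_area r x (c : R) : Gamma x -> 0 <= r ->
  (forall v, v \in E x -> dotg (g0 x) v v <= c * dotg (Q r x) v v) ->
  hs_growth r x <= 2 * c * area_growth r x.
Proof.
move=> Gx r0 le; have fr := frame_fst_snd subE Gx.
have pg := gram2_gt0 (inner_pos_def_on _ (ig x)) fr.
have h := frame2_hs (inner_pos_def_on (E x) (iQ x r0)) (ig x).1 fr le.
by rewrite mix2C hs_growthP// area_growthP// mulrA ler_pM2r// in h.
Qed.

Let pos y s : Gamma y -> 0 <= s -> (Q s y)^T = Q s y /\ pos_def_on (g0 y) (E y).
Proof. by move=> Gy s0; split; [exact: (iQ y s0).1|exact: inner_pos_def_on]. Qed.

Lemma area_growth_cvg x r : Gamma x -> 0 <= r ->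
  (fun p : M * R => area_growth p.2 p.1) @ flow_filter Gamma x r --> area_growth r x.
Proof. by move=> Gx r0; have [h _] := ratio_cvg subE fQ fg pos Gx r0. Qed.

Lemma hs_growth_cvg x r : Gamma x -> 0 <= r ->
  (fun p : M * R => hs_growth p.2 p.1) @ flow_filter Gamma x r --> hs_growth r x.
Proof. by move=> Gx r0; have [_ h] := ratio_cvg subE fQ fg pos Gx r0. Qed.

Lemma ln_cvg (T : Type) (F : set_system T) (FF : Filter F) (h : T -> R) (l : R) :
  0 < l -> h @ F --> l -> ln (h z) @[z --> F] --> ln l.
Proof. by move=> l0 hl W nW; have := continuous_ln l0 nW => nW2; exact: (hl _ nW2). Qed.

Definition area_rate T x := ln (area_growth T x) / (2 * T).
Definition hs_rate T x := ln (hs_growth T x) / (2 * T).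

Lemma area_rate_cont_fun T : 0 <= T -> cont_fun Gamma (area_rate T).
Proof.
move=> T0 x Gx; apply: cvgM; last exact: cvg_cst.
apply: ln_cvg; first exact: area_growth_gt0.
exact: (flow_filter_slice T0 (area_growth_cvg Gx T0)).
Qed.

Lemma hs_rate_cont_fun T : 0 <= T -> cont_fun Gamma (hs_rate T).
Proof.
move=> T0 x Gx; apply: cvgM; last exact: cvg_cst.
apply: ln_cvg; first exact: hs_growth_gt0.
exact: (flow_filter_slice T0 (hs_growth_cvg Gx T0)).
Qed.

Lemma exp_area_rate T x : 0 < T -> Gamma x -> expR (2 * T * area_rate T x) = area_growth T x.
Proof.
move=> T0 Gx; have e : 2 * T * area_rate T x = ln (area_growth T x).
  by rewrite /area_rate mulrC divfK// mulf_neq0// gt_eqF.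
by rewrite e lnK// posrE area_growth_gt0// ltW.
Qed.

Lemma exp_hs_rate T x : 0 < T -> Gamma x -> expR (2 * T * hs_rate T x) = hs_growth T x.
Proof.
move=> T0 Gx; have e : 2 * T * hs_rate T x = ln (hs_growth T x).
  by rewrite /hs_rate mulrC divfK// mulf_neq0// gt_eqF.
by rewrite e lnK// posrE hs_growth_gt0// ltW.
Qed.

Definition log_area x r := ln (area_growth (Num.max 0 r) x).

Lemma log_area_jcvg x : Gamma x -> joint_cvg (within Gamma (nbhs x)) log_area (log_area x).
Proof.
move=> Gx; apply: (joint_cvg_max (h := fun y r => ln (area_growth r y)) (l := fun r => ln (area_growth r x))).
by move=> r r0; apply: ln_cvg; [exact: area_growth_gt0|exact: area_growth_cvg].
Qed.

Lemma log_area_continuous x : Gamma x -> continuous (log_area x).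
Proof. by move=> Gx; apply: (joint_cvg_continuous Gx); exact: log_area_jcvg. Qed.

(** The geometric mean of the squared areas pulled back to the plane at [x]
    from times between [tau] and [tau + T], relative to the squared area of
    [g0]. *)
Definition gmean T tau x := expR (T^-1 * Int (log_area x) tau (tau + T)).

Lemma gmean_cont_fun T tau : cont_fun Gamma (gmean T tau).
Proof.
move=> x Gx.
have near : \forall y \near within Gamma (nbhs x), continuous (log_area y).
  change (\forall y \near x, Gamma y -> continuous (log_area y)).
  by apply: nearW => y Gy; exact: log_area_continuous.
have jp : joint_cvg (within Gamma (nbhs x)) (fun y => prim (log_area y)) (prim (log_area x)).
  by exact: (joint_cvg_prim (log_area_continuous Gx) near (log_area_jcvg Gx)).
have h1 : Int (log_area y) tau (tau + T) @[y --> within Gamma (nbhs x)] --> Int (log_area x) tau (tau + T).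
  have a1 : prim (log_area y) (tau + T) @[y --> within Gamma (nbhs x)] --> prim (log_area x) (tau + T).
    by exact: (joint_cvg_at jp).
  have a2 : prim (log_area y) tau @[y --> within Gamma (nbhs x)] --> prim (log_area x) tau.
    by exact: (joint_cvg_at jp).
  exact: cvgB a1 a2.
have h2 : T^-1 * Int (log_area y) tau (tau + T) @[y --> within Gamma (nbhs x)] -->
    T^-1 * Int (log_area x) tau (tau + T).
  by apply: cvgM; [exact: cvg_cst|exact: h1].
by move=> W nW; have nW2 := continuous_expR nW; exact: (h2 _ nW2).
Qed.

(** Logarithms of area expansions add along the orbit, so shifting the window
    by [t] changes their mean by the difference of two integrals over intervals
    of length [t] that are [T] apart; the integrands differ by [2 T area_rate].
    *)
Lemma gmean_cocycle T tau t x : 0 < T -> 0 <= tau -> 0 <= t -> Gamma x ->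
  gmean T tau (phi t x) * area_growth t x =
  expR (2 * Int (along phi (area_rate T) x) tau (t + tau)) * gmean T tau x.
Proof.
move=> T0 tau0 t0 Gx; have Gt := inv t0 Gx.
have k0 := area_growth_gt0 Gx t0.
have T0' := ltW T0.
have cl := log_area_continuous Gx.
have cc (c : R) : continuous (fun _ : R => c) by move=> ?; exact: cvg_cst.
have csh (c : R) : continuous (fun s => log_area x (c + s)).
  move=> s; apply: continuous_comp; last exact: cl.
  by apply: continuousD; [exact: cvg_cst|exact: cvg_id].
have tT : tau <= tau + T by rewrite lerDl.
have tt : tau <= t + tau by rewrite lerDr.
rewrite -{1}(lnK k0) /gmean -!expRD; congr expR.
have e1 : Int (log_area (phi t x)) tau (tau + T) = Int (log_area x) (t + tau) (t + (tau + T)) - T * ln (area_growth t x).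
  have ck : continuous (fun _ : R => - ln (area_growth t x)) by exact: cc.
  have e0 : Int (log_area (phi t x)) tau (tau + T) =
      Int (fun s => log_area x (t + s)) tau (tau + T) + Int (fun=> - ln (area_growth t x)) tau (tau + T).
    apply: (Int_sumE (log_area_continuous Gt) (csh t) ck tT) => s /andP[ts _]; have s0 : 0 <= s by exact: le_trans ts.
    have e : area_growth (t + s) x = area_growth t x * area_growth s (phi t x) by exact: area_growth_cocycle.
    have ks : 0 < area_growth s (phi t x) by exact: area_growth_gt0.
    rewrite /log_area (max_r s0) (max_r (addr_ge0 t0 s0)) e lnM ?posrE//.
    by rewrite addrAC subrr add0r.
  have e3 : Int (fun=> - ln (area_growth t x)) tau (tau + T) = - ln (area_growth t x) * (tau + T - tau).
    exact: Int_cst.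
  have e4 := Int_shift t cl tT.
  have alg (a b c i l : R) : a = b + c -> b = i -> c = - l * (tau + T - tau) -> a = i - T * l.
    by move=> -> -> ->; ring.
  exact: alg e0 e4 e3.
have e2 : T * (2 * Int (along phi (area_rate T) x) tau (t + tau)) =
   Int (fun s => log_area x (T + s)) tau (t + tau) - Int (log_area x) tau (t + tau).
  have cd := along_continuous flow cptM inv (area_rate_cont_fun T0') Gx.
  have cz : continuous (fun s => T * (2 * along phi (area_rate T) x s)).
    exact: (continuous_scal (continuous_scal cd)).
  have T1 : T != 0 by rewrite gt_eqF.
  have c2 : continuous (fun s => 2 * along phi (area_rate T) x s) by exact: continuous_scal.
  have z2 : Int (fun s => T * (2 * along phi (area_rate T) x s)) tau (t + tau) =
      T * (2 * Int (along phi (area_rate T) x) tau (t + tau)).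
    by rewrite (IntZ _ c2 tt) (IntZ _ cd tt).
  rewrite -z2; apply: (canRL (addrK _)); apply/esym.
  apply: (Int_sumE (csh T) cz cl tt) => s /andP[ts _]; have s0 : 0 <= s by exact: le_trans ts.
  have Gs := inv s0 Gx.
  have e : area_growth (s + T) x = area_growth s x * area_growth T (phi s x) by exact: area_growth_cocycle.
  have k1 := area_growth_gt0 Gx s0; have k2 := area_growth_gt0 Gs T0'.
  rewrite /log_area /along (max_r s0) [T + s]addrC (max_r (addr_ge0 s0 T0')) e lnM ?posrE//.
  rewrite addrC; congr (_ + _); rewrite /area_rate; set l := ln _.
  by field.
have T1 : T != 0 by rewrite gt_eqF.
have e5 : Int (log_area x) (t + tau) (t + (tau + T)) =
    Int (fun s => log_area x (T + s)) tau (t + tau) - Int (log_area x) tau (t + tau) +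
    Int (log_area x) tau (tau + T).
  have alg (F : R -> R) (i : R) : i = F (T + (t + tau)) - F (T + tau) ->
      F (t + (tau + T)) - F (t + tau) =
      i - (F (t + tau) - F tau) + (F (tau + T) - F tau).
    move=> ->; rewrite [T + tau]addrC (_ : t + (tau + T) = T + (t + tau)); last by ring.
    by ring.
  exact: (alg (prim (log_area x)) _ (Int_shift T cl tt)).
have alg (a b c i j l : R) : a = b - T * l -> T * (2 * i) = c -> b = c + j ->
    T^-1 * a + l = 2 * i + T^-1 * j.
  by move=> -> <- ->; field.
exact: alg e1 e2 e5.
Qed.

(** The averaged form is multiplied by the positive function that gives it the
    squared area element [gmean]. The upper bound on the growth of the averaged
    form limits its area growth from above in terms of its lower growth, and
    thus the rescaling costs nothing in the lower bound ([plane_rescale]). *)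
Lemma plane_adapted (T d : R) : 1 <= T -> 0 < d ->
  exists tau0 : R, forall tau, tau0 <= tau -> 1 <= tau -> exists Gc : M -> 'M[R]_m,
  [/\ cont_form S Gamma Gc, forall x, Gamma x -> inner_product (Gc x) &
   forall x t, Gamma x -> 0 <= t ->
    (forall v w, frame2 (E x) v w -> gram2 (Gc (phi t x)) (v *m DX t x) (w *m DX t x) =
       expR (2 * Int (along phi (area_rate T) x) tau (t + tau)) * gram2 (Gc x) v w) /\
    (forall v, v \in E x ->
       expR (2 * (Int (along phi (area_rate T) x) tau (t + tau) - Int (along phi (hs_rate T) x) tau (t + tau)) - 4 * d * t)
         * dotg (Gc x) v v <= dotg (Gc (phi t x)) (v *m DX t x) (v *m DX t x))].
Proof.
move=> T1 d0.
have T0 : 0 < T by exact: lt_le_trans T1.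
have T0' := ltW T0.
have cq := hs_rate_cont_fun T0'; have cd := area_rate_cont_fun T0'.
pose pl x := area_rate T x - hs_rate T x.
have cpl : cont_fun Gamma pl by move=> x Gx; apply: cvgB; [exact: cd|exact: cq].
have qp x : Gamma x -> pl x <= hs_rate T x.
  move=> Gx; have fr := frame_fst_snd subE Gx; have [_ w0] := frame2_free fr.
  have wE := frame2_memr fr.
  have gw : 0 < dotg (g0 x) (frame_snd E x) (frame_snd E x) by exact: (ig x).2.
  have h1 := hs_growth_lower Gx T0' wE; have h2 := hs_growth_upper Gx T0' wE.
  have hp := hs_growth_gt0 Gx T0'.
  have h3 : area_growth T x <= hs_growth T x * hs_growth T x.
    have alg (a h k q : R) : 0 < a -> 0 < h -> k * a <= h * q -> q <= h * a -> k <= h * h.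
      move=> a0 hh0 ka qa; rewrite -(ler_pM2r a0); apply: le_trans ka _.
      by rewrite -mulrA ler_pM2l.
    exact: alg gw hp h1 h2.
  have h4 : ln (area_growth T x) <= ln (hs_growth T x) + ln (hs_growth T x).
    rewrite -lnM ?posrE// ler_ln ?posrE//; first exact: area_growth_gt0.
    exact: mulr_gt0.
  rewrite /pl lerBlDr /area_rate /hs_rate -mulrDl; apply: ler_wpM2r h4.
  by rewrite invr_ge0 mulr_ge0.
have gr x v : Gamma x -> v \in E x ->
     expR (2 * T * pl x) * dotg (g0 x) v v <= dotg (Q T x) v v <=
     expR (2 * T * hs_rate T x) * dotg (g0 x) v v.
  move=> Gx vE; apply/andP; split; last by rewrite exp_hs_rate//; exact: hs_growth_upper.
  have -> : 2 * T * pl x = 2 * T * area_rate T x - 2 * T * hs_rate T x by rewrite /pl; ring.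
  rewrite expRD expRN exp_area_rate// exp_hs_rate// mulrAC ler_pdivrMr ?hs_growth_gt0// mulrC [leRHS]mulrC.
  by have := hs_growth_lower Gx T0' vE; rewrite mulrC.
have [tau0 H] := adapted_growth flow cptM cptG inv ig cg invE cq cpl T1 d0 qp gr.
exists tau0 => tau h1 tau1; have {}H := H tau h1 tau1.
have tau0' : 0 < tau by exact: lt_le_trans tau1.
pose A := adapted S X phi g0 (hs_rate T) pl d tau.
have iA x : Gamma x -> inner_product (A x) by exact: adapted_inner.
have cA : cont_form S Gamma A by exact: adapted_cont_form.
pose rho x := area_ratio E (A x) (g0 x) x.
have rho0 x : Gamma x -> 0 < rho x.
  move=> Gx; have fr := frame_fst_snd subE Gx.
  rewrite divr_gt0//; first exact: gram2_gt0 (inner_pos_def_on _ (iA x Gx)) fr.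
  exact: gram2_gt0 (inner_pos_def_on _ (ig x)) fr.
have crho : cont_fun Gamma rho.
  move=> x Gx.
  have posA y s : Gamma y -> 0 <= s -> (A y)^T = A y /\ pos_def_on (g0 y) (E y).
    by move=> Gy _; split; [exact: (iA y Gy).1|exact: inner_pos_def_on].
  have [h _] := ratio_cvg subE (cont_flow_form_cst cA) fg posA Gx (lexx 0).
  exact: (flow_filter_slice (lexx 0) h).
pose theta x := Num.sqrt (gmean T tau x / rho x).
have gm0 x : 0 < gmean T tau x by exact: expR_gt0.
have th0 x : Gamma x -> 0 < theta x by move=> Gx; rewrite sqrtr_gt0 divr_gt0// rho0.
have thE x : Gamma x -> theta x ^+ 2 = gmean T tau x / rho x.
  by move=> Gx; rewrite sqr_sqrtr// ltW// divr_gt0// rho0.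
have cth : cont_fun Gamma theta.
  move=> x Gx.
  have nz : rho x != 0 by rewrite gt_eqF// rho0.
  have h : gmean T tau y / rho y @[y --> within Gamma (nbhs x)] --> gmean T tau x / rho x.
    by apply: cvgM; [exact: gmean_cont_fun|apply: cvgV => //; exact: crho].
  by move=> W nW; have nW2 := sqrt_continuous nW; exact: (h _ nW2).
exists (fun x => theta x *: A x); split.
- exact: cont_formZ.
- move=> x Gx; split; first by rewrite linearZ/= (iA x Gx).1.
  by move=> v v0; rewrite dotgZf mulr_gt0 ?th0//; exact: (iA x Gx).2.
- move=> x t Gx t0; have Gt := inv t0 Gx.
  have area v w : frame2 (E x) v w -> gram2 (theta (phi t x) *: A (phi t x)) (v *m DX t x) (w *m DX t x) =
       expR (2 * Int (along phi (area_rate T) x) tau (t + tau)) * gram2 (theta x *: A x) v w.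
    move=> fr; have fr' := push_frame t0 Gx fr.
    have Eg y v' w' : Gamma y -> frame2 (E y) v' w' ->
        gram2 (theta y *: A y) v' w' = gmean T tau y * gram2 (g0 y) v' w'.
      move=> Gy fry; rewrite gram2Z thE//.
      have e := area_ratioE subE Gy (iA y Gy).1 (inner_pos_def_on (E y) (ig y)) fry.
      have gg := gram2_gt0 (inner_pos_def_on (E y) (ig y)) fry.
      have -> : gram2 (A y) v' w' = rho y * gram2 (g0 y) v' w'.
        by rewrite /rho e divfK// gt_eqF.
      by rewrite mulrA divfK// gt_eqF// rho0.
    have e1 := Eg _ _ _ Gt fr'; have e2 := Eg _ _ _ Gx fr.
    have e3 := gram2_pulled t x v w; have e4 := area_growthP Gx t0 fr.
    have e5 := gmean_cocycle T0 (ltW tau0') t0 Gx.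
    have alg (p q r i j k n c e : R) : p = i * j -> q = k * n -> r = j -> r = c * n ->
      i * c = e * k -> p = e * q by move=> -> -> <- -> h; rewrite !mulrA h.
    exact: alg e1 e2 e3 e4 e5.
  split=> // v vE.
  have [lo _] := H x v t Gx vE t0.
  have fr := frame_fst_snd subE Gx.
  have tt : tau <= t + tau by rewrite lerDr.
  have cdx := along_continuous flow cptM inv cd Gx.
  have cqx := along_continuous flow cptM inv cq Gx.
  have cqx' : continuous (fun r => (-1) * along phi (hs_rate T) x r) by exact: continuous_scal.
  have Ipl : Int (along phi pl x) tau (t + tau) =
     Int (along phi (area_rate T) x) tau (t + tau) - Int (along phi (hs_rate T) x) tau (t + tau).
    have e : along phi pl x = (fun r => along phi (area_rate T) x r + (-1) * along phi (hs_rate T) x r).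
      by apply/funext => r; rewrite /along /pl mulN1r.
    have e1 := IntD cdx cqx' tt; have e2 := IntZ (-1) cqx tt.
    by rewrite e e1 e2 mulN1r.
  rewrite Ipl in lo.
  have ar := area _ _ fr.
  pose At := pull_form (DX t x) (A (phi t x)).
  have iAt : inner_product At.
    by apply: inner_pull; [exact: (flow_diff_unit flow cptM)|exact: iA].
  have AtE u : dotg At u u = dotg (A (phi t x)) (u *m DX t x) (u *m DX t x) by exact: dotg_pull.
  have gAt : gram2 At (frame_fst E x) (frame_snd E x) =
      gram2 (A (phi t x)) (frame_fst E x *m DX t x) (frame_snd E x *m DX t x).
    by apply: gram2_congr => a b; exact: dotg_pull.
  have up z : z \in E x -> dotg At z z <=
      expR (2 * Int (along phi (hs_rate T) x) tau (t + tau) + 4 * d * t) * dotg (A x) z z.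
    by move=> zE; rewrite AtE; have [] := H x z t Gx zE t0.
  have e3 : dotg (theta x *: A x) v v = theta x * dotg (A x) v v by exact: dotgZf.
  have e4 : dotg (theta (phi t x) *: A (phi t x)) (v *m DX t x) (v *m DX t x) =
      theta (phi t x) * dotg At v v by rewrite AtE; exact: dotgZf.
  have alg (p p' q q' l : R) : p = p' -> q = q' -> l * p' <= q' -> l * p <= q.
    by move=> -> ->.
  apply: (alg _ _ _ _ _ e3 e4).
  have lo' : expR (2 * (Int (along phi (area_rate T) x) tau (t + tau) -
      Int (along phi (hs_rate T) x) tau (t + tau)) - 4 * d * t) * dotg (A x) v v <= dotg At v v.
    by rewrite AtE.
  have e5 := gram2Z (theta x) (A x) (frame_fst E x) (frame_snd E x).
  have e6 := gram2Z (theta (phi t x)) (A (phi t x)) (frame_fst E x *m DX t x) (frame_snd E x *m DX t x).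
  apply: (plane_rescale (iA x Gx) iAt fr vE (th0 x Gx) (th0 _ Gt) (expR_ge0 _) (expR_ge0 _) _ lo' up).
  have alg2 (p q r s' a b i l k c : R) : p = c * q -> p = b * r -> q = a * s' -> i = r ->
      c = l * k -> b * i = l * k * (a * s').
    by move=> k1 k2 k3 -> <-; rewrite -k2 k1 k3.
  apply: (alg2 _ _ _ _ _ _ _ _ _ _ ar e6 e5 gAt).
  move: (Int _ _ _) (Int _ _ _) => i1 i2; rewrite -expRD; congr expR; ring.
Qed.

End PlaneField.

(** * Assembling the blocks *)

Section Assembly.
Context {R : realType} {m : nat}.
Local Notation V := 'rV[R]_m.
Implicit Types (G H A : 'M[R]_m) (u v w : V) (U : {vspace V}).

Lemma opnorm_sq G H A U v (c : R) : inner_product G -> psd H -> v \in U ->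
  opnorm G H A U <= c -> dotg H (v *m A) (v *m A) <= c ^+ 2 * dotg G v v.
Proof.
move=> iG pH vU le; have h := opnorm_ub A iG pH vU; have n0 := normg_ge0 G v.
have o0 := opnorm_ge0 G H A U.
rewrite -(normg_sq (v *m A) pH) -(normg_sq v (inner_psd iG)) -exprMn.
rewrite ler_pXn2r ?nnegrE ?normg_ge0 ?mulr_ge0 ?(le_trans o0 le)//.
by apply: le_trans h _; exact: ler_wpM2r.
Qed.

Lemma opnorm_sq2 G H A U v G' H' A' U' v' (c : R) :
  inner_product G -> psd H -> v \in U -> inner_product G' -> psd H' -> v' \in U' ->
  opnorm G H A U * opnorm G' H' A' U' <= c ->
  dotg H (v *m A) (v *m A) * dotg H' (v' *m A') (v' *m A') <=
    c ^+ 2 * (dotg G v v * dotg G' v' v').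
Proof.
move=> iG pH vU iG' pH' vU' le.
have h := opnorm_sq iG pH vU (lexx (opnorm G H A U)).
have h' := opnorm_sq iG' pH' vU' (lexx (opnorm G' H' A' U')).
apply: le_trans (ler_pM (pH.2 _) (pH'.2 _) h h') _.
rewrite mulrACA -exprMn; apply: ler_wpM2r.
  by rewrite mulr_ge0//; [exact: (inner_psd iG).2|exact: (inner_psd iG').2].
have o0 : 0 <= opnorm G H A U * opnorm G' H' A' U' by rewrite mulr_ge0 ?opnorm_ge0.
by rewrite ler_pXn2r ?nnegrE// (le_trans o0 le).
Qed.

Lemma opnorm_le_sq G H A U (c : R) : psd G -> psd H -> 0 <= c ->
  (forall v, v \in U -> dotg H (v *m A) (v *m A) <= c ^+ 2 * dotg G v v) ->
  opnorm G H A U <= c.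
Proof.
move=> pG pH c0 le; apply: opnorm_le => // v vU.
rewrite -(@ler_pXn2r _ 2) ?nnegrE ?mulr_ge0 ?normg_ge0//.
by rewrite exprMn !normg_sq//; exact: le.
Qed.

(* [Es], [Ec] and [Eu] enter through the projections onto them at the source
   and at the target, which [A] intertwines. *)
Variables (A Ps Pc Pu Ps' Pc' Pu' Hs Hc Hu Hs' Hc' Hu' : 'M[R]_m).
Variables (Es Ec Eu : {vspace V}).
Let G := pull_form Ps Hs + pull_form Pc Hc + pull_form Pu Hu.
Let G' := pull_form Ps' Hs' + pull_form Pc' Hc' + pull_form Pu' Hu'.
Hypothesis uA : A \in unitmx.
Hypotheses (js : Ps *m A = A *m Ps') (jc : Pc *m A = A *m Pc') (ju : Pu *m A = A *m Pu').
Hypotheses (is_s : forall v, v *m Ps \in Es) (is_c : forall v, v *m Pc \in Ec)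
  (is_u : forall v, v *m Pu \in Eu).
Hypotheses (iHs : psd Hs) (iHc : inner_product Hc) (iHu : psd Hu).
Hypotheses (iHs' : psd Hs') (iHc' : inner_product Hc') (iHu' : psd Hu').

Lemma assembly_dot v w : dotg (pull_form A G') v w =
  dotg (pull_form A Hs') (v *m Ps) (w *m Ps) + dotg (pull_form A Hc') (v *m Pc) (w *m Pc) +
  dotg (pull_form A Hu') (v *m Pu) (w *m Pu).
Proof. by rewrite dotg_pull /G' !dotgDf !dotg_pull -!mulmxA js jc ju. Qed.

Variables (es ec eu a : R).
Hypotheses (ec0 : 0 <= ec) (eu0 : 0 <= eu).
Hypothesis up_s : forall v, v \in Es -> dotg Hs' (v *m A) (v *m A) <= es * dotg Hs v v.
Hypothesis lo_c : forall v, v \in Ec -> ec * dotg Hc v v <= dotg Hc' (v *m A) (v *m A).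
Hypothesis lo_u : forall v, v \in Eu -> eu * dotg Hu v v <= dotg Hu' (v *m A) (v *m A).
Hypothesis area_c : forall v w, frame2 Ec v w ->
  gram2 Hc' (v *m A) (w *m A) = a * gram2 Hc v w.
Hypothesis dim_c : \dim Ec = 2%N.

Lemma assembly_upper v : v *m Pc = 0 -> v *m Pu = 0 ->
  dotg G' (v *m A) (v *m A) <= es * dotg G v v.
Proof.
move=> vc vu; rewrite -dotg_pull assembly_dot /G !dotgDf !dotg_pull vc vu.
by rewrite !mul0mx !dotg0l !addr0; exact: up_s.
Qed.

Lemma assembly_lower (k : R) v : 0 <= k -> k <= ec -> k <= eu -> v *m Ps = 0 ->
  k * dotg G v v <= dotg G' (v *m A) (v *m A).
Proof.
move=> k0 kc ku vs; rewrite -dotg_pull assembly_dot /G !dotgDf !dotg_pull vs.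
rewrite !mul0mx !dotg0l !add0r mulrDr; apply: lerD.
  by apply: le_trans (lo_c (is_c v)); apply: ler_wpM2r => //; exact: (inner_psd iHc).2.
by apply: le_trans (lo_u (is_u v)); apply: ler_wpM2r => //; exact: iHu.2.
Qed.

Lemma area_all v w : v \in Ec -> w \in Ec ->
  gram2 (pull_form A Hc') v w = a * gram2 Hc v w.
Proof.
have [e1 [e2 fr]] := dim2_frame dim_c.
move=> /(frame2_comb fr)[x1 [x2 ->]] /(frame2_comb fr)[y1 [y2 ->]].
rewrite !gram2_comb ?pull_form_sym// ?iHc.1 ?iHc'.1//.
by rewrite {1}/gram2 !dotg_pull -/(gram2 _ _ _) area_c// mulrCA.
Qed.

Lemma gram2_pull_form B H v w : gram2 (pull_form B H) v w = gram2 H (v *m B) (w *m B).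
Proof. by rewrite /gram2 !dotg_pull. Qed.

Lemma assembly_area (k : R) v w : 0 <= k -> k <= a -> k <= eu ^+ 2 -> k <= ec * eu ->
  v *m Ps = 0 -> w *m Ps = 0 ->
  k * gram2 G v w <= gram2 (pull_form A G') v w.
Proof.
move=> k0 ka ku kcu vs ws.
pose Bc := pull_form Pc Hc; pose Bu := pull_form Pu Hu.
pose Bc' := pull_form Pc (pull_form A Hc'); pose Bu' := pull_form Pu (pull_form A Hu').
have pc := psd_pull Pc (inner_psd iHc); have pu := psd_pull Pu iHu.
have pc' := psd_pull Pc (psd_pull A (inner_psd iHc')).
have pu' := psd_pull Pu (psd_pull A iHu').
have e1 : gram2 G v w = gram2 (Bc + Bu) v w.
  by rewrite /gram2 /G !dotgDf !(dotg_pull Ps) vs ws !dotg0l !add0r.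
have e2 : gram2 (pull_form A G') v w = gram2 (Bc' + Bu') v w.
  by rewrite /gram2 !assembly_dot vs ws !dotg0l !add0r /Bc' /Bu' !dotgDf -!(dotg_pull Pc) -!(dotg_pull Pu).
have sum3 (x y z x' y' z' : R) : k * x <= x' -> k * y <= y' -> k * z <= z' ->
    k * (x + y + z) <= x' + y' + z' by move=> ? ? ?; rewrite !mulrDr !lerD.
rewrite e1 e2 (gram2D Bc Bu) (gram2D Bc' Bu'); apply: sum3.
- rewrite /Bc /Bc' (gram2_pull_form Pc Hc) (gram2_pull_form Pc (pull_form A Hc')) (area_all (is_c v) (is_c w)).
  by apply: (ler_wpM2r _ ka); exact: gram2_ge0 (inner_psd iHc).
- apply: (@le_trans _ _ (gram2 (eu *: Bu) v w)).
    by rewrite gram2Z; apply: ler_wpM2r => //; exact: gram2_ge0.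
  apply: gram2_le => //; first exact: psdZ.
  by move=> z; rewrite dotgZf !dotg_pull; exact: lo_u.
- apply: (@le_trans _ _ (mix2 (ec *: Bc) (eu *: Bu) v w)).
    rewrite mix2Zl (mix2C Bc (eu *: Bu)) mix2Zl mulrA (mix2C Bu Bc).
    by apply: ler_wpM2r => //; exact: mix2_ge0.
  apply: mix2_le => //; try exact: psdZ.
    by move=> z; rewrite dotgZf !dotg_pull; exact: lo_c.
  by move=> z; rewrite dotgZf !dotg_pull; exact: lo_u.
Qed.

End Assembly.

(** * Rates at a large time *)

(** Half of the smallest exponent is spent on absorbing the constants, which a
    large [T] makes possible; the other half is [eps]. *)
Lemma common_rate (R : realType) (K C1 C2 C3 l l1 l2 l3 : R) :
  0 < K -> 0 < C1 -> 0 < C2 -> 0 < C3 -> 0 < l -> 0 < l1 -> 0 < l2 -> 0 < l3 ->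
  exists eps T : R, [/\ 0 < eps, 1 <= T &
    [/\ 2 * (K * expR (- l * T)) ^+ 2 <= expR (- (2 * T * eps)),
        (C1 * expR (- l1 * T)) ^+ 2 <= expR (- (2 * T * eps)),
        (C2 * expR (- l2 * T)) ^+ 2 <= expR (- (2 * T * eps)) &
        expR (2 * T * eps) <= (C3 * expR (l3 * T)) ^+ 2]].
Proof.
move=> K0 C10 C20 C30 l0 l10 l20 l30.
pose eps := Num.min (Num.min l l1) (Num.min l2 l3) / 2.
have e0 : 0 < eps by rewrite divr_gt0// !lt_min l0 l10 l20 l30.
have [le le1 le2 le3] : [/\ 2 * eps <= l, 2 * eps <= l1, 2 * eps <= l2 & 2 * eps <= l3].
  by split; rewrite mulrC divfK// !ge_min lexx ?orbT.
pose D := 2 * K + C1 + C2 + C3^-1.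
have C3' : 0 < C3^-1 by rewrite invr_gt0.
pose T := 1 + D / eps.
have D0 : 0 < D by rewrite !addr_gt0// mulr_gt0.
have T1 : 1 <= T by rewrite lerDl divr_ge0 ?ltW.
have TD : D <= expR (eps * T).
  apply: le_trans (expR_ge1Dx _); rewrite mulrDr mulr1 mulrC divfK ?gt_eqF//.
  by lra.
have b (c k : R) : 0 < c -> c <= D -> 2 * eps <= k -> c * expR (- k * T) <= expR (- (T * eps)).
  move=> c0 cD ck; apply: (@le_trans _ _ (expR (eps * T) * expR (- k * T))).
    by apply: ler_wpM2r; [exact: expR_ge0|exact: le_trans TD].
  rewrite -expRD ler_expR; have : 0 <= (k - 2 * eps) * T by rewrite mulr_ge0 ?subr_ge0//; lra.
  by lra.
have sq (c : R) : 0 <= c -> c <= expR (- (T * eps)) -> c ^+ 2 <= expR (- (2 * T * eps)).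
  move=> c0 h; have -> : - (2 * T * eps) = - (T * eps) + - (T * eps) by ring.
  by rewrite expRD -expr2 ler_pXn2r ?nnegrE ?expR_ge0.
exists eps, T; split=> //; split.
- apply: (@le_trans _ _ ((2 * K * expR (- l * T)) ^+ 2)).
    have : 0 <= (K * expR (- l * T)) ^+ 2 by exact: sqr_ge0.
    by rewrite !exprMn; lra.
  by apply: sq; [rewrite !mulr_ge0 ?expR_ge0// ltW|apply: b => //; rewrite /D; lra].
- by apply: sq; [rewrite !mulr_ge0 ?expR_ge0// ltW|apply: b => //; rewrite /D; lra].
- by apply: sq; [rewrite !mulr_ge0 ?expR_ge0// ltW|apply: b => //; rewrite /D; lra].
- have h := b C3^-1 l3 C3' _ le3.
  have {}h : expR (T * eps) <= C3 * expR (l3 * T).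
    have {}h : C3^-1 * expR (- l3 * T) <= expR (- (T * eps)) by apply: h; rewrite /D; lra.
    rewrite -[leLHS]invrK -[leRHS]invrK lef_pV2 ?posrE ?invr_gt0 ?mulr_gt0 ?expR_gt0//.
    by rewrite invfM -!expRN -mulNr.
  have -> : 2 * T * eps = T * eps + T * eps by ring.
  rewrite expRD -expr2 ler_pXn2r ?nnegrE ?expR_ge0//.
  by rewrite mulr_ge0 ?expR_ge0// ltW.
Qed.

Section Rates.
Context {R : realType} {m : nat} {M : topologicalType}.
Variable S : smooth_manifold R m M.
Variables (X : M -> 'rV[R]_m) (phi : R -> M -> M) (Gamma : set M).
Hypothesis flow : is_flow S X phi.
Hypothesis cptM : compact [set: M].
Variable g0 : M -> 'M[R]_m.
Hypothesis ig : forall x, inner_product (g0 x).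
Local Notation V := 'rV[R]_m.
Local Notation DX := (flow_diff S X phi).
Local Notation Q := (pulled S X phi g0).
Implicit Types (x y : M) (r s t c : R) (u v w : V) (E F : M -> {vspace V}).

Lemma normDX_sq E x t v c : v \in E x -> normDX S X phi g0 t x E <= c ->
  dotg (Q t x) v v <= c ^+ 2 * dotg (g0 x) v v.
Proof.
move=> vE le.
have h := opnorm_sq (ig x) (inner_psd (ig (phi t x))) vE le.
by apply: le_trans h; rewrite le_eqVlt; apply/orP; left; apply/eqP; exact: dotg_pulled.
Qed.

Lemma normDX_mul_sq E F x t v w c : 0 <= t -> v \in E x -> w \in F x ->
  w *m DX t x \in F (phi t x) ->
  normDX S X phi g0 t x E * normDX S X phi g0 (- t) (phi t x) F <= c ->
  dotg (Q t x) v v * dotg (g0 x) w w <= c ^+ 2 * (dotg (g0 x) v v * dotg (Q t x) w w).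
Proof.
move=> t0 vE wF wF' le.
have h := opnorm_sq2 (ig x) (inner_psd (ig (phi t x))) vE (ig (phi t x))
  (inner_psd (ig (phi (- t) (phi t x)))) wF' le.
have e0 : w *m DX t x *m DX (- t) (phi t x) = w.
  by rewrite -mulmxA (flow_diff_back flow cptM x t0) mulmx1.
have e1 : phi (- t) (phi t x) = x by exact: (flow_back flow x t0).
have eN y u : y = x -> u = w -> dotg (g0 y) u u = dotg (g0 x) w w by move=> -> ->.
have e2 := eN _ _ e1 e0.
have e3 : dotg (Q t x) v v = dotg (g0 (phi t x)) (v *m DX t x) (v *m DX t x).
  exact: dotg_pulled.
have e4 : dotg (Q t x) w w = dotg (g0 (phi t x)) (w *m DX t x) (w *m DX t x).
  exact: dotg_pulled.
have alg (p p' q q' n r r' k : R) : p' * q' <= k * (n * r') -> q' = q -> p = p' -> r = r' ->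
   p * q <= k * (n * r) by move=> hh <- -> ->.
exact: alg h e2 e3 e4.
Qed.

Lemma normDXV_sq E x t v c : 0 <= t -> v \in E x -> normDXV S X phi g0 t x E <= c ->
  dotg (g0 x) v v <= c ^+ 2 * dotg (Q t x) v v.
Proof.
move=> t0 vE le.
have h := opnorm_sq (ig (phi t x)) (inner_psd (ig x)) (push_mem (DX t x) vE) le.
have e0 : v *m DX t x *m invmx (DX t x) = v by exact: mulmxK (flow_diff_unit flow cptM x t0) _.
have e3 : dotg (Q t x) v v = dotg (g0 (phi t x)) (v *m DX t x) (v *m DX t x).
  exact: dotg_pulled.
have alg (u : V) (q q' k : R) : dotg (g0 x) u u <= k * q' -> u = v -> q = q' ->
    dotg (g0 x) v v <= k * q by move=> hh <- ->.
exact: alg h e0 e3.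
Qed.

Lemma detDX_sq E x t c : subbundle S Gamma 2 E -> Gamma x -> 0 <= t -> 0 <= c ->
  c <= detDX S X phi g0 t x (E x) -> c ^+ 2 <= area_growth S X phi g0 E t x.
Proof.
move=> subE Gx t0 c0 le; have fr := frame_fst_snd subE Gx.
have [d0 e] := absdetP (ig x) (ig (phi t x)) (flow_diff_unit flow cptM x t0) fr.
have k := area_growthP flow cptM ig subE Gx t0 fr.
have g0' := gram2_gt0 (inner_pos_def_on (E x) (ig x)) fr.
have alg (d a b q k2 : R) : 0 < a -> 0 <= d -> c <= d -> d ^+ 2 * a = q -> q = k2 * a ->
    c ^+ 2 <= k2.
  move=> a0 d0' cd <- /(mulIf (lt0r_neq0 a0)) <-.
  by rewrite ler_pXn2r ?nnegrE.
exact: (alg _ _ 0 _ _ g0' d0 le e k).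
Qed.

Variables Es Ec Eu : M -> {vspace V}.
Hypothesis subC : subbundle S Gamma 2 Ec.
Hypothesis invC : invariant_bundle S X phi Gamma Ec.
Hypothesis invU : invariant_bundle S X phi Gamma Eu.

Lemma hs_growth_dominates T x v (c : R) : 0 <= T -> Gamma x -> 0 <= c ->
  (forall w, w \in Ec x -> dotg (Q T x) v v * dotg (g0 x) w w <=
     c * (dotg (g0 x) v v * dotg (Q T x) w w)) ->
  hs_growth S X phi g0 Ec T x * dotg (Q T x) v v <=
    2 * c * area_growth S X phi g0 Ec T x * dotg (g0 x) v v.
Proof.
move=> T0 Gx c0 le; have [->|v0] := eqVneq v 0.
  have z1 : dotg (Q T x) 0 0 = 0 by exact: dotg0l.
  have z2 : dotg (g0 x) 0 0 = 0 by exact: dotg0l.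
  by rewrite z1 z2 !mulr0.
have iQ : inner_product (Q T x) by exact: (pulled_inner flow cptM ig).
have q0 : 0 < dotg (Q T x) v v by exact: iQ.2.
have h w : w \in Ec x ->
    dotg (g0 x) w w <= c * dotg (g0 x) v v / dotg (Q T x) v v * dotg (Q T x) w w.
  move=> /le {}le; have alg (q n n' p : R) : 0 < q -> q * n <= c * (n' * p) -> n <= c * n' / q * p.
    by move=> n0' hh; rewrite mulrAC ler_pdivlMr// mulrC -mulrA.
  exact: alg q0 le.
have := hs_growth_le_area flow cptM ig subC Gx T0 h.
have alg (hs n q k : R) : 0 < q -> hs <= 2 * (c * n / q) * k -> hs * q <= 2 * c * k * n.
  move=> n0'; rewrite -(ler_pM2r n0') => /le_trans; apply; rewrite le_eqVlt; apply/orP; left.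
  by apply/eqP; field; rewrite gt_eqF.
exact: alg.
Qed.

Lemma hs_growth_dominated T x z (c : R) : 0 <= T -> Gamma x -> 0 <= c ->
  (forall w, w \in Ec x -> dotg (Q T x) w w * dotg (g0 x) z z <=
     c * (dotg (g0 x) w w * dotg (Q T x) z z)) ->
  hs_growth S X phi g0 Ec T x * dotg (g0 x) z z <= 2 * c * dotg (Q T x) z z.
Proof.
move=> T0 Gx c0 le; have [->|v0] := eqVneq z 0.
  have z1 : dotg (Q T x) 0 0 = 0 by exact: dotg0l.
  have z2 : dotg (g0 x) 0 0 = 0 by exact: dotg0l.
  by rewrite z1 z2 !mulr0.
have n0 : 0 < dotg (g0 x) z z by exact: (ig x).2.
have h w : w \in Ec x ->
    dotg (Q T x) w w <= c * dotg (Q T x) z z / dotg (g0 x) z z * dotg (g0 x) w w.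
  move=> /le {}le; have alg (n q q' p : R) : 0 < n -> q * n <= c * (p * q') -> q <= c * q' / n * p.
    by move=> n0' hh; rewrite mulrAC ler_pdivlMr// -mulrA [q' * p]mulrC.
  exact: alg n0 le.
have := hs_growth_le flow cptM ig subC Gx T0 h.
have alg (hs n q : R) : 0 < n -> hs <= 2 * (c * q / n) -> hs * n <= 2 * c * q.
  move=> n0'; rewrite -(ler_pM2r n0') => /le_trans; apply; rewrite le_eqVlt; apply/orP; left.
  by apply/eqP; field; rewrite gt_eqF.
exact: alg.
Qed.

(** Domination, stated with operator norms on [Ec], is turned into a bound on
    the Hilbert-Schmidt norm; the factor 2 lost there is the one in the first
    conclusion of [common_rate]. *)
Lemma rates : dominated_splitting S X phi g0 Gamma Es Ec Eu ->
  uniformly_contracted S X phi g0 Gamma Es ->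
  area_expanding S X phi g0 Gamma Ec ->
  uniformly_expanded S X phi g0 Gamma Eu ->
  exists eps T : R, [/\ 0 < eps, 1 <= T & forall x, Gamma x ->
   [/\ forall v, v \in Es x ->
         dotg (Q T x) v v <= expR (- (2 * T * eps)) * dotg (g0 x) v v /\
         hs_growth S X phi g0 Ec T x * dotg (Q T x) v v <=
           expR (- (2 * T * eps)) * area_growth S X phi g0 Ec T x * dotg (g0 x) v v,
       forall z, z \in Eu x ->
         dotg (g0 x) z z <= expR (- (2 * T * eps)) * dotg (Q T x) z z /\
         hs_growth S X phi g0 Ec T x * dotg (g0 x) z z <=
           expR (- (2 * T * eps)) * dotg (Q T x) z z &
       expR (2 * T * eps) <= area_growth S X phi g0 Ec T x]].
Proof.
move=> [K [l [K0 l0 dom]]] [C1 [l1 [C10 l10 con]]] [C3 [l3 [C30 l30 are]]] [C2 [l2 [C20 l20 ex]]].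
have [eps [T [e0 T1 [b b1 b2 b3]]]] := common_rate K0 C10 C20 C30 l0 l10 l20 l30.
have T0 : 0 < T by lra.
have T0' := ltW T0.
exists eps, T; split=> // x Gx; have [d1 d2] := dom x T Gx T0.
have [nK n1 n2] : [/\ forall v, 0 <= dotg (g0 x) v v, forall v, 0 <= dotg (Q T x) v v &
    0 <= (K * expR (- l * T)) ^+ 2].
  split; last exact: sqr_ge0.
    by move=> v; exact: (inner_psd (ig x)).2.
  by move=> v; exact: (inner_psd (pulled_inner flow cptM ig x T0')).2.
have mono (a b' h n : R) : 0 <= n -> a <= b' -> h <= a * n -> h <= b' * n.
  by move=> n0 ab hh; apply: le_trans hh _; exact: ler_wpM2r.
split.
- move=> v vE; split.
    exact: mono (nK v) b1 (normDX_sq vE (con x T Gx T0')).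
  have h : hs_growth S X phi g0 Ec T x * dotg (Q T x) v v <= 2 * (K * expR (- l * T)) ^+ 2 *
      area_growth S X phi g0 Ec T x * dotg (g0 x) v v.
    apply: hs_growth_dominates => // w wE.
    apply: (@normDX_mul_sq Es Ec x T v w _ T0' vE wE _ (ltW d1)).
    by rewrite -(invC T Gx); exact: push_mem.
  have k0 : 0 <= area_growth S X phi g0 Ec T x by exact: (ltW (area_growth_gt0 flow cptM ig subC Gx T0')).
  have alg (a b' k n hh : R) : 0 <= k -> 0 <= n -> a <= b' -> hh <= a * k * n -> hh <= b' * k * n.
    by move=> k0' n0' ab /le_trans; apply; rewrite -!mulrA ler_wpM2r// mulr_ge0.
  exact: alg k0 (nK v) b h.
- move=> z zE; split.
    exact: mono (n1 z) b2 (normDXV_sq T0' zE (ex x T Gx T0)).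
  have h : hs_growth S X phi g0 Ec T x * dotg (g0 x) z z <= 2 * (K * expR (- l * T)) ^+ 2 * dotg (Q T x) z z.
    apply: hs_growth_dominated => // w wE.
    apply: (@normDX_mul_sq Ec Eu x T w z _ T0' wE zE _ (ltW d2)).
    by rewrite -(invU T Gx); exact: push_mem.
  exact: mono (n1 z) b h.
- have c0 : 0 <= C3 * expR (l3 * T) by rewrite mulr_ge0 ?expR_ge0// ltW.
  exact: le_trans b3 (detDX_sq subC Gx T0' c0 (ltW (are x T Gx T0))).
Qed.

End Rates.

(** * Complements of a splitting and one-sided growth *)

Section Complements.
Context {R : realType} {m : nat} {M : topologicalType}.
Variable Gamma : set M.
Local Notation V := 'rV[R]_m.
Implicit Types (x y : M) (v : V) (p q : M -> R) (E F : M -> {vspace V}).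

Lemma cont_fun_max p q : cont_fun Gamma p -> cont_fun Gamma q ->
  cont_fun Gamma (fun x => Num.max (p x) (q x)).
Proof.
move=> cp cq x Gx.
have e : (fun y => Num.max (p y) (q y)) = (fun y => 2^-1 * (p y + q y + `|p y - q y|)).
  by apply/funext => y; rewrite maxr_absE mulrC.
rewrite e; have -> : Num.max (p x) (q x) = 2^-1 * (p x + q x + `|p x - q x|).
  by rewrite maxr_absE mulrC.
apply: cvgM; first exact: cvg_cst.
have h1 : p y @[y --> within Gamma (nbhs x)] --> p x := cp x Gx.
have h2 : q y @[y --> within Gamma (nbhs x)] --> q x := cq x Gx.
by apply: cvgD; [exact: cvgD|apply: cvg_norm; exact: cvgB].
Qed.

Lemma cont_fun_min p q : cont_fun Gamma p -> cont_fun Gamma q ->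
  cont_fun Gamma (fun x => Num.min (p x) (q x)).
Proof.
move=> cp cq x Gx.
have e : (fun y => Num.min (p y) (q y)) = (fun y => 2^-1 * (p y + q y - `|p y - q y|)).
  by apply/funext => y; rewrite minr_absE mulrC.
rewrite e; have -> : Num.min (p x) (q x) = 2^-1 * (p x + q x - `|p x - q x|).
  by rewrite minr_absE mulrC.
apply: cvgM; first exact: cvg_cst.
have h1 : p y @[y --> within Gamma (nbhs x)] --> p x := cp x Gx.
have h2 : q y @[y --> within Gamma (nbhs x)] --> q x := cq x Gx.
by apply: cvgB; [exact: cvgD|apply: cvg_norm; exact: cvgB].
Qed.

Lemma proj_intertwine E F (A : 'M[R]_m) x y : complementary Gamma E F ->
  Gamma x -> Gamma y ->
  (forall v, v \in E x -> v *m A \in E y) -> (forall v, v \in F x -> v *m A \in F y) ->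
  proj E F x *m A = A *m proj E F y.
Proof.
move=> EF Gx Gy AE AF; apply/row_matrixP => i; rewrite !rowE !mulmxA.
move: (delta_mx 0 i : V) => v; have [_ full] := EF x Gx.
have /memv_addP[a aE [b bF ->]] : v \in (E x + F x)%VS by rewrite full memvf.
by rewrite !mulmxDl (proj_id EF Gx aE) (proj_ker EF Gx bF) (proj_id EF Gy (AE a aE))
   (proj_ker EF Gy (AF b bF)) mul0mx.
Qed.

Lemma vspace_exchange (A B C : {vspace V}) : (A :&: B)%VS = 0%VS ->
  ((A + B) :&: C)%VS = 0%VS -> (A :&: (B + C))%VS = 0%VS.
Proof.
move=> AB ABC; apply/eqP; rewrite -subv0; apply/subvP => v.
rewrite memv_cap => /andP[vA /memv_addP[b bB [c cC e]]].
have cAB : c \in (A + B)%VS.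
  have -> : c = v - b by rewrite e addrC addKr.
  by rewrite memvB//; [exact: (subvP (addvSl A B))|exact: (subvP (addvSr A B))].
have c0 : c = 0.
  by apply/eqP; rewrite -memv0 -ABC memv_cap cAB.
by rewrite -AB memv_cap vA e c0 addr0.
Qed.

Lemma splitting_complementary (Es Ec Eu : M -> {vspace V}) : splitting Gamma Es Ec Eu ->
  [/\ complementary Gamma Es (fun x => (Ec x + Eu x)%VS),
      complementary Gamma Ec (fun x => (Es x + Eu x)%VS) &
      complementary Gamma Eu (fun x => (Es x + Ec x)%VS)].
Proof.
move=> sp.
have dir x : Gamma x -> (Es x :&: Ec x)%VS = 0%VS /\ ((Es x + Ec x) :&: Eu x)%VS = 0%VS.
  move=> Gx; have [_] := sp x Gx.
  rewrite directv_addE => /and3P[+ _ /eqP h2].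
  by rewrite directv_addE => /and3P[_ _ /eqP h1].
split=> x Gx; have [full _] := sp x Gx; have [d1 d2] := dir x Gx; split.
- exact: vspace_exchange.
- by rewrite addvA.
- by apply: vspace_exchange; [rewrite capvC|rewrite [(Ec x + Es x)%VS]addvC].
- by rewrite addvA [(Ec x + Es x)%VS]addvC.
- by rewrite capvC.
- by rewrite addvC.
Qed.

End Complements.

Lemma Int_le_shift (R : realType) (f g : R -> R) (c a b : R) :
  continuous f -> continuous g -> a <= b ->
  (forall s, a <= s <= b -> f s + c <= g s) -> Int f a b + c * (b - a) <= Int g a b.
Proof.
move=> cf cg ab le; have cc : continuous (fun _ : R => c) by move=> ?; exact: cvg_cst.
rewrite -(Int_cst c ab) -IntD//; apply: Int_le => //.
by move=> s; apply: (@continuousD R R R f (fun=> c)); [exact: cf|exact: cc].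
Qed.

Lemma exp_ln (R : realType) (T C n q b : R) : 0 < T -> 0 < C -> 0 <= n -> q <= C * n ->
  q <= expR (2 * T * Num.max b (ln C / (2 * T))) * n.
Proof.
move=> T0 C0 n0 qn; have T2 : 0 < 2 * T by rewrite mulr_gt0.
apply: le_trans qn _; apply: ler_wpM2r => //.
rewrite -{1}(lnK C0) ler_expR mulrC -ler_pdivrMr// le_max lexx orbT//.
Qed.

Lemma exp_lnV (R : realType) (T C n q b : R) : 0 < T -> 0 < C -> 0 <= n -> n <= C * q ->
  expR (2 * T * Num.min b (- (ln C / (2 * T)))) * n <= q.
Proof.
move=> T0 C0 n0 nq; have T2 : 0 < 2 * T by rewrite mulr_gt0.
apply: (@le_trans _ _ (C^-1 * n)); last by rewrite mulrC ler_pdivrMr// mulrC.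
apply: ler_wpM2r => //; rewrite -{2}(lnK C0) -expRN ler_expR.
by rewrite mulrC -ler_pdivlMr// ge_min mulNr lexx orbT.
Qed.

Section OneSided.
Context {R : realType} {m : nat} {M : topologicalType}.
Variable S : smooth_manifold R m M.
Variables (X : M -> 'rV[R]_m) (phi : R -> M -> M) (Gamma : set M).
Hypothesis flow : is_flow S X phi.
Hypothesis cptM : compact [set: M].
Hypothesis cptG : compact Gamma.
Hypothesis inv : forall (t : R) (x : M), 0 <= t -> Gamma x -> Gamma (phi t x).
Variable g0 : M -> 'M[R]_m.
Hypothesis ig : forall x, inner_product (g0 x).
Hypothesis cg : cont_form S Gamma g0.
Local Notation V := 'rV[R]_m.
Local Notation DX := (flow_diff S X phi).
Local Notation Q := (pulled S X phi g0).
Variable E : M -> {vspace V}.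
Hypothesis invE : forall (t : R) (x : M) (v : 'rV[R]_m),
  0 <= t -> Gamma x -> v \in E x -> v *m DX t x \in E (phi t x).
Implicit Types (x y : M) (r s t : R) (u v w : V).

(** Averaging needs bounds on both sides; the missing lower rate can be taken
    as low as compactness demands, because it does not enter the upper bound.
    *)
Lemma adapted_upper (p : M -> R) (T d : R) : cont_fun Gamma p -> 1 <= T -> 0 < d ->
  (forall x v, Gamma x -> v \in E x ->
     dotg (Q T x) v v <= expR (2 * T * p x) * dotg (g0 x) v v) ->
  exists tau0 : R, forall tau, tau0 <= tau -> 1 <= tau -> exists H : M -> 'M[R]_m,
  [/\ cont_form S Gamma H, forall x, Gamma x -> inner_product (H x) &
   forall x v t, Gamma x -> v \in E x -> 0 <= t ->
     dotg (H (phi t x)) (v *m DX t x) (v *m DX t x) <=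
       expR (2 * Int (along phi p x) tau (t + tau) + 4 * d * t) * dotg (H x) v v].
Proof.
move=> cp T1 d0 up; have T0 : 0 < T by exact: lt_le_trans T1.
have pos x r : Gamma x -> 0 <= r -> inner_product (Q r x).
  by move=> _ r0; exact: (pulled_inner flow cptM ig).
have fQ : cont_flow_form S Gamma Q by exact: cont_flow_form_pulled.
have fg : cont_flow_form S Gamma (fun=> g0) by exact: cont_flow_form_cst.
have [C C1 hC] := flow_compare cptG T fg fQ pos.
have C0 : 0 < C by exact: lt_le_trans C1.
pose q x := Num.min (p x) (- (ln C / (2 * T))).
have cq : cont_fun Gamma q by apply: cont_fun_min => // x Gx; exact: cvg_cst.
have qp x : Gamma x -> q x <= p x by move=> _; rewrite ge_min lexx.
have two x v : Gamma x -> v \in E x -> expR (2 * T * q x) * dotg (g0 x) v v <=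
    dotg (Q T x) v v <= expR (2 * T * p x) * dotg (g0 x) v v.
  move=> Gx vE; rewrite (up x v Gx vE) andbT.
  have TT : 0 <= T <= T by rewrite lexx ltW.
  have N0 : 0 <= dotg (g0 x) v v by exact: (inner_psd (ig x)).2.
  exact: exp_lnV T0 C0 N0 (hC x T v Gx TT).
have [tau0 H] := adapted_growth flow cptM cptG inv ig cg invE cp cq T1 d0 qp two.
exists tau0 => tau h1 tau1.
have tau0' : 0 < tau by exact: lt_le_trans tau1.
exists (adapted S X phi g0 p q d tau); split.
- exact: (adapted_cont_form flow cptM inv cg cp cq tau0').
- by move=> x Gx; exact: (adapted_inner flow cptM inv ig cg d cp cq tau0' Gx).
- by move=> x v t Gx vE t0; have [_] := H tau h1 tau1 x v t Gx vE t0.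
Qed.

(** As in [adapted_upper], with a constant upper rate given by compactness. *)
Lemma adapted_lower (q : M -> R) (T d : R) : cont_fun Gamma q -> 1 <= T -> 0 < d ->
  (forall x v, Gamma x -> v \in E x ->
     expR (2 * T * q x) * dotg (g0 x) v v <= dotg (Q T x) v v) ->
  exists tau0 : R, forall tau, tau0 <= tau -> 1 <= tau -> exists H : M -> 'M[R]_m,
  [/\ cont_form S Gamma H, forall x, Gamma x -> inner_product (H x) &
   forall x v t, Gamma x -> v \in E x -> 0 <= t ->
     expR (2 * Int (along phi q x) tau (t + tau) - 4 * d * t) * dotg (H x) v v <=
       dotg (H (phi t x)) (v *m DX t x) (v *m DX t x)].
Proof.
move=> cq T1 d0 lo; have T0 : 0 < T by exact: lt_le_trans T1.
have pos x r : Gamma x -> 0 <= r -> inner_product (g0 x) by [].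
have fQ : cont_flow_form S Gamma Q by exact: cont_flow_form_pulled.
have fg : cont_flow_form S Gamma (fun=> g0) by exact: cont_flow_form_cst.
have [C C1 hC] := flow_compare cptG T fQ fg pos.
have C0 : 0 < C by exact: lt_le_trans C1.
pose p x := Num.max (q x) (ln C / (2 * T)).
have cp : cont_fun Gamma p by apply: cont_fun_max => // x Gx; exact: cvg_cst.
have qp x : Gamma x -> q x <= p x by move=> _; rewrite le_max lexx.
have two x v : Gamma x -> v \in E x -> expR (2 * T * q x) * dotg (g0 x) v v <=
    dotg (Q T x) v v <= expR (2 * T * p x) * dotg (g0 x) v v.
  move=> Gx vE; rewrite (lo x v Gx vE) /=.
  have TT : 0 <= T <= T by rewrite lexx ltW.
  have N0 : 0 <= dotg (g0 x) v v by exact: (inner_psd (ig x)).2.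
  exact: exp_ln T0 C0 N0 (hC x T v Gx TT).
have [tau0 H] := adapted_growth flow cptM cptG inv ig cg invE cp cq T1 d0 qp two.
exists tau0 => tau h1 tau1.
have tau0' : 0 < tau by exact: lt_le_trans tau1.
exists (adapted S X phi g0 p q d tau); split.
- exact: (adapted_cont_form flow cptM inv cg cp cq tau0').
- by move=> x Gx; exact: (adapted_inner flow cptM inv ig cg d cp cq tau0' Gx).
- by move=> x v t Gx vE t0; have [] := H tau h1 tau1 x v t Gx vE t0.
Qed.

End OneSided.

(** * Sectional expansion for an orthogonal sum *)

Section Sectional.
Context {R : realType} {m : nat}.
Local Notation V := 'rV[R]_m.
Implicit Types (G H A P : 'M[R]_m) (u v w : V) (U : {vspace V}).

Lemma assembly_inner (Ps Pc Pu Hs Hc Hu : 'M[R]_m) :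
  (forall v, v = v *m Ps + v *m Pc + v *m Pu) ->
  inner_product Hs -> inner_product Hc -> inner_product Hu ->
  inner_product (pull_form Ps Hs + pull_form Pc Hc + pull_form Pu Hu).
Proof.
move=> dec is_ ic iu; split.
  by rewrite !linearD/= !pull_form_sym//; [exact: iu.1|exact: ic.1|exact: is_.1].
move=> v v0; rewrite !dotgDf !dotg_pull.
have n0 H z : inner_product H -> 0 <= dotg H z z by move=> iH; exact: (inner_psd iH).2.
have ns := n0 _ (v *m Ps) is_; have nc := n0 _ (v *m Pc) ic; have nu := n0 _ (v *m Pu) iu.
have [vs|vs] := eqVneq (v *m Ps) 0; last first.
  by have := is_.2 _ vs; move: ns nc nu; lra.
have [vc|vc] := eqVneq (v *m Pc) 0; last first.
  by have := ic.2 _ vc; move: ns nc nu; lra.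
have vu : v *m Pu != 0 by move: v0; rewrite {1}(dec v) vs vc !add0r.
by have := iu.2 _ vu; move: ns nc nu; lra.
Qed.

(** The bounds are stated for exponents of lengths, so [lam] stands for the
    final rate multiplied by the elapsed time. On [Ec + Eu] the norm of the
    inverse is governed by the slower of the two blocks. *)
Lemma assembly_sectional (A Ps Pc Pu Ps' Pc' Pu' Hs Hc Hu Hs' Hc' Hu' : 'M[R]_m)
    (Es Ec Eu : {vspace V}) (lam sg cc uu aa : R) :
  let G := pull_form Ps Hs + pull_form Pc Hc + pull_form Pu Hu in
  let G' := pull_form Ps' Hs' + pull_form Pc' Hc' + pull_form Pu' Hu' in
  A \in unitmx ->
  [/\ Ps *m A = A *m Ps', Pc *m A = A *m Pc' & Pu *m A = A *m Pu'] ->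
  [/\ forall v, v *m Ps \in Es, forall v, v *m Pc \in Ec & forall v, v *m Pu \in Eu] ->
  [/\ inner_product Hs, inner_product Hc & inner_product Hu] ->
  [/\ inner_product Hs', inner_product Hc' & inner_product Hu'] ->
  inner_product G -> inner_product G' ->
  (forall v, v \in Es -> v *m Pc = 0 /\ v *m Pu = 0) ->
  (forall v, v \in (Ec + Eu)%VS -> v *m Ps = 0) -> \dim Ec = 2%N ->
  (forall v, v \in Es -> dotg Hs' (v *m A) (v *m A) <= expR (2 * sg) * dotg Hs v v) ->
  (forall v, v \in Ec -> expR (2 * cc) * dotg Hc v v <= dotg Hc' (v *m A) (v *m A)) ->
  (forall v, v \in Eu -> expR (2 * uu) * dotg Hu v v <= dotg Hu' (v *m A) (v *m A)) ->
  (forall v w, frame2 Ec v w ->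
    gram2 Hc' (v *m A) (w *m A) = expR (2 * aa) * gram2 Hc v w) ->
  [/\ sg <= - lam, sg - cc <= - lam & sg - uu <= - lam] ->
  [/\ lam <= aa, lam <= 2 * uu & lam <= cc + uu] ->
  [/\ opnorm G G' A Es * opnorm G' G (invmx A) (push A (Ec + Eu)) <= expR (- lam),
      opnorm G G' A Es <= expR (- lam) &
      forall L : {vspace V}, (L <= Ec + Eu)%VS -> \dim L = 2%N ->
        expR lam <= absdet G G' A L].
Proof.
move=> G G' uA [js jc ju] [ms mc mu] [is_ ic iu] [is' ic' iu'] iG iG' kerE kerF dimC
  ups loc lou area [l1 l2 l3] [l4 l5 l6].
have [ps pu ps' pu'] : [/\ psd Hs, psd Hu, psd Hs' & psd Hu'] by split; exact: inner_psd.
have pG := inner_psd iG; have pG' := inner_psd iG'.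
have sq (z : R) : expR z ^+ 2 = expR (2 * z).
  by rewrite expr2 -expRD; congr expR; ring.
have nE : opnorm G G' A Es <= expR sg.
  apply: (opnorm_le_sq pG pG' (expR_ge0 _)) => v vE.
  have [vc vu] := kerE v vE.
  by rewrite sq; exact: (assembly_upper Hc Hu Hc' Hu' js jc ju ms ups vc vu).
have nF : opnorm G' G (invmx A) (push A (Ec + Eu)) <= expR (- Num.min cc uu).
  apply: (opnorm_le_sq pG' pG (expR_ge0 _)) => z /push_memP[v vF ->].
  have h : expR (2 * Num.min cc uu) * dotg G v v <= dotg G' (v *m A) (v *m A).
    apply: (assembly_lower Hs Hs' js jc ju mc mu ic pu loc lou _ _ _ (kerF v vF)).
    - exact: expR_ge0.
    - by rewrite ler_expR ler_pM2l// ge_min lexx.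
    - by rewrite ler_expR ler_pM2l// ge_min lexx orbT.
  by rewrite mulmxK// sq mulrN expRN mulrC ler_pdivlMr ?expR_gt0// mulrC.
split.
- apply: le_trans (ler_pM (opnorm_ge0 _ _ _ _) (opnorm_ge0 _ _ _ _) nE nF) _.
  rewrite -expRD ler_expR; case: (leP cc uu) => _; lra.
- by apply: le_trans nE _; rewrite ler_expR.
- move=> L LF dL; have [v [w fr]] := dim2_frame dL.
  have vF := subvP LF _ (frame2_meml fr); have wF := subvP LF _ (frame2_memr fr).
  have [d0 e] := absdetP iG iG' uA fr.
  have g0 := gram2_gt0 (inner_pos_def_on L iG) fr.
  have h : expR (2 * lam) * gram2 G v w <= gram2 (pull_form A G') v w.
    apply: (assembly_area Hs Hs' js jc ju mc mu ic pu ic' pu' (expR_ge0 _) (expR_ge0 _) loc lou area dimC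
      _ _ _ _ (kerF v vF) (kerF w wF)).
    - exact: expR_ge0.
    - by rewrite ler_expR ler_pM2l.
    - by rewrite sq ler_expR; lra.
    - by rewrite -expRD ler_expR; lra.
  move: h; rewrite -e ler_pM2r// -sq => h.
  by rewrite -(@ler_pXn2r _ 2) ?nnegrE ?expR_ge0.
Qed.

End Sectional.

(** * The assembled metric along an orbit *)

Section AdaptedMetric.
Context {R : realType} {m : nat} {M : topologicalType}.
Variable S : smooth_manifold R m M.
Variables (X : M -> 'rV[R]_m) (phi : R -> M -> M) (Gamma : set M).
Hypothesis flow : is_flow S X phi.
Hypothesis cptM : compact [set: M].
Hypothesis cptG : compact Gamma.
Hypothesis inv : forall (t : R) (x : M), 0 <= t -> Gamma x -> Gamma (phi t x).
Local Notation V := 'rV[R]_m.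
Local Notation DX := (flow_diff S X phi).
Variables (Es Ec Eu : M -> {vspace V}) (ds du : nat).
Hypotheses (subS : subbundle S Gamma ds Es) (subC : subbundle S Gamma 2 Ec)
  (subU : subbundle S Gamma du Eu).
Hypothesis spl : splitting Gamma Es Ec Eu.
Hypotheses (invS : forall (t : R) (x : M) (v : V), 0 <= t -> Gamma x -> v \in Es x ->
    v *m DX t x \in Es (phi t x))
  (invC : forall (t : R) (x : M) (v : V), 0 <= t -> Gamma x -> v \in Ec x ->
    v *m DX t x \in Ec (phi t x))
  (invU : forall (t : R) (x : M) (v : V), 0 <= t -> Gamma x -> v \in Eu x ->
    v *m DX t x \in Eu (phi t x)).
Implicit Types (x y : M) (r s t : R) (u v w : V).

Lemma add_inv (E F : M -> {vspace V}) :
  (forall t x v, 0 <= t -> Gamma x -> v \in E x -> v *m DX t x \in E (phi t x)) ->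
  (forall t x v, 0 <= t -> Gamma x -> v \in F x -> v *m DX t x \in F (phi t x)) ->
  forall t x v, 0 <= t -> Gamma x -> v \in (E x + F x)%VS ->
    v *m DX t x \in (E (phi t x) + F (phi t x))%VS.
Proof.
move=> hE hF t x v t0 Gx /memv_addP[a aE [b bF ->]]; rewrite mulmxDl.
by apply/memv_addP; exists (a *m DX t x);
  [exact: hE|exists (b *m DX t x) => //; exact: hF].
Qed.

Let F x := (Ec x + Eu x)%VS.
Let Ps := proj Es F.
Let Pc := proj Ec (fun x => (Es x + Eu x)%VS).
Let Pu := proj Eu (fun x => (Es x + Ec x)%VS).

(** The orthogonal sum of the blocks: each form only sees the component of a
    vector in its own bundle. *)
Definition assembled (Hs Hc Hu : M -> 'M[R]_m) x :=
  pull_form (Ps x) (Hs x) + pull_form (Pc x) (Hc x) + pull_form (Pu x) (Hu x).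

Lemma assembled_cont_form (Hs Hc Hu : M -> 'M[R]_m) :
  cont_form S Gamma Hs -> cont_form S Gamma Hc -> cont_form S Gamma Hu ->
  cont_form S Gamma (assembled Hs Hc Hu).
Proof.
move=> hs hc hu; have [cs cc cu] := splitting_complementary spl.
have dis (E1 E2 E3 : M -> {vspace V}) : complementary Gamma E1 (fun x => (E2 x + E3 x)%VS) ->
    (forall x, Gamma x -> (E1 x :&: E2 x)%VS = 0%VS) /\ (forall x, Gamma x -> (E1 x :&: E3 x)%VS = 0%VS).
  move=> c; split=> x Gx; have [d _] := c x Gx; apply/eqP; rewrite -subv0 -d.
    by apply: capvS => //; exact: addvSl.
  by apply: capvS => //; exact: addvSr.
have [dsc dsu] := dis _ _ _ cs; have [_ dcu] := dis _ _ _ cc.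
apply: cont_formD; first apply: cont_formD.
- exact: (cont_form_proj cs subS (subbundle_add dcu subC subU) hs).
- exact: (cont_form_proj cc subC (subbundle_add dsu subS subU) hc).
- exact: (cont_form_proj cu subU (subbundle_add dsc subS subC) hu).
Qed.

Lemma splitting_dec x v : Gamma x -> v = v *m Ps x + v *m Pc x + v *m Pu x.
Proof.
move=> Gx; have [cs cc cu] := splitting_complementary spl; have [full _] := spl Gx.
have : v \in (Es x + Ec x + Eu x)%VS by rewrite full memvf.
move=> /memv_addP[_ /memv_addP[a aE [b bE ->]] [c cE ->]].
have aS (E1 E2 : M -> {vspace V}) z : z \in E1 x -> z \in (E1 x + E2 x)%VS.
  by move=> h; exact: (subvP (addvSl _ _)).
have bS (E1 E2 : M -> {vspace V}) z : z \in E2 x -> z \in (E1 x + E2 x)%VS.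
  by move=> h; exact: (subvP (addvSr _ _)).
rewrite !mulmxDl (proj_id cs Gx aE) (proj_ker cs Gx (aS Ec Eu b bE)) (proj_ker cs Gx (bS Ec Eu c cE)).
rewrite (proj_id cc Gx bE) (proj_ker cc Gx (aS Es Eu a aE)) (proj_ker cc Gx (bS Es Eu c cE)).
rewrite (proj_id cu Gx cE) (proj_ker cu Gx (aS Es Ec a aE)) (proj_ker cu Gx (bS Es Ec b bE)).
by rewrite !addr0 !add0r.
Qed.

Lemma assembled_inner (Hs Hc Hu : M -> 'M[R]_m) x : Gamma x ->
  inner_product (Hs x) -> inner_product (Hc x) -> inner_product (Hu x) ->
  inner_product (assembled Hs Hc Hu x).
Proof. by move=> Gx; apply: assembly_inner => v; exact: splitting_dec. Qed.

Lemma assembled_sectional (Hs Hc Hu : M -> 'M[R]_m) (x : M) (t lam sg cc uu aa : R) :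
  Gamma x -> 0 <= t ->
  (forall y, Gamma y -> [/\ inner_product (Hs y), inner_product (Hc y) & inner_product (Hu y)]) ->
  (forall v, v \in Es x ->
    dotg (Hs (phi t x)) (v *m DX t x) (v *m DX t x) <= expR (2 * sg) * dotg (Hs x) v v) ->
  (forall v, v \in Ec x ->
    expR (2 * cc) * dotg (Hc x) v v <= dotg (Hc (phi t x)) (v *m DX t x) (v *m DX t x)) ->
  (forall v, v \in Eu x ->
    expR (2 * uu) * dotg (Hu x) v v <= dotg (Hu (phi t x)) (v *m DX t x) (v *m DX t x)) ->
  (forall v w, frame2 (Ec x) v w -> gram2 (Hc (phi t x)) (v *m DX t x) (w *m DX t x) =
    expR (2 * aa) * gram2 (Hc x) v w) ->
  [/\ sg <= - lam, sg - cc <= - lam & sg - uu <= - lam] ->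
  [/\ lam <= aa, lam <= 2 * uu & lam <= cc + uu] ->
  let g := assembled Hs Hc Hu in
  [/\ normDX S X phi g t x Es * normDXV S X phi g t x F <= expR (- lam),
      normDX S X phi g t x Es <= expR (- lam) &
      forall L : {vspace V}, (L <= F x)%VS -> \dim L = 2%N ->
        expR lam <= detDX S X phi g t x L].
Proof.
move=> Gx t0 iH hs hc hu ha r1 r2 g; have [cs cc' cu] := splitting_complementary spl.
have Gt := inv t0 Gx.
have js : Ps x *m DX t x = DX t x *m Ps (phi t x).
  by apply: (proj_intertwine cs Gx Gt) => v vE; [exact: invS|exact: (add_inv invC invU)].
have jc : Pc x *m DX t x = DX t x *m Pc (phi t x).
  by apply: (proj_intertwine cc' Gx Gt) => v vE; [exact: invC|exact: (add_inv invS invU)].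
have ju : Pu x *m DX t x = DX t x *m Pu (phi t x).
  by apply: (proj_intertwine cu Gx Gt) => v vE; [exact: invU|exact: (add_inv invS invC)].
have [i1 i2 i3] := iH x Gx; have [j1 j2 j3] := iH _ Gt.
apply: (assembly_sectional (flow_diff_unit flow cptM x t0) (And3 js jc ju) _ (iH x Gx) (iH _ Gt)
  (assembled_inner Gx i1 i2 i3) (assembled_inner Gt j1 j2 j3) _ _ _ hs hc hu ha r1 r2).
- by split=> v; exact: proj_in.
- move=> v vE; split.
    by apply: (proj_ker cc' Gx); exact: (subvP (addvSl _ _)).
  by apply: (proj_ker cu Gx); exact: (subvP (addvSl _ _)).
- by move=> v vF; exact: (proj_ker cs Gx).
- exact: frame2_dim (frame_fst_snd subC Gx).
Qed.

End AdaptedMetric.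

(** * The sectional-adapted metric *)

Section Orbit.
Context {R : realType} {m : nat} {M : topologicalType}.
Variable S : smooth_manifold R m M.
Variables (X : M -> 'rV[R]_m) (phi : R -> M -> M) (Gamma : set M).
Hypothesis flow : is_flow S X phi.
Hypothesis cptM : compact [set: M].
Hypothesis inv : forall (t : R) (x : M), 0 <= t -> Gamma x -> Gamma (phi t x).

Lemma along_le (p q : M -> R) (c tau t : R) (x : M) :
  cont_fun Gamma p -> cont_fun Gamma q -> 0 <= t -> Gamma x ->
  (forall y, Gamma y -> p y + c <= q y) ->
  Int (along phi p x) tau (t + tau) + c * t <= Int (along phi q x) tau (t + tau).
Proof.
move=> cp cq t0 Gx le.
have tt : tau <= t + tau by rewrite lerDr.
have -> : c * t = c * (t + tau - tau) by rewrite addrK.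
apply: (Int_le_shift (along_continuous flow cptM inv cp Gx)
  (along_continuous flow cptM inv cq Gx) tt) => s _.
by apply: le; apply: inv => //; rewrite le_max lexx.
Qed.

Lemma along_ge_cst (p : M -> R) (c tau t : R) (x : M) :
  cont_fun Gamma p -> 0 <= t -> Gamma x -> (forall y, Gamma y -> c <= p y) ->
  c * t <= Int (along phi p x) tau (t + tau).
Proof.
move=> cp t0 Gx le; have c0 : cont_fun Gamma (fun=> c) by move=> y _; exact: cvg_cst.
have h : Int (along phi (fun=> c) x) tau (t + tau) + 0 * t <= Int (along phi p x) tau (t + tau).
  by apply: along_le => // y Gy; rewrite addr0; exact: le.
have tt : tau <= t + tau by rewrite lerDr.
have e : Int (along phi (fun=> c) x) tau (t + tau) = c * (t + tau - tau) by exact: (Int_cst c tt).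
by rewrite e addrK mul0r addr0 in h.
Qed.

Lemma along_le_cst (p : M -> R) (c tau t : R) (x : M) :
  cont_fun Gamma p -> 0 <= t -> Gamma x -> (forall y, Gamma y -> p y <= c) ->
  Int (along phi p x) tau (t + tau) <= c * t.
Proof.
move=> cp t0 Gx le; have c0 : cont_fun Gamma (fun=> c) by move=> y _; exact: cvg_cst.
have h : Int (along phi p x) tau (t + tau) + 0 * t <= Int (along phi (fun=> c) x) tau (t + tau).
  by apply: along_le => // y Gy; rewrite addr0; exact: le.
have tt : tau <= t + tau by rewrite lerDr.
have e : Int (along phi (fun=> c) x) tau (t + tau) = c * (t + tau - tau) by exact: (Int_cst c tt).
by rewrite e addrK mul0r addr0 in h.
Qed.

End Orbit.

Theorem theorem3 (R : realType) (m : nat) (M : topologicalType)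
  (S : smooth_manifold R m M)
  (X : M -> 'rV[R]_m) (phi : R -> M -> M)
  (g0 : M -> 'M[R]_m) (Gamma : set M)
  (Es Ec Eu : M -> {vspace 'rV[R]_m}) (ds du : nat) :
  (3 <= m)%N ->
  compact [set: M] -> connected [set: M] ->
  Ck_vector_field S 1 X -> inward_transverse S X -> is_flow S X phi ->
  riemannian_metric S g0 ->
  compact Gamma -> invariant_set S X phi Gamma ->
  subbundle S Gamma ds Es -> subbundle S Gamma 2 Ec ->
  subbundle S Gamma du Eu ->
  splitting Gamma Es Ec Eu ->
  invariant_bundle S X phi Gamma Es ->
  invariant_bundle S X phi Gamma Ec ->
  invariant_bundle S X phi Gamma Eu ->
  dominated_splitting S X phi g0 Gamma Es Ec Eu ->
  uniformly_contracted S X phi g0 Gamma Es ->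
  area_expanding S X phi g0 Gamma Ec ->
  uniformly_expanded S X phi g0 Gamma Eu ->
  strongly_partially_hyperbolic S X phi g0 Gamma Ec Eu ->
  let F := fun x => (Ec x + Eu x)%VS in
  exists (g : M -> 'M[R]_m) (lambda : R),
    [/\ riemannian_metric_on S Gamma g, 0 < lambda &
      forall (x : M) (t : R), Gamma x -> 0 < t ->
        [/\ normDX S X phi g t x Es * normDXV S X phi g t x F
              <= expR (- lambda * t),
            normDX S X phi g t x Es <= expR (- lambda * t) &
            forall L : {vspace 'rV[R]_m}, (L <= F x)%VS -> \dim L = 2%N ->
              expR (lambda * t) <= detDX S X phi g t x L]].
Proof.
move=> _ cptM _ _ _ flow rg cptG invG subS subC subU spl iS iC iU dom con are ex _ F.
have inv (t : R) (x : M) : 0 <= t -> Gamma x -> Gamma (phi t x).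
  by move=> _ Gx; have [_ <-] := invG t; exists x.
have invB (E : M -> {vspace 'rV[R]_m}) : invariant_bundle S X phi Gamma E ->
    forall (t : R) (x : M) (v : 'rV[R]_m), 0 <= t -> Gamma x -> v \in E x ->
      v *m flow_diff S X phi t x \in E (phi t x).
  by move=> iE t x v _ Gx vE; rewrite -(iE t x Gx); exact: push_mem.
have invS := invB _ iS; have invC := invB _ iC; have invU := invB _ iU.
have ig := rg.1; have cg := cont_form_metric (Gamma := Gamma) rg.
have [eps [T [e0 T1 hr]]] := rates flow cptM ig subC iC iU dom con are ex.
have T0 : 0 < T by exact: lt_le_trans T1.
pose D := area_rate S X phi g0 Ec T; pose K := hs_rate S X phi g0 Ec T.
have cD : cont_fun Gamma D by exact: (area_rate_cont_fun flow cptM inv ig cg subC (ltW T0)).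
have cK : cont_fun Gamma K by exact: (hs_rate_cont_fun flow cptM inv ig cg subC (ltW T0)).
have eD x : Gamma x -> expR (2 * T * D x) = area_growth S X phi g0 Ec T x.
  by move=> Gx; exact: (exp_area_rate flow cptM ig subC T0 Gx).
have eK x : Gamma x -> expR (2 * T * K x) = hs_growth S X phi g0 Ec T x.
  by move=> Gx; exact: (exp_hs_rate flow cptM ig subC T0 Gx).
have cc (c : R) : cont_fun Gamma (fun=> c) by move=> x _; exact: cvg_cst.
pose ps x := Num.min (- eps) (D x - K x - eps).
pose pu x := Num.max eps (K x + eps).
have cps : cont_fun Gamma ps.
  apply: cont_fun_min => //; move=> x Gx.
  by apply: cvgB; [apply: cvgB; [exact: cD|exact: cK]|exact: cvg_cst].
have cpu : cont_fun Gamma pu.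
  apply: cont_fun_max => //; move=> x Gx.
  by apply: cvgD; [exact: cK|exact: cvg_cst].
have ups x v : Gamma x -> v \in Es x ->
    dotg (pulled S X phi g0 T x) v v <= expR (2 * T * ps x) * dotg (g0 x) v v.
  move=> Gx vE; have [hs _ _] := hr x Gx; have [h1 h2] := hs v vE.
  have alg (q n d k e : R) : q <= expR (- (2 * T * e)) * n ->
      expR (2 * T * k) * q <= expR (- (2 * T * e)) * expR (2 * T * d) * n ->
      q <= expR (2 * T * Num.min (- e) (d - k - e)) * n.
    move=> a1 a2; case: (leP (- e) (d - k - e)) => _; first by rewrite mulrN.
    rewrite -(ler_pM2l (expR_gt0 (2 * T * k))); apply: le_trans a2 _.
    rewrite mulrA -!expRD le_eqVlt; apply/orP; left; apply/eqP.
    by congr (expR _ * _); ring.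
  by apply: alg h1 _; rewrite (eK x Gx) (eD x Gx).
have lou x v : Gamma x -> v \in Eu x ->
    expR (2 * T * pu x) * dotg (g0 x) v v <= dotg (pulled S X phi g0 T x) v v.
  move=> Gx vE; have [_ hu _] := hr x Gx; have [h1 h2] := hu v vE.
  have alg (q n k e : R) : n <= expR (- (2 * T * e)) * q ->
      expR (2 * T * k) * n <= expR (- (2 * T * e)) * q ->
      expR (2 * T * Num.max e (k + e)) * n <= q.
    have aux (z : R) : z <= expR (- (2 * T * e)) * q -> expR (2 * T * e) * z <= q.
      by move=> h; rewrite -ler_pdivlMl ?expR_gt0// -expRN.
    move=> a1 a2; case: (leP e (k + e)) => _; last exact: aux.
    have -> : 2 * T * (k + e) = 2 * T * e + 2 * T * k by ring.
    by rewrite expRD -mulrA; exact: aux.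
  by apply: alg h1 _; rewrite (eK x Gx).
have leD x : Gamma x -> eps <= D x.
  move=> Gx; have [_ _ h] := hr x Gx; rewrite -(eD x Gx) ler_expR in h.
  by rewrite ler_pM2l ?mulr_gt0// in h.
(* Each growth estimate loses [4 d] in the exponent of squared lengths; two of
   them are compared, so half of [eps] is left. *)
pose d := eps / 8.
have d0 : 0 < d by rewrite divr_gt0.
have [ts Hts] := adapted_upper flow cptM cptG inv ig cg invS cps T1 d0 ups.
have [tu Htu] := adapted_lower flow cptM cptG inv ig cg invU cpu T1 d0 lou.
have [tc Htc] := plane_adapted flow cptM cptG inv ig cg subC invC T1 d0.
(* One window for the three blocks: their rates are integrated over the same
   piece of orbit, hence can be compared pointwise. *)
pose tau := Num.max (Num.max ts tu) (Num.max tc 1).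
have [l1 l2 l3 l4] : [/\ ts <= tau, tu <= tau, tc <= tau & 1 <= tau].
  by rewrite /tau !le_max !lexx !orbT.
have [Hs [cHs iHs rs]] := Hts tau l1 l4.
have [Hu [cHu iHu ru]] := Htu tau l2 l4.
have [Hc [cHc iHc rc]] := Htc tau l3 l4.
pose g := assembled Es Ec Eu Hs Hc Hu.
exists g, (eps / 2); split.
- split; first by move=> x Gx; exact: (assembled_inner spl Gx (iHs x Gx) (iHc x Gx) (iHu x Gx)).
  move=> c ac; apply: (cont_form_within ac).
  exact: (assembled_cont_form subS subC subU spl cHs cHc cHu).
- by rewrite divr_gt0.
- move=> x t Gx t0; have t0' := ltW t0; rewrite mulNr.
  pose Is := Int (along phi ps x) tau (t + tau).
  pose Iu := Int (along phi pu x) tau (t + tau).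
  pose ID := Int (along phi D x) tau (t + tau).
  pose IK := Int (along phi K x) tau (t + tau).
  have [ar lo] := rc x t Gx t0'.
  have b1 : Is <= - eps * t.
    by apply: (along_le_cst flow cptM inv tau cps t0' Gx) => y _; rewrite ge_min lexx.
  have b2 : eps * t <= Iu.
    by apply: (along_ge_cst flow cptM inv tau cpu t0' Gx) => y _; rewrite le_max lexx.
  have b3 : eps * t <= ID by exact: (along_ge_cst flow cptM inv tau cD t0' Gx).
  have b4 : IK + eps * t <= Iu.
    by apply: (along_le flow cptM inv tau cK cpu t0' Gx) => y _; rewrite le_max lexx orbT.
  have b5 : Is + (IK + eps * t) <= ID.
    have cKp : cont_fun Gamma (fun y => ps y + K y).
      by move=> y Gy; apply: cvgD; [exact: cps|exact: cK].
    have h : Int (along phi (fun y => ps y + K y) x) tau (t + tau) + eps * t <= ID.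
      apply: (along_le flow cptM inv tau cKp cD t0' Gx) => y _.
      have : ps y <= D y - K y - eps by rewrite ge_min lexx orbT.
      by lra.
    have tt : tau <= t + tau by rewrite lerDr.
    have e : Int (along phi (fun y => ps y + K y) x) tau (t + tau) = Is + IK.
      exact: (IntD (along_continuous flow cptM inv cps Gx) (along_continuous flow cptM inv cK Gx) tt).
    by rewrite addrA -e.
  have b0 : 0 <= eps * t by rewrite mulr_ge0 ?ltW.
  have iH y : Gamma y -> [/\ inner_product (Hs y), inner_product (Hc y) & inner_product (Hu y)].
    by move=> Gy; split; [exact: iHs|exact: iHc|exact: iHu].
  apply: (assembled_sectional flow cptM inv subC spl invS invC invU (lam := eps / 2 * t)
    (sg := Is + 2 * d * t) (cc := ID - IK - 2 * d * t) (uu := Iu - 2 * d * t) (aa := ID)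
    Gx t0' iH _ _ _ ar).
  + move=> v vE; have h := rs x v t Gx vE t0'.
    by have -> : 2 * (Is + 2 * d * t) = 2 * Is + 4 * d * t by ring.
  + move=> v vE; have h := lo v vE.
    by have -> : 2 * (ID - IK - 2 * d * t) = 2 * (ID - IK) - 4 * d * t by ring.
  + move=> v vE; have h := ru x v t Gx vE t0'.
    by have -> : 2 * (Iu - 2 * d * t) = 2 * Iu - 4 * d * t by ring.
  + by rewrite /d; move: b0 b1 b2 b3 b4 b5; clear; split; lra.
  + by rewrite /d; move: b0 b1 b2 b3 b4 b5; clear; split; lra.
Qed.
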